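(* Let $([\cdot,\cdot]_n)_{n\ge0}$ be the sequence of Rankin–Cohen brackets on the algebra $\mathrm{JS}^\infty=\mathbb C[\wp,\partial_z\wp,\mathrm e_4,\mathrm E_1,\mathrm e_2]$ of singular quasi-Jacobi forms of index zero, defined by bilinear extension of $$[f,g]_n=\sum_{r=0}^n(-1)^r\binom{k+n-1}{n-r}\binom{\ell+n-1}{r}\partial_\tau^r(f)\,\partial_\tau^{n-r}(g)\qquad(f\in\mathrm{JS}^\infty_k,\ g\in\mathrm{JS}^\infty_\ell).$$ The subalgebra $\mathrm{JS}^{0,\infty}=\mathbb C[\wp,\partial_z\wp,\mathrm e_4,\mathrm E_1]$ of quasi-Jacobi forms of quasielliptic type is stable under this sequence: $[f,g]_n\in\mathrm{JS}^{0,\infty}$ for all $f,g\in\mathrm{JS}^{0,\infty}$ and all $n\ge0$.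
   Context: $\mathcal H$ is the upper half-plane. All functions are functions of $(\tau,z)\in\mathcal H\times\mathbb C$, possibly with poles in $z$ at $\mathbb Z\oplus\tau\mathbb Z$; functions of $\tau$ alone are viewed as functions of $(\tau,z)$. $\partial_z=\partial/\partial z$ and $\partial_\tau=\frac{\pi}{2i}\frac{\partial}{\partial\tau}$. $\wp(\tau,z)=\frac1{z^2}+\sum_{w\in(\mathbb Z\oplus\tau\mathbb Z)\setminus\{0\}}\left(\frac1{(z-w)^2}-\frac1{w^2}\right)$; $\mathrm e_4(\tau)=\sum_{w\in(\mathbb Z\oplus\tau\mathbb Z)\setminus\{0\}}w^{-4}$; $\mathrm e_2(\tau)=\frac{\pi^2}3\left(1-24\sum_{n\ge1}\sigma_1(n)e^{2i\pi n\tau}\right)$ with $\sigma_1(n)=\sum_{d\mid n}d$; $\mathrm E_1(\tau,z)=\lim_{N\to\infty}\sum_{n=-N}^N\left(\lim_{M\to\infty}\sum_{m=-M}^M\frac1{z+m+n\tau}\right)$. The five functions $\wp,\partial_z\wp,\mathrm e_4,\mathrm E_1,\mathrm e_2$ are algebraically independent and $\mathrm{JS}^\infty$ is graded by weight, with these generators of weights $2,3,4,1,2$ respectively; $\mathrm{JS}^\infty_k$ is the weight-$k$ component. $\mathrm{JS}^\infty$ is stable under $\partial_\tau$ and $\partial_z$. *)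

(* Defs.v *)
(* Stdlib reals with Coquelicot; natural-number binomials and divisors come
   from MathComp. *)
From Stdlib Require Export Reals ZArith List.
From Coquelicot Require Export Coquelicot.
From mathcomp Require seq prime binomial.
Export ListNotations.

Open Scope C_scope.

(* A function of (tau, z) is a total map, but only its values at the points of
   [dom] are meaningful: two functions are identified when they agree there. *)
Definition fn : Type := C -> C -> C.

Definition lattice (tau w : C) : Prop :=
  exists m n : Z, w = RtoC (IZR m) + RtoC (IZR n) * tau.

Definition dom (tau z : C) : Prop := (0 < Im tau)%R /\ ~ lattice tau z.

Definition eqD (f g : fn) : Prop :=
  forall tau z : C, dom tau z -> f tau z = g tau z.

Definition fconst (c : C) : fn := fun _ _ => c.
Definition fadd (f g : fn) : fn := fun tau z => f tau z + g tau z.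
Definition fmul (f g : fn) : fn := fun tau z => f tau z * g tau z.
Definition fscal (c : C) (f : fn) : fn := fun tau z => c * f tau z.

Definition dz (f : fn) : fn := fun tau z => C_derive (fun w => f tau w) z.

Definition dtau (f : fn) : fn :=
  fun tau z => RtoC PI / (2 * Ci) * C_derive (fun t => f t z) tau.

Definition lim_along {T : Type} (F : (T -> Prop) -> Prop) (u : T -> C) : C :=
  iota (fun l : C_CompleteNormedModule => filterlim u F (locally l)).

Definition Clim_seq (u : nat -> C) : C := lim_along eventually u.

(* The net of the finite subsets of D, a finite subset being a duplicate-free
   list of elements of D. *)
Definition finite_subsets {I : Type} (D : I -> Prop) : (list I -> Prop) -> Prop :=
  fun P => exists l0 : list I, NoDup l0 /\ List.Forall D l0 /\
    forall l : list I, NoDup l -> List.Forall D l -> incl l0 l -> P l.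

(* Unordered sum of a over D, the limit of its finite partial sums. *)
Definition sum_over {I : Type} (D : I -> Prop) (a : I -> C) : C :=
  lim_along (finite_subsets D)
    (fun l => fold_right (fun i s => a i + s) (RtoC 0) l).

Definition lattice_sum (tau : C) (a : C -> C) : C :=
  sum_over (fun w => lattice tau w /\ w <> 0) a.

Definition sum_sym (N : nat) (a : Z -> C) : C :=
  sum_n (fun j => a (Z.of_nat j - Z.of_nat N)%Z) (2 * N).

Definition Cexp (z : C) : C :=
  RtoC (exp (Re z)) * (RtoC (cos (Im z)) + Ci * RtoC (sin (Im z))).

Definition sigma1 (n : nat) : nat := seq.sumn (prime.divisors n).

Definition wp : fn := fun tau z =>
  1 / z ^ 2 + lattice_sum tau (fun w => 1 / (z - w) ^ 2 - 1 / w ^ 2).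

Definition e4 : fn := fun tau _ => lattice_sum tau (fun w => 1 / w ^ 4).

Definition e2 : fn := fun tau _ =>
  RtoC PI ^ 2 / 3 *
  (1 - 24 * Clim_seq (sum_n (fun n =>
     RtoC (INR (sigma1 (S n))) *
     Cexp (2 * Ci * RtoC PI * RtoC (INR (S n)) * tau)))).

Definition E1 : fn := fun tau z =>
  Clim_seq (fun N => sum_sym N (fun n =>
    Clim_seq (fun M => sum_sym M (fun m =>
      1 / (z + RtoC (IZR m) + RtoC (IZR n) * tau))))).

Inductive subalg (gens : list fn) : fn -> Prop :=
| subalg_const c : subalg gens (fconst c)
| subalg_gen g : In g gens -> subalg gens g
| subalg_add f g : subalg gens f -> subalg gens g -> subalg gens (fadd f g)
| subalg_mul f g : subalg gens f -> subalg gens g -> subalg gens (fmul f g)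
| subalg_ext f g : eqD f g -> subalg gens f -> subalg gens g.

(* [homog gens k] is the linear span of the monomials of weight k in the
   weighted generators [gens]; scalars are constants, of weight 0. *)
Inductive homog (gens : list (nat * fn)) : nat -> fn -> Prop :=
| homog_const c : homog gens 0 (fconst c)
| homog_gen k g : In (k, g) gens -> homog gens k g
| homog_add k f g :
    homog gens k f -> homog gens k g -> homog gens k (fadd f g)
| homog_mul k l f g :
    homog gens k f -> homog gens l g -> homog gens (k + l) (fmul f g)
| homog_ext k f g : eqD f g -> homog gens k f -> homog gens k g.

Definition JS0_gens : list (nat * fn) :=
  [(2, wp); (3, dz wp); (4, e4); (1, E1)]%nat.
Definition JSinf_gens : list (nat * fn) := JS0_gens ++ [(2%nat, e2)].

Definition JSinf : fn -> Prop := subalg (map snd JSinf_gens).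
Definition JSinf_wt : nat -> fn -> Prop := homog JSinf_gens.
Definition JS0 : fn -> Prop := subalg (map snd JS0_gens).

(* MathComp's binomial vanishes when the lower index exceeds the upper one.
   The truncated k + n - 1 is 0 instead of -1 only for k = n = 0, and then the
   lower index is 0, so the coefficient is 1 in either reading. *)
Definition rc_homog (n k l : nat) (f g : fn) : fn := fun tau z =>
  sum_n (fun r =>
    (- 1) ^ r *
    RtoC (INR (binomial.binomial (k + n - 1) (n - r))) *
    RtoC (INR (binomial.binomial (l + n - 1) r)) *
    Nat.iter r dtau f tau z * Nat.iter (n - r) dtau g tau z) n.

(* Since JSinf is the direct sum of its weight components, these conditions
   determine B n on JSinf x JSinf, up to eqD, as the bilinear extension of
   rc_homog. *)
Record is_rankin_cohen (B : nat -> fn -> fn -> fn) : Prop := {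
  rc_ext : forall n f f' g g', JSinf f -> JSinf g ->
    eqD f f' -> eqD g g' -> eqD (B n f g) (B n f' g');
  rc_addl : forall n f1 f2 g, JSinf f1 -> JSinf f2 -> JSinf g ->
    eqD (B n (fadd f1 f2) g) (fadd (B n f1 g) (B n f2 g));
  rc_addr : forall n f g1 g2, JSinf f -> JSinf g1 -> JSinf g2 ->
    eqD (B n f (fadd g1 g2)) (fadd (B n f g1) (B n f g2));
  rc_scall : forall n c f g, JSinf f -> JSinf g ->
    eqD (B n (fscal c f) g) (fscal c (B n f g));
  rc_scalr : forall n c f g, JSinf f -> JSinf g ->
    eqD (B n f (fscal c g)) (fscal c (B n f g));
  rc_wt : forall n k l f g, JSinf_wt k f -> JSinf_wt l g ->
    eqD (B n f g) (rc_homog n k l f g)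
}.

(* Main.v *)
Require Import Defs.
From Stdlib Require Import Lra Lia ClassicalEpsilon Permutation FunctionalExtensionality.

(* Let X = e2 / 4. Every generator f of JS0, of weight k, satisfies dtau f = k X f + (element of
   JS0 of weight k + 2), and dtau X = X^2 - (5/16) e4. Hence for f of weight k >= 1 the sequence
   phi_0 = f, (s+1)(k+s) phi_(s+1) = d phi_s - (5/16) e4 phi_(s-1), where d is dtau without its
   X-part, stays in JS0, and up to a constant dtau^r f = sum_j X^j/j! phi_(r-j). The bracket of f
   and g is then a multiple of the degree-n coefficient of
   exp(-X T) phi_f(-T) * exp(X T) phi_g(T), in which X cancels. In weight 0 only constants occur.

   The formulas for dtau on the generators come from writing all functions as sums over n of
   pi cot and its derivatives at z + n tau. With c_n = pi cot pi(z + n tau), s_n = -c_n', the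
   addition formulas for c_x c_y, s_x c_y and s_x s_y, summed over Z x Z, express E1 * sum s_n,
   (sum s_n)^2 and the square of sum_(n <> 0) s(n tau) through the simple sums. These three identities
   are the heat equation for E1, the equation wp'' = 6 wp^2 - 30 e4 and Ramanujan's formula for
   dtau e2; the remaining formulas follow by differentiating them in z. *)

(** * Unordered sums *)

(** In weight k, dtau - k X is a derivation of Serre type: e2 enters the derivative of each
    generator of JS0 only through weight times X, and dtau X - X^2 lies in JS0 again. The algebraic
    half rests on these two facts. Its recursion divides by k + s, which is zero for k = s = 0;
    hence the separate treatment of weight 0. The obstacle is analytic. The limits, lattice sums and
    derivatives of the statement are total operators, meaningful only where convergence or
    differentiability has been established, and the derivative in tau acts on double series. Summing
    each row of the lattice in closed form leaves single series in n that decay exponentially,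
    locally uniformly in (tau, z); these may be multiplied, reordered and differentiated term by
    term. The quadratic identities then compare row and column sums. The terms of the series for E1
    have opposite nonzero limits at the two ends; this jump of 2 pi i, seen under a shift of the
    index, is the source of the terms weighted by n. *)

Definition lsum {I : Type} (a : I -> C) (l : list I) : C :=
  fold_right (fun i s => a i + s) (RtoC 0) l.
Definition rsum {I : Type} (a : I -> R) (l : list I) : R :=
  fold_right (fun i s => (a i + s)%R) 0%R l.

(** Convergence along [finite_subsets] without a constraint, in epsilon form. Sums over a subset are
    taken over the whole type after extension by zero with [restr], so that one notion serves rows,
    columns and fibres. *)
Definition has_sum {I : Type} (a : I -> C) (s : C) : Prop :=
  forall eps : R, (0 < eps)%R -> exists l0, NoDup l0 /\
    forall l, NoDup l -> incl l0 l -> (Cmod (lsum a l - s) < eps)%R.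
Definition bdd_sums {I : Type} (b : I -> R) : Prop :=
  exists M, forall l, NoDup l -> (rsum b l <= M)%R.
Definition summable {I : Type} (a : I -> C) : Prop :=
  bdd_sums (fun i => Cmod (a i)).
Definition restr {I : Type} (P : I -> Prop) (a : I -> C) (i : I) : C :=
  if excluded_middle_informative (P i) then a i else 0.

Lemma restr_in {I} (P : I -> Prop) a i : P i -> restr P a i = a i.
Proof. unfold restr; destruct (excluded_middle_informative _); tauto. Qed.
Lemma restr_out {I} (P : I -> Prop) a i : ~ P i -> restr P a i = 0.
Proof. unfold restr; destruct (excluded_middle_informative _); tauto. Qed.

Definition filt {I} (P : I -> Prop) (l : list I) : list I :=
  filter (fun i => if excluded_middle_informative (P i) then true else false) l.
Lemma filt_In {I} (P : I -> Prop) l i : In i (filt P l) <-> In i l /\ P i.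
Proof.
  unfold filt; rewrite filter_In; destruct (excluded_middle_informative _);
    intuition discriminate.
Qed.
Lemma filt_NoDup {I} (P : I -> Prop) l : NoDup l -> NoDup (filt P l).
Proof. apply NoDup_filter. Qed.

Lemma lsum_app {I} (a : I -> C) l1 l2 : lsum a (l1 ++ l2) = lsum a l1 + lsum a l2.
Proof. induction l1; simpl; [ring | rewrite IHl1; ring]. Qed.
Lemma rsum_app {I} (a : I -> R) l1 l2 :
  rsum a (l1 ++ l2) = (rsum a l1 + rsum a l2)%R.
Proof. induction l1; simpl; [ring | rewrite IHl1; ring]. Qed.
Lemma lsum_perm {I} (a : I -> C) l1 l2 : Permutation l1 l2 -> lsum a l1 = lsum a l2.
Proof. induction 1; simpl; try congruence; ring. Qed.
Lemma rsum_perm {I} (a : I -> R) l1 l2 : Permutation l1 l2 -> rsum a l1 = rsum a l2.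
Proof. induction 1; simpl; try congruence; ring. Qed.
Lemma lsum_ext {I} (a b : I -> C) l :
  (forall i, In i l -> a i = b i) -> lsum a l = lsum b l.
Proof.
  induction l; simpl; intros H; auto. rewrite H, IHl; auto.
Qed.
Lemma lsum_zero {I} (a : I -> C) l : (forall i, In i l -> a i = 0) -> lsum a l = 0.
Proof.
  induction l; simpl; intros H; auto. rewrite H, IHl; auto. ring.
Qed.
Lemma rsum_le {I} (a b : I -> R) l :
  (forall i, In i l -> (a i <= b i)%R) -> (rsum a l <= rsum b l)%R.
Proof.
  induction l; simpl; intros H; [lra|]. pose proof (H a0 (or_introl eq_refl)).
  assert (rsum a l <= rsum b l)%R by auto. lra.
Qed.
Lemma rsum_ge0 {I} (a : I -> R) l : (forall i, (0 <= a i)%R) -> (0 <= rsum a l)%R.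
Proof. intros H; induction l; simpl; [lra|]. specialize (H a0). lra. Qed.
Lemma rsum_scal {I} k (a : I -> R) l : rsum (fun i => k * a i)%R l = (k * rsum a l)%R.
Proof. induction l; simpl; [ring|rewrite IHl; ring]. Qed.
Lemma lsum_plus {I} (a b : I -> C) l : lsum (fun i => a i + b i) l = lsum a l + lsum b l.
Proof. induction l; simpl; [ring|rewrite IHl; ring]. Qed.
Lemma lsum_scal {I} k (a : I -> C) l : lsum (fun i => k * a i) l = k * lsum a l.
Proof. induction l; simpl; [ring|rewrite IHl; ring]. Qed.
Lemma lsum_map {I J} (f : J -> I) (a : I -> C) l :
  lsum a (map f l) = lsum (fun j => a (f j)) l.
Proof. induction l; simpl; congruence. Qed.
Lemma rsum_map {I J} (f : J -> I) (a : I -> R) l :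
  rsum a (map f l) = rsum (fun j => a (f j)) l.
Proof. induction l; simpl; congruence. Qed.
Lemma Cmod_lsum {I} (a : I -> C) l : (Cmod (lsum a l) <= rsum (fun i => Cmod (a i)) l)%R.
Proof.
  induction l; simpl. rewrite Cmod_0; lra.
  eapply Rle_trans; [apply Cmod_triangle|]. lra.
Qed.

Lemma incl_perm {I} (l0 l : list I) : NoDup l0 -> NoDup l -> incl l0 l ->
  Permutation l (l0 ++ filt (fun i => ~ In i l0) l).
Proof.
  intros H0 H Hi. apply NoDup_Permutation; auto.
  - apply NoDup_app; auto. now apply filt_NoDup.
    intros i Hi0. rewrite filt_In. tauto.
  - intros i. rewrite in_app_iff, filt_In. specialize (Hi i).
    destruct (classic (In i l0)); tauto.
Qed.
Lemma rsum_incl {I} (b : I -> R) l0 l : (forall i, (0 <= b i)%R) ->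
  NoDup l0 -> NoDup l -> incl l0 l -> (rsum b l0 <= rsum b l)%R.
Proof.
  intros Hb H0 H Hi. rewrite (rsum_perm _ _ _ (incl_perm _ _ H0 H Hi)), rsum_app.
  pose proof (rsum_ge0 b (filt (fun i => ~ In i l0) l) Hb). lra.
Qed.

Lemma union_list {I} (l1 l2 : list I) : NoDup l1 -> NoDup l2 ->
  exists l, NoDup l /\ incl l1 l /\ incl l2 l.
Proof.
  intros H1 H2. exists (l1 ++ filt (fun i => ~ In i l1) l2). repeat split.
  - apply NoDup_app; auto. now apply filt_NoDup.
    intros i Hi0. rewrite filt_In. tauto.
  - intros i; rewrite in_app_iff; auto.
  - intros i; rewrite in_app_iff, filt_In. destruct (classic (In i l1)); tauto.
Qed.
Lemma nodup_list {I} (l : list I) : exists l', NoDup l' /\ forall i, In i l' <-> In i l.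
Proof.
  induction l as [|x l [l' [H1 H2]]]. exists nil; split; [constructor|tauto].
  destruct (classic (In x l)).
  - exists l'; split; auto. intros i; rewrite H2; simpl; split; auto.
    intros [<-|]; auto.
  - exists (x :: l'); split. constructor; auto. now rewrite H2.
    intros i; simpl; rewrite H2; tauto.
Qed.

Lemma Cmod_sub_sym a b : Cmod (a - b) = Cmod (b - a).
Proof. rewrite <- Cmod_opp. f_equal; ring. Qed.
Lemma Cmod_sub_tri a b c : (Cmod (a - c) <= Cmod (a - b) + Cmod (b - c))%R.
Proof. replace (a - c) with ((a - b) + (b - c)) by ring. apply Cmod_triangle. Qed.
Lemma Csub_0 a b : a - b = 0 -> a = b.
Proof. intros H. replace a with ((a - b) + b) by ring. rewrite H; ring. Qed.
Lemma Cmod_small_eq a b : (forall eps, (0 < eps)%R -> (Cmod (a - b) < eps)%R) -> a = b.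
Proof.
  intros H. apply Csub_0, Cmod_eq_0.
  destruct (Rle_lt_or_eq_dec 0 (Cmod (a - b)) (Cmod_ge_0 _)); auto.
  specialize (H _ r); lra.
Qed.

Lemma has_sum_unique {I} (a : I -> C) s t : has_sum a s -> has_sum a t -> s = t.
Proof.
  intros Hs Ht. apply Cmod_small_eq. intros e He.
  destruct (Hs (e/2)%R) as [l1 [N1 H1]]; [lra|].
  destruct (Ht (e/2)%R) as [l2 [N2 H2]]; [lra|].
  destruct (union_list l1 l2 N1 N2) as [l [N [i1 i2]]].
  specialize (H1 l N i1); specialize (H2 l N i2).
  pose proof (Cmod_sub_tri s (lsum a l) t). rewrite (Cmod_sub_sym s (lsum a l)) in H. lra.
Qed.
Lemma has_sum_ext {I} (a b : I -> C) s : (forall i, a i = b i) -> has_sum a s -> has_sum b s.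
Proof.
  intros E H e He. destruct (H e He) as [l0 [N H0]]. exists l0; split; auto.
  intros l Nl Hl. rewrite <- (lsum_ext a b); auto.
Qed.
Lemma has_sum_plus {I} (a b : I -> C) s t : has_sum a s -> has_sum b t ->
  has_sum (fun i => a i + b i) (s + t).
Proof.
  intros Hs Ht e He.
  destruct (Hs (e/2)%R) as [l1 [N1 H1]]; [lra|].
  destruct (Ht (e/2)%R) as [l2 [N2 H2]]; [lra|].
  destruct (union_list l1 l2 N1 N2) as [l [N [i1 i2]]].
  exists l; split; auto. intros k Nk Hk.
  specialize (H1 k Nk (fun i h => Hk i (i1 i h))).
  specialize (H2 k Nk (fun i h => Hk i (i2 i h))).
  rewrite lsum_plus.
  replace (lsum a k + lsum b k - (s + t)) with ((lsum a k - s) + (lsum b k - t)) by ring.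
  eapply Rle_lt_trans; [apply Cmod_triangle|]. lra.
Qed.
Lemma has_sum_scal {I} k (a : I -> C) s : has_sum a s -> has_sum (fun i => k * a i) (k * s).
Proof.
  intros H e He. pose proof (Cmod_ge_0 k) as Hk0.
  destruct (H (e / (Cmod k + 1))%R) as [l0 [N H0]].
  { apply Rdiv_lt_0_compat; lra. }
  exists l0; split; auto. intros l Nl Hl. specialize (H0 l Nl Hl).
  rewrite lsum_scal. replace (k * lsum a l - k * s) with (k * (lsum a l - s)) by ring.
  rewrite Cmod_mult. apply Rmult_lt_compat_r with (r := (Cmod k + 1)%R) in H0; [|lra].
  unfold Rdiv in H0; rewrite Rmult_assoc, Rinv_l, Rmult_1_r in H0 by lra.
  pose proof (Cmod_ge_0 (lsum a l - s)). nra.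
Qed.
Lemma has_sum_minus {I} (a b : I -> C) s t : has_sum a s -> has_sum b t ->
  has_sum (fun i => a i - b i) (s - t).
Proof.
  intros Hs Ht. replace (s - t) with (s + (-(1)) * t) by ring.
  eapply has_sum_ext; [|exact (has_sum_plus _ _ _ _ Hs (has_sum_scal (-(1)) _ _ Ht))].
  intros i; simpl; ring.
Qed.
Lemma has_sum_finite {I} (a : I -> C) l0 : NoDup l0 ->
  (forall i, ~ In i l0 -> a i = 0) -> has_sum a (lsum a l0).
Proof.
  intros N H e He. exists l0; split; auto. intros l Nl Hl.
  rewrite (lsum_perm _ _ _ (incl_perm _ _ N Nl Hl)), lsum_app.
  rewrite (lsum_zero a (filt _ _)).
  replace (lsum a l0 + 0 - lsum a l0) with (RtoC 0) by ring. now rewrite Cmod_0.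
  intros i; rewrite filt_In; intros [_ Hi]; auto.
Qed.
Lemma has_sum_0 {I} : has_sum (fun _ : I => RtoC 0) 0.
Proof. apply (has_sum_finite (fun _ : I => RtoC 0) nil). constructor. auto. Qed.
Lemma has_sum_single {I} (a : I -> C) i0 : (forall i, i <> i0 -> a i = 0) -> has_sum a (a i0).
Proof.
  intros H. replace (a i0) with (lsum a [i0]) by (simpl; ring).
  apply has_sum_finite. constructor; auto. constructor.
  intros i Hi; apply H; intros ->; apply Hi; now left.
Qed.

(* A partial bijection [f] from [P] onto the support of [b]. *)
Lemma has_sum_reindex {I J} (f : J -> I) (P : J -> Prop) (a : J -> C) (b : I -> C) s :
  (forall j j', P j -> P j' -> f j = f j' -> j = j') ->
  (forall j, ~ P j -> a j = 0) ->
  (forall i, (forall j, P j -> f j <> i) -> b i = 0) ->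
  (forall j, P j -> a j = b (f j)) ->
  has_sum a s -> has_sum b s.
Proof.
  intros inj a0 b0 ab H e He. destruct (H e He) as [l0 [N H0]].
  assert (Nm : forall l, NoDup l -> (forall j, In j l -> P j) -> NoDup (map f l)).
  { induction l; simpl; intros Hl HP; constructor; inversion Hl; subst; auto.
    rewrite in_map_iff; intros [j [E Hj]]. apply inj in E; auto. subst; auto. }
  exists (map f (filt P l0)). split.
  { apply Nm. now apply filt_NoDup. intros j; rewrite filt_In; tauto. }
  intros l Nl Hl.
  (* [l1] lists the points of P mapped into l. Adding the entries of [l0] outside P, where a
     vanishes, then gives a list that contains [l0]. *)
  assert (X : exists l1, NoDup l1 /\ (forall j, In j l1 <-> P j /\ In (f j) l)
                         /\ lsum a l1 = lsum b l).
  { clear Hl. induction l as [|i l IH].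
    - exists nil; split; [constructor|]. split; auto. intros; simpl; tauto.
    - inversion Nl; subst. destruct IH as [l1 [N1 [I1 S1]]]; auto.
      destruct (classic (exists j, P j /\ f j = i)) as [[j [Pj Ej]]|no].
      + exists (j :: l1). split. { constructor; auto. rewrite I1, Ej. tauto. }
        split. 2: simpl; rewrite S1, ab, Ej; auto.
        intros j'; simpl. rewrite I1. split.
        * intros [<-|[? ?]]; auto.
        * intros [Pj' [E|E]]; auto. left; apply inj; auto; congruence.
      + exists l1. split; auto. split.
        * intros j; rewrite I1; simpl; split; [tauto|]. intros [Pj [E|?]]; auto.
          exfalso; eauto.
        * simpl. rewrite S1, b0. ring. intros j Pj E; eauto. }
  destruct X as [l1 [N1 [I1 S1]]].
  rewrite <- S1.
  replace (lsum a l1) with (lsum a (l1 ++ filt (fun j => ~ P j) l0)).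
  2:{ rewrite lsum_app, (lsum_zero _ (filt _ _)). ring.
      intros j; rewrite filt_In; intros [_ ?]; auto. }
  apply H0.
  - apply NoDup_app; auto. now apply filt_NoDup.
    intros j; rewrite I1, filt_In; tauto.
  - intros j Hj. rewrite in_app_iff, I1, filt_In.
    destruct (classic (P j)); [left; split; auto|tauto].
    apply Hl, in_map, filt_In; auto.
Qed.

Lemma has_sum_bij {I J} (f : J -> I) (g : I -> J) (b : I -> C) s :
  (forall j, g (f j) = j) -> (forall i, f (g i) = i) ->
  has_sum (fun j => b (f j)) s -> has_sum b s.
Proof.
  intros gf fg. apply (has_sum_reindex f (fun _ => True)); auto.
  - intros j j' _ _ E. now rewrite <- (gf j), E, gf.
  - tauto.
  - intros i Hi. exfalso; apply (Hi (g i)); auto.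
Qed.

Lemma finite_subsets_filter {I} (D : I -> Prop) : ProperFilter (finite_subsets D).
Proof.
  split.
  - intros P [l0 [N [F H]]]. exists l0. apply H; auto. intros i; auto.
  - split.
    + exists nil; split; [constructor|]. split; auto.
    + intros P Q [l1 [N1 [F1 H1]]] [l2 [N2 [F2 H2]]].
      destruct (union_list l1 l2 N1 N2) as [l [N [i1 i2]]].
      exists (filt D l). split. now apply filt_NoDup.
      rewrite Forall_forall in F1, F2.
      split. { rewrite Forall_forall; intros i; rewrite filt_In; tauto. }
      intros k Nk Fk Hk. split; [apply H1|apply H2]; auto;
        intros i Hi; apply Hk, filt_In; auto.
    + intros P Q PQ [l0 [N [F H]]]. exists l0; auto.
Qed.

Lemma Cball_of_Cmod (x y : C) (e : posreal) :
  (Cmod (y - x) < e)%R -> @ball C_UniformSpace x e y.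
Proof. intros H. apply (C_NormedModule_mixin_compat1 x y e H). Qed.
Lemma Cmod_of_Cball (x y : C) (e : posreal) :
  @ball C_UniformSpace x e y -> (Cmod (y - x) < 2 * e)%R.
Proof.
  intros H. apply C_NormedModule_mixin_compat2 in H.
  eapply Rlt_le_trans; [exact H|]. apply Rmult_le_compat_r. apply Rlt_le, cond_pos.
  apply Rsqr_incr_0; try lra. rewrite Rsqr_sqrt; unfold Rsqr; lra. apply sqrt_pos.
Qed.

(** The partial sums of the moduli have a supremum S. A list within e of S leaves less than e for
    any disjoint list, so the partial sums of a are Cauchy. *)
Lemma summable_has_sum {I} (a : I -> C) : summable a -> exists s, has_sum a s.
Proof.
  intros [M HM].
  set (E := fun x => exists l, NoDup l /\ x = rsum (fun i => Cmod (a i)) l).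
  destruct (completeness E) as [S [HS1 HS2]].
  { exists M. intros x [l [N ->]]; auto. }
  { exists 0%R. exists nil. split; auto. constructor. }
  assert (key : forall eps : R, (0 < eps)%R -> exists l0, NoDup l0 /\
     forall l, NoDup l -> incl l0 l -> (Cmod (lsum a l - lsum a l0) < eps)%R).
  { intros e He. destruct (classic (exists l0, NoDup l0 /\
      (S - e < rsum (fun i => Cmod (a i)) l0)%R)) as [[l0 [N H0]]|no].
    - exists l0; split; auto. intros l Nl Hl.
      pose proof (incl_perm _ _ N Nl Hl) as Pm.
      assert (B : (rsum (fun i => Cmod (a i)) l <= S)%R) by (apply HS1; exists l; auto).
      rewrite (rsum_perm _ _ _ Pm), rsum_app in B.
      rewrite (lsum_perm _ _ _ Pm), lsum_app.
      match goal with |- (Cmod (?u + ?v - ?u) < _)%R =>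
        replace (u + v - u) with v by ring end.
      eapply Rle_lt_trans; [apply Cmod_lsum|]. lra.
    - exfalso. assert (S <= S - e)%R; [|lra]. apply HS2. intros x [l [N ->]].
      apply Rnot_lt_le; intros L; apply no; exists l; auto. }
  pose proof (finite_subsets_filter (fun _ : I => True)) as PF.
  destruct (proj1 (@filterlim_locally_cauchy (list I) C_CompleteNormedModule
     (finite_subsets (fun _ : I => True)) PF (lsum a))) as [s Hs].
  { intros e. destruct (key (e/2)%R) as [l0 [N H0]]. { destruct e; simpl; lra. }
    exists (fun l => NoDup l /\ incl l0 l). split.
    - exists l0. split; auto. split. rewrite Forall_forall; auto. intros; auto.
    - intros u v [Nu Hu] [Nv Hv]. apply Cball_of_Cmod.
      pose proof (H0 u Nu Hu). pose proof (H0 v Nv Hv).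
      pose proof (Cmod_sub_tri (lsum a v) (lsum a l0) (lsum a u)).
      pose proof (Cmod_sub_sym (lsum a l0) (lsum a u)). lra. }
  exists s. intros e He.
  assert (He2 : (0 < e / 2)%R) by lra.
  destruct (proj1 (filterlim_locally _ _) Hs (mkposreal _ He2)) as [l0 [N [F H0]]].
  exists l0; split; auto. intros l Nl Hl.
  assert (Fl : List.Forall (fun _ : I => True) l) by (rewrite Forall_forall; auto).
  specialize (H0 l Nl Fl Hl). apply Cmod_of_Cball in H0. simpl in H0. lra.
Qed.

Lemma has_sum_bound {I} (a : I -> C) s M : has_sum a s ->
  (forall l, NoDup l -> (rsum (fun i => Cmod (a i)) l <= M)%R) -> (Cmod s <= M)%R.
Proof.
  intros H HM. apply le_epsilon. intros e He. destruct (H e He) as [l0 [N H0]].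
  specialize (H0 l0 N (incl_refl _)). specialize (HM l0 N).
  pose proof (Cmod_lsum a l0).
  pose proof (Cmod_triangle (s - lsum a l0) (lsum a l0)).
  replace (s - lsum a l0 + lsum a l0) with s in H2 by ring.
  rewrite Cmod_sub_sym in H0. lra.
Qed.

Lemma bdd_sums_le {I} (a b : I -> R) : (forall i, (a i <= b i)%R) ->
  bdd_sums b -> bdd_sums a.
Proof.
  intros H [M HM]. exists M. intros l N. eapply Rle_trans; [apply rsum_le|]; eauto.
Qed.
Lemma bdd_sums_scal {I} k (a : I -> R) : (0 <= k)%R -> bdd_sums a ->
  bdd_sums (fun i => k * a i)%R.
Proof.
  intros Hk [M HM]. exists (k * M)%R. intros l N. rewrite rsum_scal.
  apply Rmult_le_compat_l; auto.
Qed.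
Lemma bdd_sums_inj {I J} (f : J -> I) (b : I -> R) :
  (forall j j', f j = f j' -> j = j') -> bdd_sums b -> bdd_sums (fun j => b (f j)).
Proof.
  intros inj [M HM]. exists M. intros l N. rewrite <- rsum_map. apply HM.
  apply FinFun.Injective_map_NoDup; auto.
Qed.

Lemma list_prod_NoDup {I J} (l1 : list I) (l2 : list J) :
  NoDup l1 -> NoDup l2 -> NoDup (list_prod l1 l2).
Proof.
  induction 1; simpl; intros; [constructor|]. apply NoDup_app; auto.
  - apply FinFun.Injective_map_NoDup; auto. intros u v E; congruence.
  - intros [u v]. rewrite in_map_iff, in_prod_iff. intros [? [E ?]]. inversion E; subst.
    tauto.
Qed.
Lemma rsum_prod {I J} (b : I * J -> R) l1 l2 :
  rsum b (list_prod l1 l2) = rsum (fun i => rsum (fun j => b (i, j)) l2) l1.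
Proof.
  induction l1; simpl; auto. rewrite rsum_app, rsum_map, IHl1. reflexivity.
Qed.

Lemma bdd_sums_prod {I J} (b : I * J -> R) (A : I -> R) : (forall p, (0 <= b p)%R) ->
  (forall i l, NoDup l -> (rsum (fun j => b (i, j)) l <= A i)%R) ->
  bdd_sums A -> bdd_sums b.
Proof.
  intros Hb HA [M HM]. exists M. intros l N.
  (* A finite set of pairs lies in the rectangle of its two projections. *)
  destruct (nodup_list (map fst l)) as [l1 [N1 H1]].
  destruct (nodup_list (map snd l)) as [l2 [N2 H2]].
  apply Rle_trans with (rsum b (list_prod l1 l2)).
  - apply rsum_incl; auto. now apply list_prod_NoDup.
    intros [i j] H. apply in_prod_iff. rewrite H1, H2. split.
    now apply (in_map fst) in H. now apply (in_map snd) in H.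
  - rewrite rsum_prod. eapply Rle_trans; [apply rsum_le|apply (HM l1 N1)].
    intros i _; auto.
Qed.

Lemma choice_list {I B} (l : list I) (Q : I -> B -> Prop) : (forall i, exists b, Q i b) ->
  exists f : I -> B, forall i, Q i (f i).
Proof.
  intros H. exists (fun i => proj1_sig (constructive_indefinite_description _ (H i))).
  intros i. apply proj2_sig.
Qed.

(** Each row of a finite [l] is cut to a finite list that contains the row of [l0] and is within d
    of the row sum. The union of these lists contains [l0], so the double sum over it is close to
    s. *)
Lemma has_sum_fubini {I J} (a : I * J -> C) (b : I -> C) s :
  has_sum a s -> (forall i, has_sum (fun j => a (i, j)) (b i)) -> has_sum b s.
Proof.
  intros H Hb e He. destruct (H (e/2)%R) as [l0 [N0 H0]]; [lra|].
  destruct (nodup_list (map fst l0)) as [l1 [N1 H1]].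
  exists l1; split; auto. intros l Nl Hl.
  set (d := (e / (2 * (INR (length l) + 1)))%R).
  assert (Hlen := pos_INR (length l)).
  assert (Hd : (0 < d)%R) by (apply Rdiv_lt_0_compat; lra).
  destruct (choice_list l (fun i k => NoDup k /\ (forall j, In (i, j) l0 -> In j k) /\
     (Cmod (lsum (fun j => a (i, j)) k - b i) < d)%R)) as [f Hf].
  { intros i. destruct (Hb i d Hd) as [k0 [Nk0 Hk0]].
    destruct (nodup_list (map snd (filt (fun p => fst p = i) l0))) as [k1 [Nk1 Hk1]].
    destruct (union_list k0 k1 Nk0 Nk1) as [k [Nk [i0 i1]]].
    exists k. split; auto. split; auto. intros j Hj. apply i1. rewrite Hk1.
    apply in_map_iff. exists (i, j); split; auto. apply filt_In; auto. }
  set (L := flat_map (fun i => map (fun j => (i, j)) (f i)) l).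
  assert (EL : forall l', lsum a (flat_map (fun i => map (fun j => (i, j)) (f i)) l')
             = lsum (fun i => lsum (fun j => a (i, j)) (f i)) l').
  { induction l'; simpl; auto. rewrite lsum_app, lsum_map, IHl'. reflexivity. }
  assert (IL : forall i j, In (i, j) L <-> In i l /\ In j (f i)).
  { intros i j. unfold L. rewrite in_flat_map. split.
    - intros [x [Hx Hm]]. rewrite in_map_iff in Hm. destruct Hm as [y [E Hy]].
      inversion E; subst; auto.
    - intros [? ?]. exists i; split; auto. now apply in_map. }
  assert (NL : NoDup L).
  { unfold L. assert (Hf1 : forall i, NoDup (f i)) by (intros; apply Hf). clear - Nl Hf1. induction Nl; simpl; [constructor|]. apply NoDup_app; auto.
    - apply FinFun.Injective_map_NoDup; [intros u v E; congruence|apply Hf1].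
    - intros [u v]. rewrite in_map_iff, in_flat_map. intros [? [E ?]] [y [Hy Hm]].
      rewrite in_map_iff in Hm. destruct Hm as [? [E' ?]]. congruence. }
  assert (H2 : (Cmod (lsum a L - s) < e / 2)%R).
  { apply H0; auto. intros [i j] Hij. apply IL. split.
    - apply Hl, H1. now apply (in_map fst) in Hij.
    - now apply Hf. }
  assert (H3 : forall l', (Cmod (lsum b l' - lsum a
     (flat_map (fun i => map (fun j => (i, j)) (f i)) l')) <= INR (length l') * d)%R).
  { intros l'. rewrite EL. induction l' as [|x l' IH].
    - simpl. replace (0 - 0) with (RtoC 0) by ring. rewrite Cmod_0. lra.
    - cbn [lsum fold_right length]. fold (lsum b l').
      fold (lsum (fun i => lsum (fun j => a (i, j)) (f i)) l').
      rewrite S_INR.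
      match goal with |- (Cmod (?u + ?v - (?w + ?t)) <= _)%R =>
        replace (u + v - (w + t)) with ((u - w) + (v - t)) by ring end.
      eapply Rle_trans; [apply Cmod_triangle|].
      destruct (Hf x) as [_ [_ Hx]]. rewrite Cmod_sub_sym in Hx. lra. }
  specialize (H3 l). fold L in H3.
  assert (H4 : (INR (length l) * d <= e / 2)%R).
  { apply Rle_trans with ((INR (length l) + 1) * d)%R; [nra|].
    unfold d. right. field. lra. }
  pose proof (Cmod_sub_tri (lsum b l) (lsum a L) s). lra.
Qed.

(** The engine of the quadratic identities: one absolutely convergent double series, evaluated by
    rows and by columns. *)
Lemma has_sum_fubini_swap {I J} (a : I * J -> C) (b : I -> C) (c : J -> C) :
  summable a ->
  (forall i, has_sum (fun j => a (i, j)) (b i)) ->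
  (forall j, has_sum (fun i => a (i, j)) (c j)) ->
  exists s, has_sum b s /\ has_sum c s.
Proof.
  intros Ha Hb Hc. destruct (summable_has_sum a Ha) as [s Hs]. exists s. split.
  - now apply has_sum_fubini with a.
  - apply has_sum_fubini with (fun p => a (snd p, fst p)); auto.
    apply (has_sum_bij (fun p : I * J => (snd p, fst p)) (fun p => (snd p, fst p)));
      try (now intros []).
    eapply has_sum_ext; [|exact Hs]. now intros [].
Qed.

(** Fubini on the graph of p, viewed as a family on J x I that vanishes off the graph. *)
Lemma has_sum_fibers {I J} (p : I -> J) (a : I -> C) (b : J -> C) s :
  has_sum a s -> (forall j, has_sum (restr (fun i => p i = j) a) (b j)) -> has_sum b s.
Proof.
  intros H Hb.
  apply has_sum_fubini with (fun q : J * I => restr (fun i => p i = fst q) a (snd q)); auto.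
  apply (has_sum_reindex (fun i => (p i, i)) (fun _ => True) a); auto.
  - intros j j' _ _ E; congruence.
  - tauto.
  - intros [j i] Hi. simpl. apply restr_out. intros E. apply (Hi i); auto. congruence.
  - intros i _. simpl. now rewrite restr_in.
Qed.

Lemma sum_over_has_sum {I} (D : I -> Prop) (a : I -> C) s :
  has_sum (restr D a) s -> sum_over D a = s.
Proof.
  intros H. unfold sum_over, lim_along.
  pose proof (finite_subsets_filter D) as PF.
  apply (@iota_filterlim_locally C_AbsRing C_CompleteNormedModule); [apply _|].
  apply (filterlim_locally (U := C_UniformSpace)). intros e.
  destruct (H e (cond_pos e)) as [l0 [N H0]].
  exists (filt D l0). split. now apply filt_NoDup. split.
  { rewrite Forall_forall; intros i; rewrite filt_In; tauto. }
  intros l Nl Fl Hl. rewrite Forall_forall in Fl. apply Cball_of_Cmod.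
  change (fold_right (fun i s0 => a i + s0) (RtoC 0) l) with (lsum a l).
  (* The entries of [l0] outside D are appended, since [H0] needs a list that contains all of [l0];
     they contribute zero. *)
  replace (lsum a l) with (lsum (restr D a) (l ++ filt (fun i => ~ D i) l0)).
  - apply H0.
    + apply NoDup_app; auto. now apply filt_NoDup. intros i; rewrite filt_In.
      intros Hi [_ ?]; auto.
    + intros i Hi. rewrite in_app_iff, filt_In. destruct (classic (D i)); [|tauto].
      left. apply Hl, filt_In; auto.
  - rewrite lsum_app, (lsum_zero _ (filt _ _)), (lsum_ext _ a). ring.
    intros i Hi; apply restr_in; auto.
    intros i; rewrite filt_In; intros [_ ?]; now apply restr_out.
Qed.

Lemma Clim_seq_unique (u : nat -> C) l :
  (forall eps, (0 < eps)%R -> exists N, forall n, (N <= n)%nat -> (Cmod (u n - l) < eps)%R) ->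
  Clim_seq u = l.
Proof.
  intros H. unfold Clim_seq, lim_along.
  apply (@iota_filterlim_locally C_AbsRing C_CompleteNormedModule); [apply _|].
  apply (filterlim_locally (U := C_UniformSpace)). intros e.
  destruct (H e (cond_pos e)) as [N HN]. exists N. intros n Hn. apply Cball_of_Cmod; auto.
Qed.

(** * Symmetric ranges and convergent majorants over the integers *)

Definition zrange (N : nat) : list Z :=
  map (fun j => (Z.of_nat j - Z.of_nat N)%Z) (seq 0 (2 * N + 1)).
Lemma zrange_NoDup N : NoDup (zrange N).
Proof. apply FinFun.Injective_map_NoDup; [intros u v E; lia|apply seq_NoDup]. Qed.
Lemma zrange_In N n : In n (zrange N) <-> (Z.abs n <= Z.of_nat N)%Z.
Proof.
  unfold zrange. rewrite in_map_iff. split.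
  - intros [j [E H]]. apply in_seq in H. lia.
  - intros H. exists (Z.to_nat (n + Z.of_nat N)). rewrite in_seq. lia.
Qed.
Lemma sum_n_lsum (a : nat -> C) n : sum_n a n = lsum a (seq 0 (S n)).
Proof.
  induction n. rewrite sum_O. simpl. ring.
  rewrite sum_Sn, IHn, (seq_S (S n)), lsum_app. simpl (lsum a [_]). unfold plus; simpl. ring.
Qed.
Lemma sum_sym_lsum N a : sum_sym N a = lsum a (zrange N).
Proof.
  unfold sum_sym, zrange. rewrite sum_n_lsum, lsum_map. do 2 f_equal. lia.
Qed.
Lemma zrange_cover (l : list Z) : exists N, forall n, (N <= n)%nat -> incl l (zrange n).
Proof.
  induction l as [|x l [N H]]. exists 0%nat; intros n _ i [].
  exists (N + Z.to_nat (Z.abs x))%nat. intros n Hn i [<-|Hi].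
  - apply zrange_In. lia. - apply (H n); auto; lia.
Qed.
Lemma has_sum_sym_lim (a : Z -> C) s : has_sum a s -> Clim_seq (fun N => sum_sym N a) = s.
Proof.
  intros H. apply Clim_seq_unique. intros e He. destruct (H e He) as [l0 [N H0]].
  destruct (zrange_cover l0) as [N0 HN]. exists N0. intros n Hn. rewrite sum_sym_lsum.
  apply H0; auto. apply zrange_NoDup.
Qed.
Lemma nat_cover (l : list nat) : exists N, forall n, (N <= n)%nat -> incl l (seq 0 (S n)).
Proof.
  induction l as [|x l [N H]]. exists 0%nat; intros n _ i [].
  exists (N + x)%nat. intros n Hn i [<-|Hi].
  - apply in_seq. lia. - apply (H n); auto; lia.
Qed.
Lemma has_sum_nat_lim (a : nat -> C) s : has_sum a s -> Clim_seq (sum_n a) = s.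
Proof.
  intros H. apply Clim_seq_unique. intros e He. destruct (H e He) as [l0 [N H0]].
  destruct (nat_cover l0) as [N0 HN]. exists N0. intros n Hn. rewrite sum_n_lsum.
  apply H0; auto. apply seq_NoDup.
Qed.

(** The 1 makes majorants B / zn n ^ p meaningful at n = 0, so they can be stated for all n at
    once. *)
Definition zn (n : Z) : R := (1 + IZR (Z.abs n))%R.
Lemma zn_ge1 n : (1 <= zn n)%R.
Proof. unfold zn. assert (0 <= IZR (Z.abs n))%R by (apply IZR_le; lia). lra. Qed.

(** Each half-line telescopes to at most [t 0]. The index 0 is counted in both halves, which only
    weakens the bound. *)
Lemma bdd_sums_Z (b : Z -> R) (t : nat -> R) :
  (forall k, (0 <= t k)%R) ->
  (forall n, (0 <= b n <= t (Z.abs_nat n) - t (S (Z.abs_nat n)))%R) -> bdd_sums b.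
Proof.
  intros Ht Hb. exists (t 0%nat + t 0%nat)%R. intros l N.
  destruct (zrange_cover l) as [M HM]. specialize (HM M (le_n M)).
  eapply Rle_trans. apply (rsum_incl b l (zrange M)); auto. apply Hb. apply zrange_NoDup.
  clear - Ht Hb.
  assert (H : forall n, (rsum b (map (fun j => Z.of_nat j) (seq 0 n)) <= t 0%nat - t n)%R).
  { induction n. simpl; lra. rewrite seq_S, map_app, rsum_app. simpl.
    pose proof (Hb (Z.of_nat n)). rewrite Zabs2Nat.id in H. lra. }
  assert (H' : forall n, (rsum b (map (fun j => - Z.of_nat j)%Z (seq 0 n)) <= t 0%nat - t n)%R).
  { induction n. simpl; lra. rewrite seq_S, map_app, rsum_app. simpl.
    pose proof (Hb (- Z.of_nat n)%Z).
    replace (Z.abs_nat (- Z.of_nat n)) with n in H0 by lia. lra. }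
  specialize (H (S M)). specialize (H' (S M)). pose proof (Ht (S M)).
  set (L := map (fun j => Z.of_nat j) (seq 0 (S M))) in *.
  set (L' := map (fun j => - Z.of_nat j)%Z (seq 0 (S M))) in *.
  destruct (union_list L L') as [k [Nk [i1 i2]]].
  { apply FinFun.Injective_map_NoDup; [intros u v E; lia|apply seq_NoDup]. }
  { apply FinFun.Injective_map_NoDup; [intros u v E; lia|apply seq_NoDup]. }
  apply Rle_trans with (rsum b L + rsum b (filt (fun i => ~ In i L) L'))%R.
  - rewrite <- rsum_app. apply rsum_incl. apply Hb. apply zrange_NoDup.
    + apply NoDup_app.
      apply FinFun.Injective_map_NoDup; [intros u v E; lia|apply seq_NoDup].
      apply filt_NoDup, FinFun.Injective_map_NoDup; [intros u v E; lia|apply seq_NoDup].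
      intros i; rewrite filt_In; tauto.
    + intros i. rewrite zrange_In, in_app_iff, filt_In. intros Hi.
      destruct (classic (In i L)); [tauto|right; split; auto].
      apply in_map_iff. exists (Z.to_nat (- i)). rewrite in_seq.
      assert (i < 0)%Z; [|lia].
      apply Z.nle_gt. intros Hi0. apply H1, in_map_iff. exists (Z.to_nat i).
      rewrite in_seq. lia.
  - assert (rsum b (filt (fun i => ~ In i L) L') <= rsum b L')%R; [|lra].
    apply rsum_incl. apply Hb.
    apply filt_NoDup, FinFun.Injective_map_NoDup; [intros u v E; lia|apply seq_NoDup].
    apply FinFun.Injective_map_NoDup; [intros u v E; lia|apply seq_NoDup].
    intros i; rewrite filt_In; tauto.
Qed.

Lemma zn_nat n : zn n = (1 + INR (Z.abs_nat n))%R.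
Proof. unfold zn. now rewrite INR_IZR_INZ, Zabs2Nat.id_abs. Qed.

(** With u^2 = 1 + k and v^2 = u^2 + 1 one has 1/u - 1/v = 1/(u v (u + v)), and v <= 2 u makes this
    at least 1/(6 u^3). The exponent 3/2 itself is what [partial_fractions] and the lattice majorant
    [b32] require. *)
Lemma bdd_sums_32 : bdd_sums (fun n : Z => / sqrt (zn n) ^ 3)%R.
Proof.
  apply (bdd_sums_Z _ (fun k => 6 / sqrt (1 + INR k))%R).
  - intros k. pose proof (pos_INR k). apply Rlt_le, Rdiv_lt_0_compat; [lra|].
    apply sqrt_lt_R0; lra.
  - intros n. rewrite zn_nat. rewrite S_INR. set (k := INR _).
    assert (Hk : (0 <= k)%R) by apply pos_INR.
    set (u := sqrt (1 + k)). set (v := sqrt (1 + (k + 1))).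
    assert (Hu : (0 < u)%R) by (apply sqrt_lt_R0; lra).
    assert (Hv : (0 < v)%R) by (apply sqrt_lt_R0; lra).
    assert (Eu : (u * u = 1 + k)%R) by (apply sqrt_sqrt; lra).
    assert (Ev : (v * v = 1 + (k + 1))%R) by (apply sqrt_sqrt; lra).
    clearbody u v k.
    split. { apply Rlt_le, Rinv_0_lt_compat, pow_lt; auto. }
    assert (E : (6 / u - 6 / v = 6 / (u * v * (u + v)))%R).
    { apply Rmult_eq_reg_r with (u * v * (u + v))%R; [|nra].
      transitivity (6 * (v * v - u * u))%R. field; lra.
      transitivity 6%R; [rewrite Eu, Ev; ring|field; repeat split; nra]. }
    rewrite E. apply Rmult_le_reg_r with (u ^ 3 * (u * v * (u + v)))%R.
    { repeat apply Rmult_lt_0_compat; try apply pow_lt; lra. }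
    replace (/ u ^ 3 * (u ^ 3 * (u * v * (u + v))))%R with (u * v * (u + v))%R
      by (field; nra).
    replace (6 / (u * v * (u + v)) * (u ^ 3 * (u * v * (u + v))))%R with (6 * u ^ 3)%R
      by (field; repeat split; nra).
    assert (v <= 2 * u)%R by nra.
    assert (v * (u + v) <= 2 * u * (3 * u))%R by (apply Rmult_le_compat; lra).
    nra.
Qed.

Lemma bdd_sums_pow p : (2 <= p)%nat -> bdd_sums (fun n : Z => / zn n ^ p)%R.
Proof.
  intros Hp. eapply bdd_sums_le; [|apply bdd_sums_32]. intros n. cbv beta.
  pose proof (zn_ge1 n) as H1. set (x := zn n) in *. clearbody x.
  apply Rinv_le_contravar. apply pow_lt, sqrt_lt_R0; lra.
  apply Rle_trans with (x ^ 2)%R; [|apply Rle_pow; auto].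
  set (u := sqrt x). assert (Eu : (u * u = x)%R) by (apply sqrt_sqrt; lra).
  assert (0 <= u)%R by apply sqrt_pos. rewrite <- Eu in *. clearbody u.
  assert (1 <= u)%R by nra.
  replace ((u * u) ^ 2)%R with (u ^ 3 * u)%R by ring.
  assert (0 <= u ^ 3)%R by (apply pow_le; lra).
  nra.
Qed.

Lemma summable_pow_bound (a : Z -> C) B p : (2 <= p)%nat ->
  (forall n, (Cmod (a n) <= B / zn n ^ p)%R) -> summable a.
Proof.
  intros Hp H.
  assert (0 <= B)%R.
  { specialize (H 0%Z). pose proof (Cmod_ge_0 (a 0%Z)). unfold zn in H. simpl in H.
    rewrite Rplus_0_r, pow1 in H. lra. }
  eapply bdd_sums_le; [exact H|]. apply bdd_sums_scal; auto. now apply bdd_sums_pow.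
Qed.

Lemma finite_bound (f : Z -> R) (N : nat) :
  exists B, (0 <= B)%R /\ forall n, (Z.abs n <= Z.of_nat N)%Z -> (f n <= B)%R.
Proof.
  assert (H : forall l : list Z, exists B, (0 <= B)%R /\ forall n, In n l -> (f n <= B)%R).
  { induction l as [|x l [B [H0 HB]]]. exists 0%R; split; [lra|]. intros n [].
    exists (B + Rabs (f x))%R. pose proof (Rabs_pos (f x)). pose proof (Rle_abs (f x)).
    split; [lra|]. intros n [<-|Hn]; [lra|]. specialize (HB n Hn). lra. }
  destruct (H (zrange N)) as [B [H0 HB]]. exists B; split; auto.
  intros n Hn. apply HB, zrange_In; auto.
Qed.
Lemma eventually_bound (a : Z -> R) B p (N : nat) :
  (forall n, (Z.of_nat N < Z.abs n)%Z -> (a n <= B / zn n ^ p)%R) ->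
  exists B', forall n, (a n <= B' / zn n ^ p)%R.
Proof.
  intros H. destruct (finite_bound (fun n => a n * zn n ^ p)%R N) as [B1 [H0 H1]].
  exists (Rabs B + B1)%R. intros n.
  assert (Hz : (0 < zn n ^ p)%R) by (apply pow_lt; pose proof (zn_ge1 n); lra).
  pose proof (Rabs_pos B). pose proof (Rle_abs B).
  apply Rmult_le_reg_r with (zn n ^ p)%R; auto.
  unfold Rdiv. rewrite Rmult_assoc, Rinv_l, Rmult_1_r by lra.
  destruct (Z_le_gt_dec (Z.abs n) (Z.of_nat N)) as [L|L].
  - specialize (H1 n L). lra.
  - assert (L' : (Z.of_nat N < Z.abs n)%Z) by lia. specialize (H n L').
    apply Rmult_le_compat_r with (r := (zn n ^ p)%R) in H; [|lra].
    unfold Rdiv in H. rewrite Rmult_assoc, Rinv_l, Rmult_1_r in H by lra. lra.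
Qed.

(** * Complex derivatives and the exponential *)

(** [C_derive] returns a value even where no derivative exists, so all calculus is done with this
    relation and transferred by [cder_C_derive]. *)
Definition cder (f : C -> C) (z l : C) : Prop :=
  forall eps : R, (0 < eps)%R -> exists d : R, (0 < d)%R /\
    forall h, (Cmod h < d)%R -> (Cmod (f (z + h)%C - f z - l * h) <= eps * Cmod h)%R.

Lemma cder_eq f z l l' : l = l' -> cder f z l -> cder f z l'.
Proof. now intros <-. Qed.
Lemma cder_const c z : cder (fun _ => c) z 0.
Proof.
  intros e He. exists 1%R; split; [lra|]. intros h _.
  replace (c - c - 0 * h) with (RtoC 0) by ring. rewrite Cmod_0.
  pose proof (Cmod_ge_0 h); nra.
Qed.
Lemma cder_id z : cder (fun w => w) z 1.
Proof.
  intros e He. exists 1%R; split; [lra|]. intros h _.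
  replace (z + h - z - 1 * h) with (RtoC 0) by ring. rewrite Cmod_0.
  pose proof (Cmod_ge_0 h); nra.
Qed.
Lemma cder_plus f g z l m : cder f z l -> cder g z m -> cder (fun w => f w + g w) z (l + m).
Proof.
  intros Hf Hg e He. destruct (Hf (e/2)%R) as [d1 [P1 H1]]; [lra|].
  destruct (Hg (e/2)%R) as [d2 [P2 H2]]; [lra|].
  exists (Rmin d1 d2); split; [now apply Rmin_glb_lt|]. intros h Hh.
  specialize (H1 h (Rlt_le_trans _ _ _ Hh (Rmin_l _ _))).
  specialize (H2 h (Rlt_le_trans _ _ _ Hh (Rmin_r _ _))).
  replace (f (z + h)%C + g (z + h)%C - (f z + g z) - (l + m) * h) with
    ((f (z + h)%C - f z - l * h) + (g (z + h)%C - g z - m * h)) by ring.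
  eapply Rle_trans; [apply Cmod_triangle|]. lra.
Qed.
Lemma cder_local_lip f z l : cder f z l -> exists d, (0 < d)%R /\
  forall h, (Cmod h < d)%R -> (Cmod (f (z + h)%C - f z) <= (Cmod l + 1) * Cmod h)%R.
Proof.
  intros H. destruct (H 1%R) as [d [P H1]]; [lra|]. exists d; split; auto.
  intros h Hh. specialize (H1 h Hh).
  pose proof (Cmod_triangle (f (z + h)%C - f z - l * h) (l * h)).
  replace (f (z + h)%C - f z - l * h + l * h) with (f (z + h)%C - f z) in H0 by ring.
  rewrite Cmod_mult in H0. lra.
Qed.
Lemma cder_comp f g z l m : cder g z m -> cder f (g z) l ->
  cder (fun w => f (g w)) z (l * m).
Proof.
  intros Hg Hf e He.
  destruct (cder_local_lip _ _ _ Hg) as [d1 [P1 H1]].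
  pose proof (Cmod_ge_0 l) as Ll. pose proof (Cmod_ge_0 m) as Lm.
  set (e1 := (e / (2 * (Cmod m + 1)))%R).
  set (e2 := (e / (2 * (Cmod l + 1)))%R).
  assert (He1 : (0 < e1)%R) by (apply Rdiv_lt_0_compat; lra).
  assert (He2 : (0 < e2)%R) by (apply Rdiv_lt_0_compat; lra).
  destruct (Hf e1 He1) as [d2 [P2 H2]].
  destruct (Hg e2 He2) as [d3 [P3 H3]].
  set (d4 := (d2 / (Cmod m + 1))%R).
  assert (P4 : (0 < d4)%R) by (apply Rdiv_lt_0_compat; lra).
  exists (Rmin d1 (Rmin d3 d4)). split; [repeat apply Rmin_glb_lt; auto|]. intros h Hh.
  pose proof (Rmin_l d1 (Rmin d3 d4)). pose proof (Rmin_r d1 (Rmin d3 d4)).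
  pose proof (Rmin_l d3 d4). pose proof (Rmin_r d3 d4).
  specialize (H1 h ltac:(lra)). specialize (H3 h ltac:(lra)).
  set (k := g (z + h)%C - g z) in *.
  assert (Hk : (Cmod k < d2)%R).
  { eapply Rle_lt_trans; [exact H1|]. apply Rlt_le_trans with ((Cmod m + 1) * d4)%R.
    apply Rmult_lt_compat_l; lra. unfold d4. right; field; lra. }
  specialize (H2 k Hk). replace (g z + k) with (g (z + h)%C) in H2 by (unfold k; ring).
  replace (f (g (z + h)%C) - f (g z) - l * m * h) with
    ((f (g (z + h)%C) - f (g z) - l * k) + l * (k - m * h)) by ring.
  eapply Rle_trans; [apply Cmod_triangle|]. rewrite Cmod_mult.
  pose proof (Cmod_ge_0 h).
  assert (A1 : (e1 * Cmod k <= e / 2 * Cmod h)%R).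
  { apply Rle_trans with (e1 * ((Cmod m + 1) * Cmod h))%R.
    apply Rmult_le_compat_l; lra. unfold e1. right; field; lra. }
  assert (A2 : (Cmod l * Cmod (k - m * h) <= e / 2 * Cmod h)%R).
  { apply Rle_trans with ((Cmod l + 1) * (e2 * Cmod h))%R.
    apply Rmult_le_compat; try lra. apply Cmod_ge_0.
    unfold e2. right; field; lra. }
  lra.
Qed.
Lemma cder_sq z : cder (fun w => w * w) z (2 * z).
Proof.
  intros e He. exists e; split; auto. intros h Hh.
  replace ((z + h) * (z + h) - z * z - 2 * z * h) with (h * h) by ring.
  rewrite Cmod_mult. pose proof (Cmod_ge_0 h); nra.
Qed.
Lemma cder_scal c f z l : cder f z l -> cder (fun w => c * f w) z (c * l).
Proof.
  intros H. apply (cder_comp (fun w => c * w) f z c l); auto.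
  intros e He. exists 1%R; split; [lra|]. intros h _.
  replace (c * (f z + h) - c * f z - c * h) with (RtoC 0) by ring. rewrite Cmod_0.
  pose proof (Cmod_ge_0 h); nra.
Qed.
Lemma cder_ext f g z l : (forall w, f w = g w) -> cder f z l -> cder g z l.
Proof. intros E H e He. destruct (H e He) as [d [P H1]]. exists d; split; auto.
  intros h Hh. rewrite <- !E; auto. Qed.
Lemma cder_ext_loc f g z l d : (0 < d)%R -> (forall h, (Cmod h < d)%R -> f (z + h)%C = g (z + h)%C) ->
  cder f z l -> cder g z l.
Proof.
  intros Hd E H e He. destruct (H e He) as [d1 [P H1]].
  exists (Rmin d d1); split; [now apply Rmin_glb_lt|].
  intros h Hh. pose proof (Rmin_l d d1). pose proof (Rmin_r d d1).
  rewrite <- E by lra.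
  assert (E0 := E 0). rewrite Cmod_0 in E0. replace (z + 0) with z in E0 by ring.
  rewrite <- E0 by lra. apply H1. lra.
Qed.
(** Polarization reduces the product to squares and the chain rule: f g is half of (f + g)^2 - f^2 -
    g^2. *)
Lemma cder_mult f g z l m : cder f z l -> cder g z m ->
  cder (fun w => f w * g w) z (l * g z + f z * m).
Proof.
  intros Hf Hg.
  pose proof (cder_comp _ (fun w => f w + g w) z _ _ (cder_plus _ _ _ _ _ Hf Hg)
    (cder_sq (f z + g z))) as H1.
  pose proof (cder_comp _ f z _ _ Hf (cder_sq (f z))) as H2.
  pose proof (cder_comp _ g z _ _ Hg (cder_sq (g z))) as H3.
  pose proof (cder_scal (/ 2) _ _ _ (cder_plus _ _ _ _ _ H1
    (cder_scal (-(1)) _ _ _ (cder_plus _ _ _ _ _ H2 H3)))) as H.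
  assert (N2 : RtoC 2 <> 0). { intros E. apply RtoC_inj in E. lra. }
  eapply cder_eq; [|eapply cder_ext; [|exact H]]. simpl. field; auto.
  intros w; simpl. field; auto.
Qed.
Lemma cder_opp f z l : cder f z l -> cder (fun w => - f w) z (- l).
Proof.
  intros H. eapply cder_eq; [|eapply cder_ext; [|exact (cder_scal (-(1)) _ _ _ H)]]; [|intros; simpl].
  all: ring.
Qed.
Lemma cder_minus f g z l m : cder f z l -> cder g z m -> cder (fun w => f w - g w) z (l - m).
Proof. intros Hf Hg. apply cder_plus; auto. now apply cder_opp. Qed.

Lemma Cmod_tri_rev a b : (Cmod a - Cmod b <= Cmod (a + b))%R.
Proof.
  pose proof (Cmod_triangle (a + b) (- b)). replace (a + b + - b) with a in H by ring.
  rewrite Cmod_opp in H. lra.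
Qed.
Lemma cder_inv0 (z : C) : z <> 0 -> cder (fun w => / w) z (- / (z * z)).
Proof.
  intros Hz e He. assert (P := proj1 (Cmod_gt_0 z) Hz). set (r := Cmod z) in *.
  assert (Pr : (0 < r ^ 3 / 2)%R) by (pose proof (pow_lt r 3 P); lra).
  (* For |h| < r / 2 the point z + h has modulus at least r / 2, so the remainder h^2 / (z^2 (z +
     h)) is at most |h|^2 / (r^3 / 2). *)
  exists (Rmin (r / 2) (e * (r ^ 3 / 2)))%R. split.
  { apply Rmin_glb_lt; [lra|apply Rmult_lt_0_compat; lra]. }
  intros h Hh. pose proof (Rmin_l (r / 2) (e * (r ^ 3 / 2)))%R.
  pose proof (Rmin_r (r / 2) (e * (r ^ 3 / 2)))%R.
  pose proof (Cmod_tri_rev z h) as T. fold r in T.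
  assert (Hzh : z + h <> 0). { apply Cmod_gt_0. lra. }
  replace (/ (z + h) - / z - - / (z * z) * h) with (h * h * / (z * z * (z + h)))
    by (field; auto).
  assert (Hd : z * z * (z + h) <> 0) by (repeat apply Cmult_neq_0; auto).
  rewrite !Cmod_mult, Cmod_inv, !Cmod_mult by auto. fold r.
  pose proof (Cmod_ge_0 h) as Hh0.
  assert (K : (r ^ 3 / 2 <= r * r * Cmod (z + h))%R).
  { replace (r ^ 3 / 2)%R with (r * r * (r / 2))%R by field.
    apply Rmult_le_compat_l; nra. }
  assert (K' : (/ (r * r * Cmod (z + h)) <= / (r ^ 3 / 2))%R)
    by (apply Rinv_le_contravar; auto).
  apply Rle_trans with (Cmod h * Cmod h * / (r ^ 3 / 2))%R.
  { apply Rmult_le_compat_l; nra. }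
  assert (Cmod h * / (r ^ 3 / 2) <= e)%R.
  { apply Rmult_le_reg_r with (r ^ 3 / 2)%R; auto.
    rewrite Rmult_assoc, Rinv_l, Rmult_1_r by lra. lra. }
  rewrite Rmult_assoc, Rmult_comm. apply Rmult_le_compat_r; auto.
Qed.
Lemma cder_inv (f : C -> C) z l : f z <> 0 -> cder f z l -> cder (fun w => / f w) z (- l / (f z * f z)).
Proof.
  intros Hz H. eapply cder_eq; [|exact (cder_comp _ f z _ _ H (cder_inv0 _ Hz))].
  field; auto.
Qed.

Lemma cder_is_derive f z l : cder f z l -> @is_derive C_AbsRing C_NormedModule f z l.
Proof.
  intros H. split.
  - apply is_linear_scal_l.
  - intros x Hx. apply (@is_filter_lim_locally_unique C_AbsRing (AbsRing_NormedModule C_AbsRing)) in Hx. rewrite <- Hx. clear x Hx.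
    intros eps. destruct (H eps (cond_pos eps)) as [d [P H1]].
    assert (K : forall y : C, (Cmod (y - z) < d)%R ->
      (Cmod (f y + - f z + - ((y + - z) * l)) <= eps * Cmod (y + - z))%R).
    { intros y Hy. specialize (H1 (y - z) Hy).
      replace (z + (y - z)) with y in H1 by ring.
      replace (f y + - f z + - ((y + - z) * l)) with (f y - f z - l * (y - z)) by ring.
      exact H1. }
    exists (mkposreal d P). intros y Hy. exact (K y Hy).
Qed.
Lemma cder_C_derive f z l : cder f z l -> C_derive f z = l.
Proof. intros H. apply is_C_derive_unique. now apply cder_is_derive. Qed.
Lemma cder_unique f z l m : cder f z l -> cder f z m -> l = m.
Proof. intros H1 H2. rewrite <- (cder_C_derive _ _ _ H1). now apply cder_C_derive. Qed.

Lemma Cmod_le_parts (z : C) : (Cmod z <= Rabs (Re z) + Rabs (Im z))%R.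
Proof.
  replace z with (RtoC (Re z) + Ci * RtoC (Im z)) at 1.
  - eapply Rle_trans; [apply Cmod_triangle|].
    rewrite Cmod_mult, Cmod_Ci, !Cmod_R. lra.
  - destruct z; unfold Cplus, Cmult, Ci, RtoC, Re, Im; simpl. f_equal; ring.
Qed.
Lemma Re_le z : (Rabs (Re z) <= Cmod z)%R.
Proof. apply re_le_Cmod. Qed.
Lemma Im_le z : (Rabs (Im z) <= Cmod z)%R.
Proof. eapply Rle_trans; [apply Rmax_r|apply Rmax_Cmod]. Qed.

(** [p] stands for [Re] or [Im]; its three properties are what the passage to a real derivative
    along a segment uses. *)
Lemma seg_deriv (p : C -> R) (f : C -> C) (z h l : C) (t : R) :
  (forall a b, p (a - b) = (p a - p b)%R) -> (forall a, (Rabs (p a) <= Cmod a)%R) ->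
  (forall (r : R) a, p (a * RtoC r) = (p a * r)%R) ->
  cder f (z + RtoC t * h) l ->
  is_derive (fun t : R => p (f (z + RtoC t * h)%C)) t (p (l * h)).
Proof.
  intros pm pl ps H.
  assert (Hc : cder (fun w => f (z + w * h)) t (l * h)).
  { apply (cder_comp f (fun w => z + w * h) (RtoC t) l h); [|exact H].
    eapply cder_eq; [|apply cder_plus; [apply cder_const|
      apply cder_mult; [apply cder_id|apply cder_const]]]. cbv beta; ring. }
  apply is_derive_Reals. intros e He.
  destruct (Hc (e/2)%R) as [d [P H1]]; [lra|].
  exists (mkposreal d P). intros r r0 Hr. simpl in Hr.
  specialize (H1 (RtoC r)). rewrite Cmod_R in H1. specialize (H1 Hr).
  rewrite <- RtoC_plus in H1.
  set (A := f (z + RtoC (t + r) * h)) in *. set (B := f (z + RtoC t * h)) in *.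
  assert (K : (Rabs (p (A - B - l * h * RtoC r)%C) <= e / 2 * Rabs r)%R)
    by (eapply Rle_trans; [apply pl|exact H1]).
  rewrite !pm, ps in K.
  replace ((p A - p B) / r - p (l * h)%C)%R with ((p A - p B - p (l * h)%C * r) / r)%R
    by (field; auto).
  unfold Rdiv at 1. rewrite Rabs_mult, Rabs_inv.
  assert (0 < Rabs r)%R by now apply Rabs_pos_lt.
  apply Rmult_lt_reg_r with (Rabs r); auto. rewrite Rmult_assoc, Rinv_l, Rmult_1_r by lra.
  eapply Rle_lt_trans; [exact K|]. nra.
Qed.

Lemma cder_mvt_part (p : C -> R) (f f' : C -> C) (z h : C) M :
  (forall a b, p (a - b) = (p a - p b)%R) -> (forall a, (Rabs (p a) <= Cmod a)%R) ->
  (forall (r : R) a, p (a * RtoC r) = (p a * r)%R) ->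
  (forall t : R, (0 <= t <= 1)%R -> cder f (z + RtoC t * h) (f' (z + RtoC t * h)) /\
     (Cmod (f' (z + RtoC t * h)%C) <= M)%R) ->
  (Rabs (p (f (z + h)%C - f z)%C) <= M * Cmod h)%R.
Proof.
  intros pm pl ps H.
  destruct (MVT_gen (fun t : R => p (f (z + RtoC t * h)%C)) 0 1
    (fun t => p (f' (z + RtoC t * h) * h))) as [x [Hx E]].
  - intros x. rewrite Rmin_left, Rmax_right by lra. intros Hx.
    apply seg_deriv; auto. apply H. lra.
  - intros x. rewrite Rmin_left, Rmax_right by lra. intros Hx.
    apply derivable_continuous_pt. exists (p (f' (z + RtoC x * h) * h)).
    apply is_derive_Reals. apply seg_deriv; auto. apply H. lra.
  - rewrite Rmin_left, Rmax_right in Hx by lra.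
    replace (z + RtoC 1 * h) with (z + h) in E by ring.
    replace (z + RtoC 0 * h) with z in E by ring.
    rewrite pm, E. rewrite Rminus_0_r, Rmult_1_r.
    eapply Rle_trans; [apply pl|]. rewrite Cmod_mult.
    apply Rmult_le_compat_r. apply Cmod_ge_0. apply H; lra.
Qed.

(** The factor 2 comes from applying the real mean value theorem to the real and imaginary parts
    separately, with different intermediate points. *)
Lemma cder_mvt (f f' : C -> C) (z h : C) M :
  (forall t : R, (0 <= t <= 1)%R -> cder f (z + RtoC t * h) (f' (z + RtoC t * h)) /\
     (Cmod (f' (z + RtoC t * h)%C) <= M)%R) ->
  (Cmod (f (z + h)%C - f z) <= 2 * M * Cmod h)%R.
Proof.
  intros H. eapply Rle_trans; [apply Cmod_le_parts|].
  assert (A1 : (Rabs (Re (f (z + h)%C - f z)) <= M * Cmod h)%R).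
  { apply (cder_mvt_part Re f f'); [| | |exact H].
    - intros [a1 a2] [b1 b2]; simpl; ring.
    - apply Re_le.
    - intros r [a1 a2]; simpl; ring. }
  assert (A2 : (Rabs (Im (f (z + h)%C - f z)) <= M * Cmod h)%R).
  { apply (cder_mvt_part Im f f'); [| | |exact H].
    - intros [a1 a2] [b1 b2]; simpl; ring.
    - apply Im_le.
    - intros r [a1 a2]; simpl; ring. }
  lra.
Qed.

(** The mean value bound is applied to f(v) - f'(z) v, whose derivative f'(v) - f'(z) is in turn at
    most 2 M |h|. *)
Lemma cder_taylor2 (f f' f'' : C -> C) (z h : C) M :
  (forall t : R, (0 <= t <= 1)%R ->
     cder f (z + RtoC t * h) (f' (z + RtoC t * h)) /\
     cder f' (z + RtoC t * h) (f'' (z + RtoC t * h)) /\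
     (Cmod (f'' (z + RtoC t * h)%C) <= M)%R) ->
  (Cmod (f (z + h)%C - f z - f' z * h) <= 4 * M * Cmod h ^ 2)%R.
Proof.
  intros H.
  assert (HM : (0 <= M)%R).
  { destruct (H 0%R) as [_ [_ ?]]; [lra|]. eapply Rle_trans; [apply Cmod_ge_0|eauto]. }
  pose proof (Cmod_ge_0 h) as Hh.
  pose proof (cder_mvt (fun v => f v - f' z * v) (fun v => f' v - f' z) z h
     (2 * M * Cmod h)) as K. cbv beta in K.
  replace (f (z + h) - f z - f' z * h) with (f (z + h) - f' z * (z + h) - (f z - f' z * z))
    by ring.
  eapply Rle_trans; [apply K|]. 2: right; ring.
  intros t Ht. split.
  - apply cder_minus. apply H; auto.
    eapply cder_eq; [|apply cder_scal, cder_id]. ring.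
  - eapply Rle_trans; [apply (cder_mvt f' f'' z (RtoC t * h) M)|].
    + intros u Hu. replace (z + RtoC u * (RtoC t * h)) with (z + RtoC (u * t) * h)
        by (rewrite RtoC_mult; ring).
      apply H. nra.
    + rewrite Cmod_mult, Cmod_R, Rabs_pos_eq by lra.
      assert (t * Cmod h <= Cmod h)%R by nra. nra.
Qed.

(** * Second-order bounds for the exponential *)

Lemma exp_bound1 a : (Rabs a <= 1)%R -> (Rabs (exp a - 1) <= 3 * Rabs a)%R.
Proof.
  intros Ha. destruct (MVT_gen exp 0 a exp) as [x [Hx E]].
  - intros; apply is_derive_Reals, derivable_pt_lim_exp.
  - intros. apply derivable_continuous_pt, derivable_pt_exp.
  - rewrite exp_0 in E. rewrite E, Rabs_mult, Rminus_0_r.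
    apply Rmult_le_compat_r. apply Rabs_pos. rewrite Rabs_pos_eq by (apply Rlt_le, exp_pos).
    apply Rle_trans with (exp 1); [|apply exp_le_3].
    apply Rabs_le_between in Ha.
    assert (x <= 1)%R. { unfold Rmax in Hx; destruct (Rle_dec 0 a); lra. }
    destruct H as [H| ->]; [left; now apply exp_increasing|right; auto].
Qed.
Lemma exp_bound2 a : (Rabs a <= 1)%R -> (Rabs (exp a - 1 - a) <= 3 * Rabs a ^ 2)%R.
Proof.
  intros Ha. destruct (MVT_gen (fun x => exp x - x)%R 0 a (fun x => exp x - 1)%R) as [x [Hx E]].
  - intros. auto_derive; auto; ring.
  - intros. apply derivable_continuous_pt.
    apply derivable_pt_minus; [apply derivable_pt_exp|apply derivable_pt_id].
  - rewrite exp_0 in E. replace (exp a - 1 - a)%R with (exp a - a - (1 - 0))%R by ring.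
    rewrite E, Rabs_mult, Rminus_0_r.
    assert (Rabs x <= Rabs a)%R.
    { unfold Rmin, Rmax in Hx. destruct (Rle_dec 0 a).
      rewrite !Rabs_pos_eq; lra. rewrite !Rabs_left1; lra. }
    pose proof (exp_bound1 x ltac:(lra)). pose proof (Rabs_pos a). simpl. nra.
Qed.
Lemma cos_bound1 b : (Rabs (cos b - 1) <= Rabs b)%R.
Proof.
  destruct (MVT_gen cos 0 b (fun x => - sin x)%R) as [x [Hx E]].
  - intros; apply is_derive_Reals, derivable_pt_lim_cos.
  - intros. apply derivable_continuous_pt, derivable_pt_cos.
  - rewrite cos_0 in E. rewrite E, Rabs_mult, Rminus_0_r, Rabs_Ropp.
    pose proof (SIN_bound x). assert (Rabs (sin x) <= 1)%R by (apply Rabs_le; lra).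
    pose proof (Rabs_pos b). nra.
Qed.
Lemma cos_bound2 b : (Rabs (cos b - 1) <= Rabs b ^ 2)%R.
Proof.
  destruct (MVT_gen cos 0 b (fun x => - sin x)%R) as [x [Hx E]].
  - intros; apply is_derive_Reals, derivable_pt_lim_cos.
  - intros. apply derivable_continuous_pt, derivable_pt_cos.
  - rewrite cos_0 in E. rewrite E, Rabs_mult, Rminus_0_r, Rabs_Ropp.
    assert (Rabs x <= Rabs b)%R.
    { unfold Rmin, Rmax in Hx. destruct (Rle_dec 0 b).
      rewrite !Rabs_pos_eq; lra. rewrite !Rabs_left1; lra. }
    assert (Rabs (sin x) <= Rabs x)%R.
    { destruct (Rle_lt_dec 0 x) as [L|L].
      - rewrite (Rabs_pos_eq x) by auto. destruct (Rle_lt_or_eq_dec _ _ L) as [L'|<-].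
        + apply Rabs_le. pose proof (sin_lt_x x L'). split; [|lra].
          destruct (Rle_lt_dec x 1).
          * assert (0 <= sin x)%R; [|lra]. apply sin_ge_0; auto. pose proof PI2_1. lra.
          * pose proof (SIN_bound x); lra.
        + rewrite sin_0, Rabs_R0. lra.
      - rewrite <- (Rabs_Ropp x), <- (Rabs_Ropp (sin x)), <- sin_neg.
        rewrite (Rabs_pos_eq (- x)) by lra. apply Rabs_le.
        assert (L' : (0 < - x)%R) by lra. pose proof (sin_lt_x _ L'). split; [|lra].
          destruct (Rle_lt_dec (- x) 1).
          * assert (0 <= sin (- x))%R; [|lra]. apply sin_ge_0; try lra. pose proof PI2_1. lra.
          * pose proof (SIN_bound (- x)); lra. }
    pose proof (Rabs_pos b). pose proof (Rabs_pos (sin x)). simpl. nra.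
Qed.
Lemma sin_bound2 b : (Rabs (sin b - b) <= Rabs b ^ 2)%R.
Proof.
  destruct (MVT_gen (fun x => sin x - x)%R 0 b (fun x => cos x - 1)%R) as [x [Hx E]].
  - intros. auto_derive; auto; ring.
  - intros. apply derivable_continuous_pt.
    apply derivable_pt_minus; [apply derivable_pt_sin|apply derivable_pt_id].
  - rewrite sin_0 in E. replace (sin b - b)%R with (sin b - b - (0 - 0))%R by ring.
    rewrite E, Rabs_mult, Rminus_0_r.
    assert (Rabs x <= Rabs b)%R.
    { unfold Rmin, Rmax in Hx. destruct (Rle_dec 0 b).
      rewrite !Rabs_pos_eq; lra. rewrite !Rabs_left1; lra. }
    pose proof (cos_bound1 x). pose proof (Rabs_pos b). pose proof (Rabs_pos (cos x - 1)).
    simpl. nra.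
Qed.

Lemma Cexp_pair z : Cexp z = (exp (Re z) * cos (Im z), exp (Re z) * sin (Im z))%R.
Proof. unfold Cexp, Cmult, Cplus, Ci, RtoC; simpl. f_equal; ring. Qed.
Lemma Cexp_add a b : Cexp (a + b) = Cexp a * Cexp b.
Proof.
  rewrite !Cexp_pair. destruct a as [a1 a2], b as [b1 b2]. unfold Cplus, Cmult; simpl.
  rewrite exp_plus, cos_plus, sin_plus. f_equal; ring.
Qed.
Lemma Cexp_0 : Cexp 0 = 1.
Proof. rewrite Cexp_pair. simpl. rewrite exp_0, cos_0, sin_0. unfold RtoC. f_equal; ring. Qed.
Lemma Cmod_Cexp z : Cmod (Cexp z) = exp (Re z).
Proof.
  rewrite Cexp_pair. unfold Cmod; simpl fst; simpl snd.
  replace ((exp (Re z) * cos (Im z)) ^ 2 + (exp (Re z) * sin (Im z)) ^ 2)%R with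
    (Rsqr (exp (Re z)))%R.
  apply sqrt_Rsqr, Rlt_le, exp_pos.
  pose proof (sin2_cos2 (Im z)). unfold Rsqr in *.
  replace ((exp (Re z) * cos (Im z)) ^ 2 + (exp (Re z) * sin (Im z)) ^ 2)%R with
   (exp (Re z) * exp (Re z) * (sin (Im z) * sin (Im z) + cos (Im z) * cos (Im z)))%R by ring.
  rewrite H; ring.
Qed.
Lemma Cexp_nz z : Cexp z <> 0.
Proof. apply Cmod_gt_0. rewrite Cmod_Cexp. apply exp_pos. Qed.
Lemma Cexp_opp z : Cexp (- z) = / Cexp z.
Proof.
  pose proof (Cexp_nz z). assert (Cexp z * Cexp (- z) = 1).
  { rewrite <- Cexp_add. replace (z + - z) with (RtoC 0) by ring. apply Cexp_0. }
  replace (Cexp (- z)) with (Cexp z * Cexp (- z) / Cexp z) by (field; auto).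
  rewrite H0. field; auto.
Qed.
Lemma Cexp_bound2 h : (Cmod h <= 1)%R -> (Cmod (Cexp h - 1 - h) <= 16 * Cmod h ^ 2)%R.
Proof.
  intros Hh. eapply Rle_trans; [apply Cmod_le_parts|].
  rewrite Cexp_pair.
  pose proof (Re_le h) as Ha. pose proof (Im_le h) as Hb.
  destruct h as [a b]. set (r := Cmod (a, b)) in *. simpl Re in *. simpl Im in *.
  (* Both parts are regrouped so that every summand is of second order: four are at most 3 r^2 and
     two at most r^2, 14 r^2 in all. *)
  replace (exp a * cos b + - (1) + - a)%R with
    ((exp a - 1) * (cos b - 1) + (cos b - 1) + (exp a - 1 - a))%R by ring.
  replace (exp a * sin b + - 0 + - b)%R with
    ((exp a - 1) * (sin b - b) + (sin b - b) + (exp a - 1) * b)%R by ring.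
  pose proof (exp_bound1 a ltac:(lra)) as E1. pose proof (exp_bound2 a ltac:(lra)) as E2.
  pose proof (cos_bound1 b) as C1. pose proof (cos_bound2 b) as C2.
  pose proof (sin_bound2 b) as S2.
  pose proof (Rabs_pos a). pose proof (Rabs_pos b).
  assert (Qa : (Rabs a ^ 2 <= r ^ 2)%R) by (apply pow_incr; lra).
  assert (Qb : (Rabs b ^ 2 <= r ^ 2)%R) by (apply pow_incr; lra).
  assert (Qab : (Rabs a * Rabs b <= r ^ 2)%R) by (simpl; nra).
  assert (T1 : (Rabs ((exp a - 1) * (cos b - 1)) <= 3 * r ^ 2)%R).
  { rewrite Rabs_mult. apply Rle_trans with (3 * Rabs a * Rabs b)%R; [|lra].
    apply Rmult_le_compat; try apply Rabs_pos; auto. }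
  assert (T2 : (Rabs ((exp a - 1) * (sin b - b)) <= 3 * r ^ 2)%R).
  { rewrite Rabs_mult. apply Rle_trans with (3 * (Rabs b ^ 2))%R; [|lra].
    apply Rmult_le_compat; try apply Rabs_pos; auto. lra. }
  assert (T3 : (Rabs ((exp a - 1) * b) <= 3 * r ^ 2)%R).
  { rewrite Rabs_mult. apply Rle_trans with (3 * Rabs a * Rabs b)%R; [|lra].
    apply Rmult_le_compat; try apply Rabs_pos; auto. lra. }
  pose proof (Rabs_triang ((exp a - 1) * (cos b - 1) + (cos b - 1)) (exp a - 1 - a)).
  pose proof (Rabs_triang ((exp a - 1) * (cos b - 1)) (cos b - 1)).
  pose proof (Rabs_triang ((exp a - 1) * (sin b - b) + (sin b - b)) ((exp a - 1) * b)).
  pose proof (Rabs_triang ((exp a - 1) * (sin b - b)) (sin b - b)).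
  pose proof (pow2_ge_0 r). lra.
Qed.
Lemma cder_Cexp z : cder Cexp z (Cexp z).
Proof.
  intros e He. set (M := (Cmod (Cexp z) * 16 + 1)%R).
  assert (HM : (0 < M)%R) by (unfold M; pose proof (Cmod_ge_0 (Cexp z)); lra).
  exists (Rmin 1 (e / M)). split; [apply Rmin_glb_lt; [lra|now apply Rdiv_lt_0_compat]|].
  intros h Hh. pose proof (Rmin_l 1 (e / M)). pose proof (Rmin_r 1 (e / M)).
  rewrite Cexp_add.
  replace (Cexp z * Cexp h - Cexp z - Cexp z * h) with (Cexp z * (Cexp h - 1 - h)) by ring.
  rewrite Cmod_mult. pose proof (Cexp_bound2 h ltac:(lra)). pose proof (Cmod_ge_0 h).
  pose proof (Cmod_ge_0 (Cexp z)).
  assert (Cmod h * M <= e)%R.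
  { apply Rle_trans with (e / M * M)%R; [apply Rmult_le_compat_r; lra|right; field; lra]. }
  apply Rle_trans with (M * Cmod h ^ 2)%R; [|simpl; nra].
  apply Rle_trans with (Cmod (Cexp z) * (16 * Cmod h ^ 2))%R.
  apply Rmult_le_compat_l; auto. unfold M. pose proof (pow2_ge_0 (Cmod h)). nra.
Qed.

(** * The cotangent *)

Definition pii : C := RtoC PI * Ci.
Definition ee (w : C) : C := Cexp (2 * pii * w).
(* [pi cot (pi w)], through [ee w = exp (2 pi i w)]; division by zero makes it 0 at the integers. *)
Definition ct (w : C) : C := pii * (ee w + 1) / (ee w - 1).
Definition isint (w : C) : Prop := exists k : Z, w = RtoC (IZR k).
(* The [j]-th derivative of [pi^2 / sin^2 (pi w)] for [j <= 4], as a polynomial in [ct w]. *)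
Definition sd (j : nat) (w : C) : C :=
  let c := ct w in
  let s := c * c - pii * pii in
  let s1 := - (2 * c * s) in
  let s2 := 6 * (s * s) + 4 * (pii * pii) * s in
  match j with
  | 0%nat => s
  | 1%nat => s1
  | 2%nat => s2
  | 3%nat => 12 * s * s1 + 4 * (pii * pii) * s1
  | _ => 12 * (s1 * s1) + 12 * s * s2 + 4 * (pii * pii) * s2
  end.

Lemma RtoC_nz (r : R) : r <> 0%R -> RtoC r <> 0.
Proof. intros H E. apply RtoC_inj in E. auto. Qed.
Lemma Cinv_nz (z : C) : z <> 0 -> / z <> 0.
Proof.
  intros H E. apply (f_equal (Cmult z)) in E. rewrite (Cinv_r z H) in E.
  apply (RtoC_nz 1); [lra|]. rewrite E; ring.
Qed.
Lemma C2_nz : RtoC 2 <> 0.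
Proof. apply RtoC_nz; lra. Qed.
Lemma Ci_nz : Ci <> 0.
Proof. apply Cmod_gt_0. rewrite Cmod_Ci. lra. Qed.
Lemma PI_nz : RtoC PI <> 0.
Proof. apply RtoC_nz. pose proof PI_RGT_0; lra. Qed.
Lemma pii_nz : pii <> 0.
Proof. apply Cmult_neq_0; [apply PI_nz|apply Ci_nz]. Qed.
Lemma Ci_sq : Ci * Ci = -(1).
Proof. unfold Ci, Cmult, Copp, RtoC; simpl. f_equal; ring. Qed.
Lemma pii_sq : pii * pii = - (RtoC PI * RtoC PI).
Proof. unfold pii. replace (RtoC PI * Ci * (RtoC PI * Ci)) with (RtoC PI * RtoC PI * (Ci * Ci)) by ring. rewrite Ci_sq; ring. Qed.
Lemma Cmod_pii : Cmod pii = PI.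
Proof. unfold pii. rewrite Cmod_mult, Cmod_Ci, Cmod_R, Rabs_pos_eq; [ring|]. apply Rlt_le, PI_RGT_0. Qed.

Lemma ee_pair w : ee w = (exp (- (2 * PI * Im w)) * cos (2 * PI * Re w),
   exp (- (2 * PI * Im w)) * sin (2 * PI * Re w))%R.
Proof.
  unfold ee. rewrite Cexp_pair. destruct w as [a b].
  unfold pii, Cmult, Ci, RtoC; simpl.
  do 2 f_equal; f_equal; ring.
Qed.
Lemma ee_add a b : ee (a + b) = ee a * ee b.
Proof. unfold ee. rewrite <- Cexp_add. f_equal; ring. Qed.
Lemma ee_nz w : ee w <> 0.
Proof. apply Cexp_nz. Qed.
Lemma ee_opp w : ee (- w) = / ee w.
Proof. unfold ee. rewrite <- Cexp_opp. f_equal; ring. Qed.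
Lemma ee_sub a b : ee (a - b) = ee a / ee b.
Proof. unfold Cminus. now rewrite ee_add, ee_opp. Qed.
Lemma Cmod_ee w : Cmod (ee w) = exp (- (2 * PI * Im w)).
Proof.
  unfold ee. rewrite Cmod_Cexp. f_equal. destruct w as [a b].
  unfold pii, Cmult, Ci, RtoC; simpl. ring.
Qed.
Lemma Cmod2 (a b : R) : (Cmod (a, b) ^ 2 = a ^ 2 + b ^ 2)%R.
Proof. rewrite Cmod2_alt. reflexivity. Qed.
(** |A e^(it) - 1|^2 = (A - 1)^2 + 2 A (1 - cos t) with t = 2 pi Re w. Both summands are
    nonnegative, so the formula locates the zeros of [ee w - 1] and also bounds it from below. *)
Lemma ee_dist2 w : (Cmod (ee w - 1) ^ 2 = (exp (- (2 * PI * Im w)) - 1) ^ 2 +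
   4 * exp (- (2 * PI * Im w)) * sin (PI * Re w) ^ 2)%R.
Proof.
  rewrite ee_pair. set (A := exp _).
  replace (2 * PI * Re w)%R with (2 * (PI * Re w))%R by ring.
  unfold Cminus, Cplus, Copp, RtoC; simpl fst; simpl snd. rewrite Cmod2.
  rewrite cos_2a, sin_2a. set (s := sin _). set (c := cos _).
  assert (E : (c * c = 1 - s * s)%R).
  { pose proof (sin2_cos2 (PI * Re w)). unfold Rsqr in H. fold s c in H. lra. }
  replace ((A * (2 * s * c) + - 0) ^ 2)%R with (A * A * (4 * (s * s) * (c * c)))%R by ring.
  rewrite E. ring.
Qed.
Lemma ee_1_iff w : ee w = 1 <-> isint w.
Proof.
  split.
  - intros E. pose proof (ee_dist2 w) as D. rewrite E in D.
    replace (1 - 1) with (RtoC 0) in D by ring. rewrite Cmod_0 in D.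
    set (A := exp _) in D. assert (PA : (0 < A)%R) by apply exp_pos.
    assert (S0 : sin (PI * Re w) = 0%R).
    { pose proof (pow2_ge_0 (A - 1)). pose proof (pow2_ge_0 (sin (PI * Re w))).
      assert (sin (PI * Re w) ^ 2 = 0)%R by nra.
      destruct (Req_dec (sin (PI * Re w)) 0); auto.
      exfalso. apply (pow_nonzero _ 2) in H2. auto. }
    rewrite S0 in D. assert (A1 : A = 1%R) by nra.
    unfold A in A1. rewrite <- exp_0 in A1. apply exp_inv in A1.
    pose proof PI_RGT_0.
    destruct (sin_eq_0_0 _ S0) as [k Hk]. exists k.
    destruct w as [a b]; simpl in *. unfold RtoC. f_equal.
    + apply Rmult_eq_reg_l with PI; lra.
    + assert (PI * b = 0)%R by lra. apply Rmult_integral in H0. lra.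
  - intros [k ->]. apply Csub_0, Cmod_eq_0. pose proof (ee_dist2 (RtoC (IZR k))) as D.
    simpl Re in D; simpl Im in D. rewrite Rmult_0_r, Ropp_0, exp_0 in D.
    rewrite (Rmult_comm PI), (sin_eq_0_1 (IZR k * PI)) in D by (exists k; auto).
    apply Rsqr_0_uniq. unfold Rsqr. lra.
Qed.
Lemma ee_int k : ee (RtoC (IZR k)) = 1.
Proof. apply ee_1_iff. now exists k. Qed.
Lemma ee_ne1 w : ~ isint w -> ee w - 1 <> 0.
Proof. intros H E. apply H, ee_1_iff. now apply Csub_0. Qed.

Lemma isint_opp w : isint (- w) <-> isint w.
Proof.
  assert (H : forall w, isint w -> isint (- w)).
  { intros v [k ->]. exists (- k)%Z. now rewrite opp_IZR, RtoC_opp. }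
  split; auto. intros Hw. replace w with (- - w) by ring. auto.
Qed.
Lemma isint_shift w k : isint (w + RtoC (IZR k)) <-> isint w.
Proof.
  rewrite <- !ee_1_iff, ee_add, ee_int. now rewrite Cmult_1_r.
Qed.

Lemma ct_shift w k : ct (w + RtoC (IZR k)) = ct w.
Proof. unfold ct. now rewrite ee_add, ee_int, Cmult_1_r. Qed.
Lemma sd_ct_eq j w w' : ct w = ct w' -> sd j w = sd j w'.
Proof. intros E. unfold sd. now rewrite E. Qed.
Lemma sd_shift j w k : sd j (w + RtoC (IZR k)) = sd j w.
Proof. apply sd_ct_eq, ct_shift. Qed.
Lemma ct_opp w : ct (- w) = - ct w.
Proof.
  destruct (classic (isint w)) as [H|H].
  (* At an integer both sides are 0, because the denominator is 0 and [/ 0 = 0]. *)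
  - assert (E : ee w = 1) by now apply ee_1_iff.
    unfold ct. rewrite ee_opp, E. replace (/ 1) with (RtoC 1) by (field; apply RtoC_nz; lra).
    replace (1 - 1) with (RtoC 0) by ring. unfold Cdiv.
    replace (/ 0) with (RtoC 0). ring.
    unfold Cinv, RtoC; simpl. f_equal; unfold Rdiv; rewrite ?Ropp_0; ring.
  - pose proof (ee_ne1 _ H) as N. pose proof (ee_nz w) as N0.
    assert (N' : 1 - ee w <> 0).
    { intros E. apply N. replace (ee w - 1) with (- (1 - ee w)) by ring. rewrite E; ring. }
    unfold ct. rewrite ee_opp. field. repeat split; auto.
Qed.
Lemma sd0 w : sd 0 w = ct w * ct w - pii * pii.
Proof. reflexivity. Qed.
Lemma sd1 w : sd 1 w = - (2 * ct w * sd 0 w).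
Proof. reflexivity. Qed.
Lemma sd2 w : sd 2 w = 6 * (sd 0 w * sd 0 w) + 4 * (pii * pii) * sd 0 w.
Proof. reflexivity. Qed.
Lemma sd0_opp w : sd 0 (- w) = sd 0 w.
Proof. unfold sd. rewrite ct_opp. ring. Qed.
Lemma sd0_ee w : ~ isint w ->
  sd 0 w = 4 * (pii * pii) * ee w / ((ee w - 1) * (ee w - 1)).
Proof. intros H. pose proof (ee_ne1 _ H). unfold sd, ct. field; auto. Qed.

Lemma cder_ee w : cder ee w (2 * pii * ee w).
Proof.
  eapply cder_eq; [|apply (cder_comp Cexp (fun w => 2 * pii * w)); [|apply cder_Cexp]].
  2: apply cder_scal, cder_id. fold (ee w). ring.
Qed.
Lemma cder_ct w : ~ isint w -> cder ct w (- sd 0 w).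
Proof.
  intros H. pose proof (ee_ne1 _ H) as N.
  eapply cder_eq; [|apply (cder_mult (fun w => pii * (ee w + 1)) (fun w => / (ee w - 1)))].
  3:{ apply cder_inv; auto. apply cder_minus; [apply cder_ee|apply cder_const]. }
  2:{ apply cder_scal, cder_plus; [apply cder_ee|apply cder_const]. }
  rewrite sd0_ee by auto. cbv beta. field; auto.
Qed.
(** From c' = - s and s = c^2 - pii^2 follow s' = - 2 c s and s'' = 6 s^2 + 4 pii^2 s; the higher
    cases differentiate the last relation. *)
Lemma cder_sd j w : (j <= 3)%nat -> ~ isint w -> cder (sd j) w (sd (S j) w).
Proof.
  intros Hj H. pose proof (cder_ct w H) as Hc.
  assert (H0 : cder (sd 0) w (sd 1 w)).
  { eapply cder_eq; [|apply cder_minus; [apply cder_mult; exact Hc|apply cder_const]].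
    rewrite sd1. ring. }
  assert (H1 : cder (sd 1) w (sd 2 w)).
  { eapply cder_eq; [|apply cder_opp; apply cder_mult; [apply cder_scal, Hc|exact H0]].
    rewrite sd2, sd1, sd0. ring. }
  assert (H2 : cder (sd 2) w (sd 3 w)).
  { eapply cder_eq; [|apply cder_plus; [apply cder_scal, cder_mult; exact H0|
      apply cder_scal; exact H0]].
    unfold sd. ring. }
  assert (H3 : cder (sd 3) w (sd 4 w)).
  { eapply cder_eq; [|apply cder_plus; [apply cder_mult; [apply cder_scal; exact H0|exact H1]|
      apply cder_scal; exact H1]].
    unfold sd. ring. }
  destruct j as [|[|[|[|j]]]]; auto. lia.
Qed.

(** Moving w / 2 by one half changes the sign of Y = [ee (w / 2)], which inverts the quotient (Y +
    1) / (Y - 1). *)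
Lemma ct_double w : ~ isint w ->
  ct (w / 2) <> 0 /\ ct ((w + 1) / 2) * ct (w / 2) = pii * pii /\
  2 * ct w = ct (w / 2) + ct ((w + 1) / 2).
Proof.
  intros H. pose proof C2_nz. pose proof pii_nz.
  set (Y := ee (w / 2)).
  assert (E1 : ee w = Y * Y). { unfold Y. rewrite <- ee_add. f_equal. field; auto. }
  assert (E2 : ee ((w + 1) / 2) = - Y).
  { replace ((w + 1) / 2) with (w / 2 + / 2) by (field; auto). rewrite ee_add. fold Y.
    replace (ee (/ 2)) with (-(1)). ring.
    rewrite ee_pair.
    replace (/ RtoC 2) with (RtoC (/ 2)) by (rewrite RtoC_inv; auto; lra).
    simpl. rewrite Rmult_0_r, Ropp_0, exp_0.
    replace (2 * PI * / 2)%R with PI by field. rewrite cos_PI, sin_PI.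
    unfold Copp, RtoC; simpl. f_equal; ring. }
  apply ee_ne1 in H. rewrite E1 in H.
  assert (N1 : Y - 1 <> 0). { intros E. apply H. apply Csub_0 in E. rewrite E; ring. }
  assert (N2 : Y + 1 <> 0).
  { intros E. apply H. replace Y with ((Y + 1) - 1) by ring. rewrite E; ring. }
  assert (N3 : - Y - 1 <> 0).
  { intros E. apply N2. replace (Y + 1) with (- (- Y - 1)) by ring. rewrite E; ring. }
  unfold ct. rewrite E1, E2. fold Y. clearbody Y. split.
  - apply Cmult_neq_0; [apply Cmult_neq_0; auto|now apply Cinv_nz].
  - split; field; repeat split; auto.
Qed.
Lemma sd0_double w : ~ isint w -> sd 0 (w / 2) + sd 0 ((w + 1) / 2) = 2 ^ 2 * sd 0 w.
Proof.
  intros H. destruct (ct_double w H) as [_ [E1 E2]]. rewrite !sd0.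
  transitivity ((2 * ct w) * (2 * ct w) - 4 * (pii * pii)); [|ring].
  rewrite E2. set (a := ct (w / 2)) in *. set (b := ct ((w + 1) / 2)) in *.
  replace ((a + b) * (a + b)) with (a * a + b * b + 2 * (b * a)) by ring. rewrite E1. ring.
Qed.
(* [sd 0] and [s4] satisfy [phi (w/2) + phi ((w+1)/2) = 2^e phi w] with e = 2, 4, as do the
   series [sum_m 1/(w+m)^e]. *)
Definition s4 (w : C) : C := / 6 * sd 2 w.
(** The two cotangents have product pii^2, so the two values u, v of [sd 0] satisfy u v = - pii^2 (u
    + v). Hence u^2 + v^2 is a polynomial in u + v, which [sd0_double] evaluates. *)
Lemma s4_double w : ~ isint w -> s4 (w / 2) + s4 ((w + 1) / 2) = 2 ^ 4 * s4 w.
Proof.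
  intros H. pose proof (sd0_double w H) as D.
  destruct (ct_double w H) as [_ [E1 E2]]. unfold s4. rewrite !sd2.
  set (p2 := pii * pii) in *.
  assert (E3 : sd 0 (w / 2) * sd 0 ((w + 1) / 2) = - (p2 * (sd 0 (w / 2) + sd 0 ((w + 1) / 2)))).
  { rewrite !sd0. fold p2. set (a := ct (w / 2)) in *. set (b := ct ((w + 1) / 2)) in *.
    replace ((a * a - p2) * (b * b - p2)) with
     ((b * a) * (b * a) - p2 * (a * a + b * b) + p2 * p2) by ring. rewrite E1. ring. }
  set (u := sd 0 (w / 2)) in *. set (v := sd 0 ((w + 1) / 2)) in *. set (s := sd 0 w) in *.
  transitivity (/ 6 * (6 * ((u + v) * (u + v)) - 12 * (u * v) + 4 * p2 * (u + v))); [ring|].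
  rewrite E3, D. field.
Qed.

(** * Bounds far from the real axis and near the pole *)

Lemma exp_nat_mult (n : nat) x : exp (INR n * x) = (exp x ^ n)%R.
Proof.
  induction n. simpl. now rewrite Rmult_0_l, exp_0.
  rewrite S_INR. replace ((INR n + 1) * x)%R with (INR n * x + x)%R by ring.
  rewrite exp_plus, IHn. simpl; ring.
Qed.
(** Of the exponential decay only an eighth power is kept, from exp y >= (y / 8)^8. This leaves room
    for the factors [zn n] that differentiation in tau and the double series introduce. *)
Lemma exp_decay y : (1 <= y)%R -> (exp (- (2 * PI * y)) <= 8 ^ 8 / y ^ 8 /\
   exp (- (2 * PI * y)) <= / 2)%R.
Proof.
  intros Hy. pose proof PI2_1.
  assert (E1 : (exp (- (2 * PI * y)) <= / exp y)%R).
  { rewrite <- exp_Ropp. destruct (Req_dec (- (2 * PI * y)) (- y)) as [-> |N]; [lra|].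
    left. apply exp_increasing. nra. }
  split; (eapply Rle_trans; [exact E1|]).
  - replace (8 ^ 8 / y ^ 8)%R with (/ (y / 8) ^ 8)%R by (field; lra).
    apply Rinv_le_contravar. apply pow_lt; lra.
    replace y with (INR 8 * (y / 8))%R at 2 by (simpl; field).
    rewrite exp_nat_mult. apply pow_incr. pose proof (exp_ineq1_le (y / 8)). lra.
  - apply Rinv_le_contravar; [lra|]. pose proof (exp_ineq1_le y). lra.
Qed.

Lemma ct_far w : (1 <= Im w)%R ->
  (Cmod (ct w + pii) <= 4 * PI * exp (- (2 * PI * Im w)))%R /\
  (Cmod (sd 0 w) <= 16 * PI ^ 2 * exp (- (2 * PI * Im w)))%R.
Proof.
  intros Hy. destruct (exp_decay _ Hy) as [_ H2]. rewrite <- Cmod_ee in *.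
  assert (N : ~ isint w). { intros [k E]. rewrite E in Hy. simpl in Hy. lra. }
  assert (L : (/ 2 <= Cmod (ee w - 1))%R).
  { pose proof (Cmod_tri_rev (-(1)) (ee w)). rewrite Cmod_m1 in H.
    replace (- (1) + ee w) with (ee w - 1) in H by ring. lra. }
  pose proof (ee_ne1 _ N) as N1.
  pose proof PI_RGT_0. pose proof (Cmod_ge_0 (ee w)).
  assert (L' : (/ Cmod (ee w - 1) <= 2)%R).
  { replace 2%R with (/ / 2)%R by field. apply Rinv_le_contravar; lra. }
  assert (L0 : (0 < / Cmod (ee w - 1))%R) by (apply Rinv_0_lt_compat; lra).
  split.
  - replace (ct w + pii) with (2 * pii * ee w * / (ee w - 1)) by (unfold ct; field; auto).
    rewrite !Cmod_mult, Cmod_inv, Cmod_pii, Cmod_R, Rabs_pos_eq by (auto; lra).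
    assert (0 <= PI * Cmod (ee w))%R by (apply Rmult_le_pos; lra). nra.
  - rewrite sd0_ee by auto. unfold Cdiv.
    rewrite !Cmod_mult, Cmod_inv by (apply Cmult_neq_0; auto).
    rewrite !Cmod_mult, Rinv_mult, Cmod_pii, Cmod_R, Rabs_pos_eq by lra.
    set (i := (/ Cmod (ee w - 1))%R) in *.
    assert (0 <= PI ^ 2 * Cmod (ee w))%R by (apply Rmult_le_pos; [apply pow2_ge_0|lra]).
    assert (i * i <= 4)%R by nra. simpl in *. nra.
Qed.

(** Every [sd j] is [sd 0] times a polynomial in [ct] and [sd 0], both bounded once |Im w| >= 1; the
    lower half-plane follows from parity. *)
Lemma far_bounds : exists K, (0 < K)%R /\
  (forall w, (1 <= Im w)%R -> (Cmod (ct w + pii) <= K / Rabs (Im w) ^ 8)%R) /\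
  (forall w, (Im w <= -1)%R -> (Cmod (ct w - pii) <= K / Rabs (Im w) ^ 8)%R) /\
  (forall j w, (j <= 4)%nat -> (1 <= Rabs (Im w))%R ->
     (Cmod (sd j w) <= K / Rabs (Im w) ^ 8)%R).
Proof.
  pose proof PI_RGT_0 as HP. pose proof PI_4 as HP4.
  set (K0 := (256 * 8 ^ 8)%R).
  assert (up : forall w, (1 <= Im w)%R -> (Cmod (ct w + pii) <= K0 / Rabs (Im w) ^ 8)%R
    /\ (Cmod (sd 0 w) <= K0 / Rabs (Im w) ^ 8)%R /\ (Cmod (ct w) <= 20)%R
    /\ (Cmod (sd 0 w) <= 128)%R).
  { intros w Hw. destruct (ct_far w Hw) as [H1 H2]. destruct (exp_decay _ Hw) as [E1 E2].
    rewrite Rabs_pos_eq by lra. set (x := exp _) in *.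
    assert (Px : (0 < x)%R) by apply exp_pos.
    assert (HP2 : (PI ^ 2 <= 16)%R) by (simpl; nra).
    assert (HPx : (4 * PI * x <= 16 * x)%R) by nra.
    assert (HPx2 : (16 * PI ^ 2 * x <= 256 * x)%R) by nra.
    replace (K0 / Im w ^ 8)%R with (256 * (8 ^ 8 / Im w ^ 8))%R by (unfold K0, Rdiv; ring).
    split; [|split; [|split]]; try lra.
    pose proof (Cmod_triangle (ct w + pii) (- pii)). rewrite Cmod_opp, Cmod_pii in H.
    replace (ct w + pii + - pii) with (ct w) in H by ring. lra. }
  assert (dn : forall w, (Im w <= -1)%R -> (Cmod (ct w - pii) <= K0 / Rabs (Im w) ^ 8)%R
    /\ (Cmod (sd 0 w) <= K0 / Rabs (Im w) ^ 8)%R /\ (Cmod (ct w) <= 20)%R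
    /\ (Cmod (sd 0 w) <= 128)%R).
  { intros w Hw. destruct (up (- w)) as [H1 [H2 [H3 H4]]].
    { destruct w as [a b]; simpl in *; lra. }
    rewrite ct_opp, sd0_opp in *. rewrite Cmod_opp in H3.
    replace (Rabs (Im (- w))) with (Rabs (Im w)) in *
      by (destruct w as [a b]; simpl; now rewrite Rabs_Ropp).
    replace (- ct w + pii) with (- (ct w - pii)) in H1 by ring. rewrite Cmod_opp in H1. auto. }
  assert (K0p : (0 < K0)%R) by (unfold K0; lra).
  (* Q dominates all the factors found below, the largest being 10^8 for [sd 4]. *)
  set (Q := (10 ^ 9)%R). assert (HQ : (1 <= Q)%R) by (unfold Q; lra).
  assert (big : forall w, (1 <= Rabs (Im w))%R -> (K0 / Rabs (Im w) ^ 8 <= Q * K0 / Rabs (Im w) ^ 8)%R).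
  { intros w Hw. unfold Rdiv. apply Rmult_le_compat_r.
    apply Rlt_le, Rinv_0_lt_compat, pow_lt; lra. nra. }
  exists (Q * K0)%R. split; [nra|]. split; [|split].
  - intros w Hw. destruct (up w Hw) as [H1 _]. eapply Rle_trans; [exact H1|apply big].
    rewrite Rabs_pos_eq; lra.
  - intros w Hw. destruct (dn w Hw) as [H1 _]. eapply Rle_trans; [exact H1|apply big].
    rewrite Rabs_left1; lra.
  - intros j w Hj Hw.
    assert (B : (Cmod (sd 0 w) <= K0 / Rabs (Im w) ^ 8)%R /\ (Cmod (ct w) <= 20)%R
      /\ (Cmod (sd 0 w) <= 128)%R).
    { destruct (Rle_lt_dec 0 (Im w)).
      - rewrite Rabs_pos_eq in Hw by auto. apply up; auto.
      - rewrite Rabs_left in Hw by auto. apply dn; lra. }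
    destruct B as [B0 [Bc Bs]].
    apply Rle_trans with (Q * Cmod (sd 0 w))%R.
    2:{ unfold Rdiv in *. rewrite Rmult_assoc. apply Rmult_le_compat_l; lra. }
    clear B0 big up dn.
    assert (E1 : sd 1 w = - (2 * ct w) * sd 0 w) by (rewrite sd1; ring).
    assert (E2 : sd 2 w = (6 * sd 0 w + 4 * (pii * pii)) * sd 0 w) by (rewrite sd2; ring).
    assert (E3 : sd 3 w = (12 * sd 0 w + 4 * (pii * pii)) * sd 1 w) by (unfold sd; ring).
    assert (E4 : sd 4 w = 12 * sd 1 w * sd 1 w + (12 * sd 0 w + 4 * (pii * pii)) * sd 2 w)
      by (unfold sd; ring).
    pose proof (Cmod_ge_0 (sd 0 w)) as P0. pose proof (Cmod_ge_0 (ct w)) as Pc.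
    set (s := Cmod (sd 0 w)) in *.
    assert (Bp : (Cmod (4 * (pii * pii)) <= 64)%R).
    { rewrite !Cmod_mult, Cmod_pii, Cmod_R, Rabs_pos_eq by lra. nra. }
    assert (B1 : (Cmod (sd 1 w) <= 40 * s)%R).
    { rewrite E1, Cmod_mult, Cmod_opp, Cmod_mult, Cmod_R, Rabs_pos_eq by lra. fold s. nra. }
    assert (B2 : (Cmod (sd 2 w) <= 832 * s)%R).
    { rewrite E2, Cmod_mult. apply Rmult_le_compat_r; auto.
      eapply Rle_trans; [apply Cmod_triangle|]. rewrite Cmod_mult, Cmod_R, Rabs_pos_eq by lra.
      fold s. lra. }
    assert (Bt : (Cmod (12 * sd 0 w + 4 * (pii * pii)) <= 1600)%R).
    { eapply Rle_trans; [apply Cmod_triangle|]. rewrite Cmod_mult, Cmod_R, Rabs_pos_eq by lra.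
      fold s. lra. }
    pose proof (Cmod_ge_0 (sd 1 w)) as P1. pose proof (Cmod_ge_0 (sd 2 w)) as P2.
    pose proof (Cmod_ge_0 (12 * sd 0 w + 4 * (pii * pii))) as Pt.
    assert (B3 : (Cmod (sd 3 w) <= 64000 * s)%R).
    { rewrite E3, Cmod_mult. nra. }
    assert (B4 : (Cmod (sd 4 w) <= 10 ^ 8 * s)%R).
    { rewrite E4. eapply Rle_trans; [apply Cmod_triangle|].
      rewrite !Cmod_mult, Cmod_R, Rabs_pos_eq by lra.
      assert (Cmod (sd 1 w) <= 5120)%R by lra.
      assert (Cmod (12 * sd 0 w + 4 * (pii * pii)) * Cmod (sd 2 w) <= 1600 * (832 * s))%R
        by (apply Rmult_le_compat; auto).
      assert (Cmod (sd 1 w) * Cmod (sd 1 w) <= 5120 * (40 * s))%R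
        by (apply Rmult_le_compat; auto). lra. }
    unfold Q. destruct j as [|[|[|[|[|j]]]]]; try lia; try lra. fold s. lra.
Qed.

(** In this region 0 is the only pole. For |w| <= 1/256 the second-order bound on the exponential
    applies; otherwise |Re w| >= 1/512, and the sine term of [ee_dist2] keeps [ee w - 1] away from
    0. *)
Lemma ct_near : exists K, (0 < K)%R /\ forall w : C, w <> 0 ->
  (Rabs (Re w) <= 3 / 4)%R -> (Rabs (Im w) <= / 512)%R -> (Cmod (ct w - / w) <= K)%R.
Proof.
  pose proof PI_RGT_0 as HP. pose proof PI_4 as HP4. pose proof PI2_1 as HP2.
  set (m := Rmin (sin (PI * / 512)) (sin (PI * / 4))).
  assert (Hm : (0 < m)%R).
  { apply Rmin_glb_lt; apply sin_gt_0; lra. }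
  exists (400 + (PI * 4 / m + 512))%R. split.
  { assert (0 < PI * 4 / m)%R by (apply Rdiv_lt_0_compat; lra). lra. }
  intros w Hw Hr Hi.
  assert (Hmp : (0 < PI * 4 / m)%R) by (apply Rdiv_lt_0_compat; lra).
  assert (Pw := proj1 (Cmod_gt_0 w) Hw).
  pose proof (ee_dist2 w) as D.
  destruct (Rle_lt_dec (Cmod w) (/ 256)) as [L|L].
  - apply Rle_trans with 400%R; [|lra].
    set (v := 2 * pii * w).
    assert (Ev : Cmod v = (2 * PI * Cmod w)%R).
    { unfold v. rewrite !Cmod_mult, Cmod_pii, Cmod_R, Rabs_pos_eq; lra. }
    assert (Hv : (Cmod v <= / 32)%R) by (rewrite Ev; nra).
    assert (Pv : (0 < Cmod v)%R) by (rewrite Ev; nra).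
    set (r := ee w - 1 - v).
    assert (Hrr : (Cmod r <= 16 * Cmod v ^ 2)%R).
    { apply Cexp_bound2. fold v. lra. }
    assert (Ex : ee w = 1 + v + r) by (unfold r; ring).
    assert (Nv : v <> 0) by now apply Cmod_gt_0.
    assert (L1 : (Cmod v / 2 <= Cmod (v + r))%R).
    { pose proof (Cmod_tri_rev v r). simpl in Hrr. nra. }
    assert (N1 : v + r <> 0) by (apply Cmod_gt_0; lra).
    assert (E : ct w - / w = pii * (v * v + v * r - 2 * r) * / (v * (v + r))).
    { unfold ct. rewrite Ex.
      replace (/ w) with (2 * pii * / v).
      2:{ unfold v. pose proof pii_nz. field. auto. }
      replace (1 + v + r - 1) with (v + r) by ring. field; auto. }
    rewrite E, !Cmod_mult, Cmod_inv, Cmod_mult, Cmod_pii by (apply Cmult_neq_0; auto).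
    assert (Hn : (Cmod (v * v + v * r - 2 * r) <= 34 * Cmod v ^ 2)%R).
    { eapply Rle_trans; [apply Cmod_triangle|]. rewrite Cmod_opp.
      eapply Rle_trans; [apply Rplus_le_compat_r, Cmod_triangle|].
      rewrite !Cmod_mult, Cmod_R, Rabs_pos_eq by lra.
      assert (Cmod v * Cmod r <= / 32 * (16 * Cmod v ^ 2))%R.
      { apply Rmult_le_compat; try apply Cmod_ge_0; auto. }
      pose proof (pow2_ge_0 (Cmod v)). simpl in *. lra. }
    assert (Hd : (Cmod v ^ 2 / 2 <= Cmod v * Cmod (v + r))%R) by (simpl; nra).
    assert (Pv2 : (0 < Cmod v ^ 2)%R) by (apply pow_lt; auto).
    apply Rmult_le_reg_r with (Cmod v * Cmod (v + r))%R; [lra|].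
    rewrite Rmult_assoc, Rinv_l, Rmult_1_r by lra.
    apply Rle_trans with (4 * (34 * Cmod v ^ 2))%R; [|lra].
    apply Rmult_le_compat; try lra; apply Cmod_ge_0.
  - apply Rle_trans with (PI * 4 / m + 512)%R; [|lra].
    set (A := exp _) in D. assert (PA : (0 < A)%R) by apply exp_pos.
    assert (HA : (/ 4 <= A <= 2)%R).
    { unfold A. apply Rabs_le_between in Hi.
      pose proof (exp_bound1 (- (2 * PI * Im w))) as B.
      assert (Hs : (Rabs (- (2 * PI * Im w)) <= / 64)%R).
      { rewrite Rabs_Ropp. apply Rabs_le. nra. }
      specialize (B ltac:(lra)). apply Rabs_le_between in B. lra. }
    assert (Hre : (/ 512 <= Rabs (Re w))%R) by (pose proof (Cmod_le_parts w); lra).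
    assert (Hsin : (m <= sin (PI * Rabs (Re w)))%R).
    (* t lies in [1/512, 3/4]. Beyond 1/2 the sine is reflected; its value at 3/4 of pi is that at
       1/4. *)
    { set (t := Rabs (Re w)) in *. destruct (Rle_lt_dec t (/ 2)).
      - apply Rle_trans with (sin (PI * / 512)); [apply Rmin_l|].
        apply sin_incr_1; nra.
      - apply Rle_trans with (sin (PI * / 4)); [apply Rmin_r|].
        replace (sin (PI * t)) with (sin (PI - PI * t)) by apply sin_PI_x.
        apply sin_incr_1; nra. }
    assert (Hs2 : (m ^ 2 <= sin (PI * Re w) ^ 2)%R).
    { replace (sin (PI * Re w) ^ 2)%R with (sin (PI * Rabs (Re w)) ^ 2)%R.
      apply pow_incr; lra.
      unfold Rabs. destruct (Rcase_abs (Re w)); auto.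
      replace (PI * - Re w)%R with (- (PI * Re w))%R by ring. rewrite sin_neg. ring. }
    assert (Hd : (m <= Cmod (ee w - 1))%R).
    {
      pose proof (Cmod_ge_0 (ee w - 1)). pose proof (pow2_ge_0 (A - 1)).
      apply Rsqr_incr_0; try lra. unfold Rsqr. simpl in *. nra. }
    assert (N1 : ee w - 1 <> 0) by (apply Cmod_gt_0; lra).
    eapply Rle_trans; [apply Cmod_triangle|]. rewrite Cmod_opp. apply Rplus_le_compat.
    + unfold ct. rewrite Cmod_div, Cmod_mult, Cmod_pii by auto.
      unfold Rdiv. apply Rmult_le_compat; try (apply Rmult_le_pos; try lra; apply Cmod_ge_0).
      * apply Rlt_le, Rinv_0_lt_compat; lra.
      * apply Rmult_le_compat_l; [lra|]. eapply Rle_trans; [apply Cmod_triangle|].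
        rewrite Cmod_1, Cmod_ee. fold A. lra.
      * apply Rinv_le_contravar; lra.
    + rewrite Cmod_inv by auto. replace 512%R with (/ / 512)%R by field.
      apply Rinv_le_contravar; lra.
Qed.

(** * Partial fractions *)

(** The remainder of F is the sum of the remainders of the terms: the finitely many in [l0] are
    o(|h|), the others total at most M |h|^2. The list [l0] is meant for terms with no uniform
    second-order bound, such as those close to a pole. *)
Lemma has_sum_cder {I} (f : I -> C -> C) (f' : I -> C) (F : C -> C) (L z : C) r b l0 :
  (0 < r)%R -> NoDup l0 ->
  (forall h, (Cmod h < r)%R -> has_sum (fun i => f i (z + h)) (F (z + h))) ->
  has_sum f' L -> bdd_sums b -> (forall i, (0 <= b i)%R) ->
  (forall i, In i l0 -> cder (f i) z (f' i)) ->
  (forall i h, ~ In i l0 -> (Cmod h < r)%R ->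
     (Cmod (f i (z + h)%C - f i z - f' i * h) <= b i * Cmod h ^ 2)%R) ->
  cder F z L.
Proof.
  intros Hr N0 HF HL [M HM] Hb Hd Hq e He.
  assert (HM0 : (0 <= M)%R) by (apply (HM nil); constructor).
  assert (fin : forall l, (forall i, In i l -> cder (f i) z (f' i)) ->
    exists d, (0 < d)%R /\ forall h, (Cmod h < d)%R ->
     (rsum (fun i => Cmod (f i (z + h)%C - f i z - f' i * h)) l <= e / 2 * Cmod h)%R).
  { clear - He. intros l. assert (G : forall e, (0 < e)%R -> (forall i, In i l -> cder (f i) z (f' i)) ->
      exists d, (0 < d)%R /\ forall h, (Cmod h < d)%R ->
     (rsum (fun i => Cmod (f i (z + h)%C - f i z - f' i * h)) l <= e * Cmod h)%R).
    { clear e He. induction l as [|i l IH]; intros e He H.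
      - exists 1%R; split; [lra|]. intros h _. simpl. pose proof (Cmod_ge_0 h). nra.
      - destruct (IH (e/2)%R) as [d1 [P1 H1]]; [lra|intros; apply H; now right|].
        destruct (H i (or_introl eq_refl) (e/2)%R) as [d2 [P2 H2]]; [lra|].
        exists (Rmin d1 d2); split; [now apply Rmin_glb_lt|]. intros h Hh.
        specialize (H1 h (Rlt_le_trans _ _ _ Hh (Rmin_l _ _))).
        specialize (H2 h (Rlt_le_trans _ _ _ Hh (Rmin_r _ _))). simpl. lra. }
    apply G; lra. }
  destruct (fin l0 Hd) as [d [Pd Hd']].
  exists (Rmin r (Rmin d (e / (2 * (M + 1))))). split.
  { repeat apply Rmin_glb_lt; auto. apply Rdiv_lt_0_compat; lra. }
  intros h Hh. set (d3 := (e / (2 * (M + 1)))%R) in *.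
  pose proof (Rmin_l r (Rmin d d3)). pose proof (Rmin_r r (Rmin d d3)).
  pose proof (Rmin_l d d3). pose proof (Rmin_r d d3).
  assert (Hh1 : (Cmod h < r)%R) by lra.
  assert (S : has_sum (fun i => f i (z + h) - f i z - f' i * h) (F (z + h) - F z - L * h)).
  { apply has_sum_minus. apply has_sum_minus. now apply HF.
    - specialize (HF 0). rewrite Cmod_0 in HF. specialize (HF Hr).
      replace (z + 0) with z in HF by ring. exact HF.
    - replace (L * h) with (h * L) by ring.
      eapply has_sum_ext; [|exact (has_sum_scal h _ _ HL)]. intros; cbv beta; ring. }
  pose proof (Cmod_ge_0 h) as Ph.
  apply (has_sum_bound _ _ _ S). intros l Nl.
  set (rho := fun i => Cmod (f i (z + h) - f i z - f' i * h)).
  destruct (union_list l l0 Nl N0) as [k [Nk [i1 i2]]].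
  apply Rle_trans with (rsum rho k). apply rsum_incl; auto. intros; apply Cmod_ge_0.
  rewrite (rsum_perm _ _ _ (incl_perm _ _ N0 Nk i2)), rsum_app.
  assert (H4 : (rsum rho (filt (fun i => ~ In i l0) k) <= M * Cmod h ^ 2)%R).
  { eapply Rle_trans; [apply (rsum_le _ (fun i => Cmod h ^ 2 * b i)%R)|].
    - intros i Hi. apply filt_In in Hi. unfold rho. rewrite Rmult_comm. apply Hq; tauto.
    - rewrite rsum_scal, Rmult_comm. apply Rmult_le_compat_r. apply pow2_ge_0.
      apply HM. now apply filt_NoDup. }
  specialize (Hd' h ltac:(lra)). fold rho in Hd'.
  assert (M * Cmod h ^ 2 <= e / 2 * Cmod h)%R; [|lra].
  assert (Hx : ((M + 1) * Cmod h <= e / 2)%R).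
  { apply Rle_trans with ((M + 1) * d3)%R. apply Rmult_le_compat_l; lra.
    unfold d3; right; field; lra. }
  simpl. nra.
Qed.

Lemma Re_mulR v (r : R) : Re (v * RtoC r) = (Re v * r)%R.
Proof. destruct v; simpl; ring. Qed.
Lemma Im_mulR v (r : R) : Im (v * RtoC r) = (Im v * r)%R.
Proof. destruct v; simpl; ring. Qed.
Lemma Re_addR v (r : R) : Re (v + RtoC r) = (Re v + r)%R.
Proof. destruct v; simpl; ring. Qed.
Lemma Im_addR v (r : R) : Im (v + RtoC r) = Im v.
Proof. destruct v; simpl; ring. Qed.

Lemma inv_shift_bound z : exists B, forall m : Z,
  (/ Cmod (z + RtoC (IZR m)) <= B / zn m)%R.
Proof.
  destruct (eventually_bound (fun m => / Cmod (z + RtoC (IZR m)))%R 4 1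
    (Z.to_nat (up (2 * Cmod z + 1)))) as [B HB].
  - intros n Hn. rewrite pow_1.
    destruct (archimed (2 * Cmod z + 1)) as [Ha _].
    pose proof (Cmod_ge_0 z).
    assert (Hup : (0 <= up (2 * Cmod z + 1))%Z) by (apply le_IZR; lra).
    rewrite Z2Nat.id in Hn by auto. apply IZR_lt in Hn.
    pose proof (Cmod_tri_rev (RtoC (IZR n)) z) as T. rewrite Cmod_R, <- abs_IZR in T.
    replace (RtoC (IZR n) + z) with (z + RtoC (IZR n)) in T by ring.
    unfold zn. set (a := IZR (Z.abs n)) in *.
    replace (4 / (1 + a))%R with (/ ((1 + a) / 4))%R by (field; lra).
    apply Rinv_le_contravar; lra.
  - exists B. intros m. specialize (HB m). now rewrite pow_1 in HB.
Qed.
Lemma inv_shift_bound_pos z : exists B, (0 < B)%R /\ forall m : Z,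
  (/ Cmod (z + RtoC (IZR m)) <= B / zn m)%R.
Proof.
  destruct (inv_shift_bound z) as [B HB]. exists (Rabs B + 1)%R.
  pose proof (Rabs_pos B). pose proof (Rle_abs B). split; [lra|].
  intros m. eapply Rle_trans; [apply HB|]. unfold Rdiv. apply Rmult_le_compat_r; [|lra].
  apply Rlt_le, Rinv_0_lt_compat. pose proof (zn_ge1 m); lra.
Qed.
Lemma shift_nz z m : ~ isint z -> z + RtoC (IZR m) <> 0.
Proof.
  intros H E. apply H. exists (- m)%Z. rewrite opp_IZR, RtoC_opp.
  replace z with (z + RtoC (IZR m) - RtoC (IZR m)) by ring. rewrite E. ring.
Qed.
Lemma isint_div z (N : nat) i : (0 < N)%nat -> ~ isint z ->
  ~ isint ((z + RtoC (IZR i)) / RtoC (INR N)).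
Proof.
  intros HN H [k E]. apply H. exists (k * Z.of_nat N - i)%Z.
  assert (NN : RtoC (INR N) <> 0) by (apply RtoC_nz, not_0_INR; lia).
  rewrite minus_IZR, mult_IZR, <- INR_IZR_INZ, RtoC_minus, RtoC_mult, <- E. field; auto.
Qed.

(** The representative of i modulo N in [- N / 2, N / 2). It keeps the real part of (z + k) / N
    within 3/4 of 0 for large N. *)
Definition centred (N i : nat) : Z :=
  if (2 * i <? N)%nat then Z.of_nat i else (Z.of_nat i - Z.of_nat N)%Z.

Lemma seq_add_map s N n : seq (s + N) n = map (fun i => (i + N)%nat) (seq s n).
Proof. revert s. induction n; simpl; intros s; f_equal. apply (IHn (S s)). Qed.

Lemma dyadic_sum (phi : C -> C) e :
  (forall z, ~ isint z -> phi (z / 2) + phi ((z + 1) / 2) = 2 ^ e * phi z) ->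
  forall z, ~ isint z -> forall j : nat,
  RtoC (INR (2 ^ j)) ^ e * phi z =
   lsum (fun i => phi ((z + RtoC (IZR (Z.of_nat i))) / RtoC (INR (2 ^ j)))) (seq 0 (2 ^ j)).
Proof.
  intros Hphi z Hz. induction j.
  - simpl (2 ^ 0)%nat. simpl seq. simpl lsum. rewrite Cpow_1_l.
    replace ((z + 0) / 1) with z by (field; apply RtoC_nz; lra). ring.
  - set (N := (2 ^ j)%nat) in *.
    assert (HN : (0 < N)%nat) by (unfold N; pose proof (Nat.pow_nonzero 2 j); lia).
    assert (NN : RtoC (INR N) <> 0) by (apply RtoC_nz, not_0_INR; lia).
    replace (2 ^ S j)%nat with (N + N)%nat by (unfold N; simpl; lia).
    rewrite plus_INR. replace (RtoC (INR N + INR N)) with (2 * RtoC (INR N))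
      by (rewrite RtoC_plus; ring).
    rewrite Cpow_mult_l, <- Cmult_assoc, IHj, seq_app, lsum_app, <- lsum_scal.
    simpl (0 + N)%nat.
    replace (seq N N) with (map (fun i => (i + N)%nat) (seq 0 N)).
    2:{ symmetry. rewrite <- (Nat.add_0_l N) at 1. apply seq_add_map. }
    rewrite lsum_map, <- lsum_plus. apply lsum_ext. intros i _.
    (* With w = (z + i) / N, the points w / 2 and (w + 1) / 2 are those of index i and i + N at
       level 2 N. *)
    rewrite <- Hphi by (apply isint_div; auto). f_equal; f_equal.
    + pose proof C2_nz. field; auto.
    + pose proof C2_nz. rewrite Nat2Z.inj_add, plus_IZR, RtoC_plus, <- (INR_IZR_INZ N).
      field; auto.
Qed.

(* Iterating the duplication formula gives [phi z = N^-e sum_k phi ((z+k)/N)] over N = 2^j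
   centred integers k; replacing each [phi w] by [1/w^e] costs [O (1/N) * sum_k 1/|z+k|]. *)
Lemma partial_fractions (phi : C -> C) (d : nat) (K delta : R) :
  (0 < K)%R -> (0 < delta)%R ->
  (forall z, ~ isint z -> phi (z / 2) + phi ((z + 1) / 2) = 2 ^ (S (S d)) * phi z) ->
  (forall z k, phi (z + RtoC (IZR k)) = phi z) ->
  (forall w : C, w <> 0 -> (Rabs (Re w) <= 3 / 4)%R -> (Rabs (Im w) <= delta)%R ->
     (Cmod (phi w - / w ^ (S (S d))) <= K / Cmod w ^ (S d))%R) ->
  forall z, ~ isint z -> has_sum (fun m => / (z + RtoC (IZR m)) ^ (S (S d))) (phi z).
Proof.
  intros HK Hdel Hdbl Hper Hnear z Hz.
  destruct (inv_shift_bound_pos z) as [B [PB HB]].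
  assert (Sm : summable (fun m => / (z + RtoC (IZR m)) ^ (S (S d)))).
  { apply (summable_pow_bound _ (B ^ (S (S d))) (S (S d))); [lia|]. intros m.
    pose proof (shift_nz z m Hz) as Nz. pose proof (proj1 (Cmod_gt_0 _) Nz) as Pz.
    rewrite Cmod_inv, Cmod_pow by now apply Cpow_nz.
    rewrite <- pow_inv. unfold Rdiv. rewrite <- pow_inv, <- Rpow_mult_distr.
    apply pow_incr. split; [|apply HB]. now apply Rlt_le, Rinv_0_lt_compat. }
  destruct (summable_has_sum _ Sm) as [t Ht].
  replace (phi z) with t; auto.
  destruct bdd_sums_32 as [M HM].
  assert (HM0 : (0 <= M)%R) by (apply (HM nil); constructor).
  set (Q := (K * B ^ S d * M + 1)%R).
  assert (PQ : (0 < Q)%R).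
  { unfold Q. assert (0 <= K * B ^ S d)%R by (apply Rmult_le_pos; [lra|apply pow_le; lra]).
    nra. }
  apply Cmod_small_eq. intros eps He.
  destruct (Ht (eps / 2)%R) as [l0 [N0 H0]]; [lra|].
  destruct (zrange_cover l0) as [N1 HN1].
  (* N = 2^j has four requirements: its centred range contains [l0], the points (z + k) / N satisfy
     the bounds 3/4 and delta, and the final error is at most eps / 2. *)
  assert (big : exists j : nat, forall x, In x [INR (2 * N1 + 2); 4 * Rabs (Re z) + 1; Rabs (Im z) / delta + 1; 16 * (Q / eps) ^ 2]%R -> (x <= INR (2 ^ j))%R).
  { assert (one : forall x : R, exists j, (x <= INR (2 ^ j))%R).
    { intros x. exists (Z.to_nat (up (Rabs x))).
      destruct (archimed (Rabs x)) as [Ha _]. pose proof (Rabs_pos x). pose proof (Rle_abs x).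
      assert (Hz0 : (0 <= up (Rabs x))%Z) by (apply le_IZR; lra).
      set (n := Z.to_nat _). assert (IZR (up (Rabs x)) = INR n).
      { unfold n. now rewrite INR_IZR_INZ, Z2Nat.id. }
      assert (Hpw : (n <= 2 ^ n)%nat). { pose proof (Nat.pow_gt_lin_r 2 n). lia. }
      apply le_INR in Hpw. lra. }
    generalize [INR (2 * N1 + 2); 4 * Rabs (Re z) + 1; Rabs (Im z) / delta + 1; 16 * (Q / eps) ^ 2]%R.
    induction l as [|y l [j Hj]]. exists 0%nat; intros x [].
    destruct (one y) as [j' Hj']. exists (j + j')%nat. intros x Hx.
    assert (mono : forall a b : nat, (INR (2 ^ a) <= INR (2 ^ (a + b)))%R).
    { intros a b. apply le_INR, Nat.pow_le_mono_r; lia. }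
    destruct Hx as [<-|Hx].
    - rewrite Nat.add_comm. eapply Rle_trans; [exact Hj'|apply mono].
    - eapply Rle_trans; [apply Hj; auto|apply mono]. }
  destruct big as [j Hj].
  set (N := (2 ^ j)%nat) in *.
  assert (J1 := Hj _ (or_introl eq_refl)).
  assert (J2 := Hj _ (or_intror (or_introl eq_refl))).
  assert (J3 := Hj _ (or_intror (or_intror (or_introl eq_refl)))).
  assert (J4 := Hj _ (or_intror (or_intror (or_intror (or_introl eq_refl))))).
  clear Hj. apply INR_le in J1.
  set (n := INR N) in *.
  assert (Hn : (1 <= n)%R). { pose proof (Rabs_pos (Re z)). lra. }
  assert (HnC : RtoC n <> 0) by (apply RtoC_nz; lra).
  set (L := map (centred N) (seq 0 N)).
  assert (NL : NoDup L).
  { unfold L. clear. assert (G : forall l, NoDup l -> (forall i, In i l -> (i < N)%nat) -> NoDup (map (centred N) l)).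
    { induction 1; simpl; intros Hi; constructor; auto.
      rewrite in_map_iff. intros [y [E Hy]]. assert (y = x); [|congruence].
      pose proof (Hi y (or_intror Hy)). pose proof (Hi x (or_introl eq_refl)).
      unfold centred in E. destruct (Nat.ltb_spec (2 * y) N), (Nat.ltb_spec (2 * x) N); lia. }
    apply G. apply seq_NoDup. intros i Hi; apply in_seq in Hi; lia. }
  assert (IL : forall k, In k L -> (2 * Z.abs k <= Z.of_nat N)%Z).
  { intros k Hk. unfold L in Hk. apply in_map_iff in Hk. destruct Hk as [i [<- Hi]].
    apply in_seq in Hi. unfold centred. destruct (Nat.ltb_spec (2 * i) N); lia. }
  assert (CL : incl l0 L).
  { intros k Hk. apply (HN1 N1 (le_n _)) in Hk. apply zrange_In in Hk.
    unfold L. apply in_map_iff.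
    destruct (Z_le_gt_dec 0 k).
    - exists (Z.to_nat k). rewrite in_seq. unfold centred.
      destruct (Nat.ltb_spec (2 * Z.to_nat k) N); lia.
    - exists (Z.to_nat (k + Z.of_nat N)). rewrite in_seq. unfold centred.
      destruct (Nat.ltb_spec (2 * Z.to_nat (k + Z.of_nat N)) N); lia. }
  specialize (H0 L NL CL).
  set (a := fun m => / (z + RtoC (IZR m)) ^ (S (S d))) in *.
  assert (E1 : phi z = lsum (fun k => / RtoC n ^ (S (S d)) * phi ((z + RtoC (IZR k)) / RtoC n)) L).
  { rewrite lsum_scal.
    replace (phi z) with (/ RtoC n ^ (S (S d)) * (RtoC n ^ (S (S d)) * phi z)).
    2:{ rewrite Cmult_assoc, Cinv_l. ring. now apply Cpow_nz. }
    f_equal. unfold n, N. rewrite dyadic_sum by auto. fold N. fold n.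
    unfold L. rewrite lsum_map. apply lsum_ext. intros i _. unfold centred.
    (* Replacing i by i - N moves (z + i) / N by -1, so periodicity applies. *)
    destruct (Nat.ltb (2 * i) N); auto.
    rewrite minus_IZR, <- (INR_IZR_INZ N), RtoC_minus. fold n.
    rewrite <- (Hper _ (-1)%Z). f_equal. change (IZR (-1)) with (-(1))%R. rewrite RtoC_opp.
    field; auto. }
  assert (E2 : (Cmod (phi z - lsum a L) <= eps / 2)%R).
  { rewrite E1.
    replace (lsum (fun k => / RtoC n ^ (S (S d)) * phi ((z + RtoC (IZR k)) / RtoC n)) L - lsum a L)
      with (lsum (fun k => / RtoC n ^ (S (S d)) * phi ((z + RtoC (IZR k)) / RtoC n) + (-(1)) * a k) L).
    2:{ rewrite lsum_plus, (lsum_scal (-(1)) a). ring. }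
    eapply Rle_trans; [apply Cmod_lsum|].
    eapply Rle_trans; [apply (rsum_le _ (fun k => (K * B ^ S d * sqrt (1 + n) / n) * / sqrt (zn k) ^ 3)%R)|].
    - intros k Hk. apply IL in Hk. apply IZR_le in Hk. rewrite mult_IZR, <- INR_IZR_INZ in Hk.
      fold n in Hk.
      pose proof (shift_nz z k Hz) as Nz. pose proof (proj1 (Cmod_gt_0 _) Nz) as Pz.
      set (v := z + RtoC (IZR k)) in *. set (w := v / RtoC n).
      assert (Nw : w <> 0). { unfold w. apply Cmult_neq_0; auto. now apply Cinv_nz. }
      assert (Ew : v = RtoC n * w) by (unfold w; field; auto).
      assert (Wre : (Re w = (Re z + IZR k) / n)%R).
      { unfold w, v. unfold Cdiv. rewrite <- RtoC_inv by lra.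
        rewrite Re_mulR, Re_addR. reflexivity. }
      assert (Wim : (Im w = Im z / n)%R).
      { unfold w, v. unfold Cdiv. rewrite <- RtoC_inv by lra.
        rewrite Im_mulR, Im_addR. reflexivity. }
      assert (Hw1 : (Rabs (Re w) <= 3 / 4)%R).
      { rewrite Wre. unfold Rdiv. rewrite Rabs_mult, (Rabs_pos_eq (/ n))
          by (apply Rlt_le, Rinv_0_lt_compat; lra).
        apply Rmult_le_reg_r with n; [lra|]. rewrite Rmult_assoc, Rinv_l, Rmult_1_r by lra.
        eapply Rle_trans; [apply Rabs_triang|]. rewrite <- abs_IZR. lra. }
      assert (Hw2 : (Rabs (Im w) <= delta)%R).
      { rewrite Wim. unfold Rdiv. rewrite Rabs_mult, (Rabs_pos_eq (/ n))
          by (apply Rlt_le, Rinv_0_lt_compat; lra).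
        apply Rmult_le_reg_r with n; [lra|]. rewrite Rmult_assoc, Rinv_l, Rmult_1_r by lra.
        apply Rle_trans with (delta * (Rabs (Im z) / delta))%R. right; field; lra.
        apply Rmult_le_compat_l; lra. }
      pose proof (Hnear w Nw Hw1 Hw2) as Hq.
      replace (/ RtoC n ^ (S (S d)) * phi w + - (1) * a k) with
        (/ RtoC n ^ (S (S d)) * (phi w - / w ^ (S (S d)))).
      2:{ unfold a. fold v. rewrite Ew, Cpow_mult_l.
          assert (w ^ (S (S d)) <> 0) by now apply Cpow_nz.
          assert (RtoC n ^ (S (S d)) <> 0) by now apply Cpow_nz. field; auto. }
      rewrite Cmod_mult, Cmod_inv, Cmod_pow, Cmod_R, Rabs_pos_eq by (try apply Cpow_nz; auto; lra).
      eapply Rle_trans; [apply Rmult_le_compat_l; [|exact Hq]|].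
      { apply Rlt_le, Rinv_0_lt_compat, pow_lt; lra. }
      assert (Evw : (Cmod w = Cmod v / n)%R).
      { rewrite Ew, Cmod_mult, Cmod_R, Rabs_pos_eq by lra. field; lra. }
      rewrite Evw.
      assert (HBk : ((/ Cmod v) ^ S d <= B ^ S d * / zn k)%R).
      { pose proof (zn_ge1 k) as Z1.
        apply Rle_trans with ((B / zn k) ^ S d)%R.
        - apply pow_incr. split; [now apply Rlt_le, Rinv_0_lt_compat|apply HB].
        - unfold Rdiv. rewrite Rpow_mult_distr. apply Rmult_le_compat_l; [apply pow_le; lra|].
          rewrite pow_inv. apply Rinv_le_contravar; [lra|]. simpl.
          rewrite <- (Rmult_1_r (zn k)) at 1. apply Rmult_le_compat_l; [lra|].
          apply pow_R1_Rle; auto. }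
      (* The sums of 1 / zn k are unbounded in N. Half a power of 1 + n buys the convergent exponent
         3/2 and leaves a total error of order N^(-1/2). *)
      assert (Hzk : (/ zn k <= sqrt (1 + n) * / sqrt (zn k) ^ 3)%R).
      { pose proof (zn_ge1 k) as Z1.
        assert (Zn : (zn k <= 1 + n)%R) by (unfold zn; lra).
        assert (S1 : (0 < sqrt (zn k))%R) by (apply sqrt_lt_R0; lra).
        assert (S2 : (sqrt (zn k) * sqrt (zn k) = zn k)%R) by (apply sqrt_sqrt; lra).
        apply Rmult_le_reg_r with (sqrt (zn k) ^ 3)%R; [apply pow_lt; auto|].
        rewrite Rmult_assoc, Rinv_l, Rmult_1_r by (apply pow_nonzero; lra).
        rewrite <- S2 at 1. replace (/ (sqrt (zn k) * sqrt (zn k)) * sqrt (zn k) ^ 3)%R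
          with (sqrt (zn k)) by (field; lra).
        apply sqrt_le_1; lra. }
      replace (/ n ^ S (S d) * (K / (Cmod v / n) ^ S d))%R with (K / n * (/ Cmod v) ^ S d)%R.
      2:{ unfold Rdiv. rewrite Rpow_mult_distr, !pow_inv.
          change (n ^ S (S d))%R with (n * n ^ S d)%R.
          assert (n ^ S d <> 0)%R by (apply pow_nonzero; lra).
          assert (Cmod v ^ S d <> 0)%R by (apply pow_nonzero; lra).
          field. repeat split; auto; lra. }
      replace (K * B ^ S d * sqrt (1 + n) / n * / sqrt (zn k) ^ 3)%R with
        (K / n * (B ^ S d * (sqrt (1 + n) * / sqrt (zn k) ^ 3)))%R by (unfold Rdiv; ring).
      apply Rmult_le_compat_l. { apply Rlt_le, Rdiv_lt_0_compat; lra. }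
      eapply Rle_trans; [exact HBk|]. apply Rmult_le_compat_l; auto. apply pow_le; lra.
    - rewrite rsum_scal.
      assert (P1 : (0 <= K * B ^ S d)%R) by (apply Rmult_le_pos; [lra|apply pow_le; lra]).
      assert (Sn : (0 < sqrt n)%R) by (apply sqrt_lt_R0; lra).
      assert (Sn2 : (sqrt n * sqrt n = n)%R) by (apply sqrt_sqrt; lra).
      assert (S1n : (sqrt (1 + n) <= 2 * sqrt n)%R).
      { replace (2 * sqrt n)%R with (sqrt (4 * n)).
        - apply sqrt_le_1; lra.
        - rewrite sqrt_mult by lra. f_equal. replace 4%R with (2 * 2)%R by ring. apply sqrt_square; lra. }
      assert (S4 : (4 * (Q / eps) <= sqrt n)%R).
      { assert (0 < Q / eps)%R by (apply Rdiv_lt_0_compat; lra).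
        apply Rsqr_incr_0; try lra. unfold Rsqr. rewrite Sn2. simpl in J4. lra. }
      specialize (HM L NL).
      apply Rle_trans with (K * B ^ S d * (2 * sqrt n) / n * M)%R.
      { apply Rmult_le_compat; auto.
        - apply Rmult_le_pos; [|apply Rlt_le, Rinv_0_lt_compat; lra].
          apply Rmult_le_pos; auto. apply sqrt_pos.
        - apply rsum_ge0. intros k. apply Rlt_le, Rinv_0_lt_compat, pow_lt, sqrt_lt_R0.
          pose proof (zn_ge1 k); lra.
        - unfold Rdiv. apply Rmult_le_compat_r. apply Rlt_le, Rinv_0_lt_compat; lra.
          apply Rmult_le_compat_l; auto. }
      rewrite <- Sn2 at 2.
      replace (K * B ^ S d * (2 * sqrt n) / (sqrt n * sqrt n) * M)%R with
        (2 * (K * B ^ S d * M) * / sqrt n)%R by (field; lra).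
      apply Rmult_le_reg_r with (sqrt n); auto. rewrite Rmult_assoc, Rinv_l, Rmult_1_r by lra.
      apply Rle_trans with (eps / 2 * (4 * (Q / eps)))%R.
      + replace (eps / 2 * (4 * (Q / eps)))%R with (2 * Q)%R by (field; lra). unfold Q. lra.
      + apply Rmult_le_compat_l; lra. }
  pose proof (Cmod_sub_tri t (lsum a L) (phi z)) as T.
  rewrite (Cmod_sub_sym t (lsum a L)), (Cmod_sub_sym (lsum a L) (phi z)) in T. lra.
Qed.

Definition tsum {I : Type} (a : I -> C) : C := epsilon (inhabits (RtoC 0)) (has_sum a).
Lemma tsum_spec {I} (a : I -> C) : summable a -> has_sum a (tsum a).
Proof. intros H. apply (epsilon_spec (inhabits (RtoC 0)) (has_sum a)). now apply summable_has_sum. Qed.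
Lemma tsum_eq {I} (a : I -> C) s : has_sum a s -> tsum a = s.
Proof.
  intros H. apply (has_sum_unique a); auto.
  apply (epsilon_spec (inhabits (RtoC 0)) (has_sum a)). eauto.
Qed.

Lemma sd0_near : exists K, (0 < K)%R /\ forall w : C, w <> 0 ->
  (Rabs (Re w) <= 3 / 4)%R -> (Rabs (Im w) <= / 512)%R ->
  (Cmod w * Cmod (sd 0 w - / (w * w)) <= K)%R.
Proof.
  destruct ct_near as [K0 [P0 H0]]. pose proof PI_RGT_0 as HP.
  exists (2 * K0 + 1 * (K0 * K0 + PI * PI))%R. split. nra.
  intros w Hw Hr Hi. specialize (H0 w Hw Hr Hi).
  set (r := ct w - / w) in *.
  assert (E : w * (sd 0 w - / (w * w)) = 2 * r + w * (r * r - pii * pii)).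
  { rewrite sd0. replace (ct w) with (/ w + r) by (unfold r; ring). field; auto. }
  rewrite <- Cmod_mult, E.
  pose proof (Cmod_le_parts w) as Hw1.
  pose proof (Cmod_ge_0 w). pose proof (Cmod_ge_0 r).
  eapply Rle_trans; [apply Cmod_triangle|]. apply Rplus_le_compat.
  - rewrite Cmod_mult, Cmod_R, Rabs_pos_eq; lra.
  - rewrite Cmod_mult. apply Rmult_le_compat; auto; [apply Cmod_ge_0|lra|].
    eapply Rle_trans; [apply Cmod_triangle|]. rewrite Cmod_opp, !Cmod_mult, Cmod_pii.
    apply Rplus_le_compat_r. nra.
Qed.
Lemma pf2 z : ~ isint z -> has_sum (fun m => / (z + RtoC (IZR m)) ^ 2) (sd 0 z).
Proof.
  destruct sd0_near as [K [P H]].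
  apply (partial_fractions (sd 0) 0 K (/ 512)); auto; try lra.
  - apply sd0_double. - intros; apply sd_shift.
  - intros w Hw Hr Hi. specialize (H w Hw Hr Hi).
    pose proof (proj1 (Cmod_gt_0 _) Hw) as Pw.
    simpl. rewrite !Rmult_1_r, Cmult_1_r. apply Rmult_le_reg_l with (Cmod w); auto.
    replace (Cmod w * (K / Cmod w))%R with K by (field; lra). exact H.
Qed.
(** The estimate near 0 is that of [sd 0] carried through the polynomial [sd 2]: multiplied by w^3,
    the error is a polynomial in w and v = w u, both of which are bounded. *)
Lemma pf4 z : ~ isint z -> has_sum (fun m => / (z + RtoC (IZR m)) ^ 4) (s4 z).
Proof.
  destruct sd0_near as [K [P H]]. pose proof PI_RGT_0 as HP.
  set (K' := (2 * K + K * K * 2 + PI ^ 2 * (2 + 4 * K))%R).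
  assert (PP : (0 < PI ^ 2)%R) by (apply pow_lt; auto).
  assert (PK' : (0 < K')%R) by (unfold K'; nra).
  apply (partial_fractions s4 2 K' (/ 512)); auto; try lra.
  - apply s4_double.
  - intros; unfold s4; now rewrite sd_shift.
  - intros w Hw Hr Hi. specialize (H w Hw Hr Hi).
    pose proof (proj1 (Cmod_gt_0 _) Hw) as Pw.
    pose proof (Cmod_le_parts w) as Hw1. assert (Hw2 : (Cmod w <= 2)%R) by lra.
    set (u := sd 0 w - / (w * w)) in *.
    assert (E : w ^ 3 * (s4 w - / w ^ 4) =
      2 * (w * u) + w * (w * u) * (w * u) + (2 / 3) * (pii * pii) * (w + w * w * (w * u))).
    { unfold s4. rewrite sd2. replace (sd 0 w) with (/ (w * w) + u) by (unfold u; ring).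
      field. auto. }
    apply Rmult_le_reg_l with (Cmod w ^ 3)%R; [now apply pow_lt|].
    replace (Cmod w ^ 3 * (K' / Cmod w ^ 3))%R with K' by (field; lra).
    rewrite <- Cmod_pow, <- Cmod_mult, E.
    rewrite <- Cmod_mult in H. set (v := w * u) in *.
    pose proof (Cmod_ge_0 v). pose proof (Cmod_ge_0 w).
    eapply Rle_trans; [apply Cmod_triangle|]. apply Rplus_le_compat.
    + eapply Rle_trans; [apply Cmod_triangle|]. apply Rplus_le_compat.
      * rewrite Cmod_mult, Cmod_R, Rabs_pos_eq; lra.
      * rewrite !Cmod_mult. replace (K * K * 2)%R with (2 * K * K)%R by ring.
        repeat apply Rmult_le_compat; auto. nra.
    + rewrite !Cmod_mult, Cmod_pii.
      replace (PI ^ 2 * (2 + 4 * K))%R with (1 * (PI * PI) * (2 + 4 * K))%R by ring.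
      apply Rmult_le_compat; try apply Cmod_ge_0.
      { apply Rmult_le_pos; [apply Cmod_ge_0|nra]. }
      * apply Rmult_le_compat_r; [nra|]. rewrite <- RtoC_div, Cmod_R, Rabs_pos_eq; lra.
      * eapply Rle_trans; [apply Cmod_triangle|]. apply Rplus_le_compat; auto.
        rewrite !Cmod_mult. apply Rmult_le_compat; auto; nra.
Qed.

(** * Sums of inverse powers over the nonzero integers *)

Lemma not_isint_half : ~ isint (/ 2).
Proof.
  intros [k E]. rewrite <- RtoC_inv in E by lra. apply RtoC_inj in E.
  assert (IZR (2 * k) = 1%R) by (rewrite mult_IZR; lra).
  apply eq_IZR in H. lia.
Qed.
Lemma ct_half : ct (/ 2) = 0.
Proof.
  pose proof C2_nz.
  assert (E : ct (/ 2) = - ct (/ 2)).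
  { rewrite <- ct_opp. replace (/ 2) with (- / 2 + RtoC (IZR 1)) at 1 by (field; auto).
    apply ct_shift. }
  assert (E2 : 2 * ct (/ 2) = 0).
  { replace (2 * ct (/ 2)) with (ct (/ 2) - - ct (/ 2)) by ring. rewrite <- E; ring. }
  replace (ct (/ 2)) with (/ 2 * (2 * ct (/ 2))) by (field; auto). rewrite E2; ring.
Qed.
Lemma IZR_nz k : k <> 0%Z -> RtoC (IZR k) <> 0.
Proof. intros H. apply RtoC_nz. intros E. apply eq_IZR in E. auto. Qed.
Lemma inv_int_bound m : m <> 0%Z -> (/ Cmod (RtoC (IZR m)) <= 2 / zn m)%R.
Proof.
  intros H. rewrite Cmod_R, <- abs_IZR. unfold zn.
  assert (1 <= IZR (Z.abs m))%R by (apply IZR_le; lia).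
  replace (2 / (1 + IZR (Z.abs m)))%R with (/ ((1 + IZR (Z.abs m)) / 2))%R by (field; lra).
  apply Rinv_le_contravar; lra.
Qed.
Lemma summable_zeta e : (2 <= e)%nat -> summable (restr (fun m => m <> 0%Z) (fun m => / RtoC (IZR m) ^ e)).
Proof.
  intros He. apply (summable_pow_bound _ (2 ^ e) e); auto. intros m.
  destruct (Z.eq_dec m 0) as [->|N].
  - rewrite restr_out by tauto. rewrite Cmod_0. apply Rmult_le_pos. apply pow_le; lra.
    apply Rlt_le, Rinv_0_lt_compat, pow_lt. pose proof (zn_ge1 0); lra.
  - rewrite restr_in by auto. rewrite Cmod_inv, Cmod_pow by (apply Cpow_nz, IZR_nz; auto).
    rewrite <- pow_inv. unfold Rdiv. rewrite <- pow_inv, <- Rpow_mult_distr.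
    apply pow_incr. split; [|now apply inv_int_bound].
    apply Rlt_le, Rinv_0_lt_compat, Cmod_gt_0, IZR_nz; auto.
Qed.
(** The even integers contribute 2^(-e) s; the odd ones, written 2 (1/2 + m), contribute 2^(-e) t.
    The value t comes from the partial fractions at 1/2, where the cotangent vanishes. *)
Lemma zeta_from_half e t : (2 <= e)%nat ->
  has_sum (fun m => / (/ 2 + RtoC (IZR m)) ^ e) t ->
  exists s, has_sum (restr (fun m => m <> 0%Z) (fun m => / RtoC (IZR m) ^ e)) s /\
    2 ^ e * s = s + t.
Proof.
  intros He Ht. destruct (summable_has_sum _ (summable_zeta e He)) as [s Hs].
  exists s; split; auto. set (a := restr _ _) in *.
  pose proof C2_nz as N2. assert (N2e : 2 ^ e <> 0) by now apply Cpow_nz.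
  assert (He1 : has_sum (restr (fun m => Z.even m = true) a) (/ 2 ^ e * s)).
  { apply (has_sum_reindex (fun m => (2 * m)%Z) (fun _ => True) (fun m => / 2 ^ e * a m)).
    - intros; lia. - tauto.
    - intros i Hi. apply restr_out. intros Ev. apply Z.even_spec in Ev. destruct Ev as [j Hj].
      apply (Hi j); auto.
    - intros j _. rewrite restr_in by (rewrite Z.even_mul; auto).
      unfold a. destruct (Z.eq_dec j 0) as [->|Nj].
      rewrite !restr_out by lia. ring.
      rewrite !restr_in by lia. rewrite mult_IZR, RtoC_mult, Cpow_mult_l.
      assert (RtoC (IZR j) ^ e <> 0) by (apply Cpow_nz, IZR_nz; auto). field; auto.
    - now apply has_sum_scal. }
  assert (Ho : has_sum (restr (fun m => Z.even m = false) a) (/ 2 ^ e * t)).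
  { apply (has_sum_reindex (fun m => (2 * m + 1)%Z) (fun _ => True)
      (fun m => / 2 ^ e * / (/ 2 + RtoC (IZR m)) ^ e)).
    - intros; lia. - tauto.
    - intros i Hi. apply restr_out. rewrite <- Z.negb_odd. intros Ev.
      apply Bool.negb_false_iff, Z.odd_spec in Ev. destruct Ev as [j Hj].
      apply (Hi j); auto.
    - intros j _. rewrite restr_in.
      2:{ rewrite Z.add_comm, Z.even_add_mul_2. reflexivity. }
      unfold a. rewrite restr_in by lia.
      replace (RtoC (IZR (2 * j + 1))) with (2 * (/ 2 + RtoC (IZR j))).
      2:{ rewrite plus_IZR, mult_IZR, RtoC_plus, RtoC_mult. field; auto. }
      assert (/ 2 + RtoC (IZR j) <> 0) by apply (shift_nz _ _ not_isint_half).
      rewrite Cpow_mult_l.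
      assert ((/ 2 + RtoC (IZR j)) ^ e <> 0) by now apply Cpow_nz. field; auto.
    - now apply has_sum_scal. }
  assert (E : s = / 2 ^ e * s + / 2 ^ e * t).
  { apply (has_sum_unique a); auto.
    eapply has_sum_ext; [|exact (has_sum_plus _ _ _ _ He1 Ho)]. intros m. cbv beta.
    destruct (Z.even m) eqn:Em.
    rewrite restr_in, restr_out by (auto; congruence). ring.
    rewrite restr_out, restr_in by (auto; congruence). ring. }
  rewrite E at 1. field; auto.
Qed.
Lemma zeta2 : has_sum (restr (fun m => m <> 0%Z) (fun m => / RtoC (IZR m) ^ 2)) (- (pii * pii) / 3).
Proof.
  destruct (zeta_from_half 2 _ (le_n 2) (pf2 _ not_isint_half)) as [s [Hs E]].
  rewrite sd0, ct_half in E. replace (- (pii * pii) / 3) with s; auto.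
  replace s with ((2 ^ 2 * s - s) / 3) by field. rewrite E. field.
Qed.
Lemma zeta4 : has_sum (restr (fun m => m <> 0%Z) (fun m => / RtoC (IZR m) ^ 4))
   ((pii * pii) * (pii * pii) / 45).
Proof.
  destruct (zeta_from_half 4 (s4 (/ 2)) ltac:(lia) (pf4 _ not_isint_half)) as [s [Hs E]].
  unfold s4 in E. rewrite sd2, sd0, ct_half in E.
  replace (pii * pii * (pii * pii) / 45) with s; auto.
  replace s with ((2 ^ 4 * s - s) / 15) by field. rewrite E. field.
Qed.

(** * The cotangent series *)

Lemma Cinv_0 : / 0 = 0.
Proof. unfold Cinv, RtoC; simpl. f_equal; unfold Rdiv; rewrite ?Ropp_0; ring. Qed.
Lemma cot_term_summable z : ~ isint z ->
  summable (fun m => / (z + RtoC (IZR m)) - / RtoC (IZR m)).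
Proof.
  intros Hz. destruct (inv_shift_bound_pos z) as [B [PB HB]].
  destruct (eventually_bound (fun m => Cmod (/ (z + RtoC (IZR m)) - / RtoC (IZR m)))
    (2 * Cmod z * B) 2 0) as [B' HB'].
  { intros m Hm. assert (Nm : m <> 0%Z) by lia. apply IZR_nz in Nm as Nm'.
    pose proof (shift_nz z m Hz) as Nz.
    replace (/ (z + RtoC (IZR m)) - / RtoC (IZR m)) with
      (- (z * (/ RtoC (IZR m) * / (z + RtoC (IZR m))))) by (field; auto).
    rewrite Cmod_opp, !Cmod_mult, !Cmod_inv by auto.
    pose proof (inv_int_bound m Nm) as I1. specialize (HB m).
    pose proof (zn_ge1 m).
    replace (2 * Cmod z * B / zn m ^ 2)%R with (Cmod z * (2 / zn m * (B / zn m)))%R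
      by (field; lra).
    apply Rmult_le_compat_l; [apply Cmod_ge_0|].
    apply Rmult_le_compat; auto; apply Rlt_le, Rinv_0_lt_compat; now apply Cmod_gt_0. }
  now apply (summable_pow_bound _ B' 2).
Qed.
(* For [m = 0] the subtracted term is [/ 0 = 0]. *)
Definition csum (z : C) : C := tsum (fun m => / (z + RtoC (IZR m)) - / RtoC (IZR m)).
Lemma csum_spec z : ~ isint z ->
  has_sum (fun m => / (z + RtoC (IZR m)) - / RtoC (IZR m)) (csum z).
Proof. intros H. now apply tsum_spec, cot_term_summable. Qed.
Lemma csum_opp z : ~ isint z -> csum (- z) = - csum z.
Proof.
  intros H. apply tsum_eq. apply (has_sum_bij Z.opp Z.opp); try (intros; lia).
  replace (- csum z) with (-(1) * csum z) by ring.
  eapply has_sum_ext; [|exact (has_sum_scal (-(1)) _ _ (csum_spec z H))].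
  intros m. cbv beta. rewrite opp_IZR, RtoC_opp. pose proof (shift_nz z m H) as Nz.
  destruct (Z.eq_dec m 0) as [->|N].
  - change (RtoC (IZR 0)) with (RtoC 0). replace (- RtoC 0) with (RtoC 0) by ring.
    rewrite Cinv_0. replace (z + RtoC (IZR 0)) with z in Nz by (simpl; ring).
    replace (-z + 0) with (- z) by ring. replace (z + 0) with z by ring. field.
    exact Nz.
  - apply IZR_nz in N.
    assert (- z + - RtoC (IZR m) <> 0).
    { intros E. apply Nz. replace (z + RtoC (IZR m)) with (- (- z + - RtoC (IZR m))) by ring.
      rewrite E; ring. }
    field. auto.
Qed.
(** Over [zrange n] the difference telescopes to two boundary terms that tend to 0. *)
Lemma csum_shift z : ~ isint z -> csum (z + 1) = csum z.
Proof.
  intros H.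
  assert (H1 : ~ isint (z + 1)) by (change (RtoC 1) with (RtoC (IZR 1)); now rewrite isint_shift).
  pose proof (has_sum_minus _ _ _ _ (csum_spec _ H1) (csum_spec _ H)) as HS.
  apply Csub_0. rewrite <- (has_sum_sym_lim _ _ HS).
  destruct (inv_shift_bound_pos z) as [B [PB HB]].
  apply Clim_seq_unique. intros e He.
  set (g := fun m => / (z + RtoC (IZR m))).
  assert (T : forall n, lsum (fun i : Z => / (z + 1 + RtoC (IZR i)) - / RtoC (IZR i) -
     (/ (z + RtoC (IZR i)) - / RtoC (IZR i))) (zrange n) = g (Z.of_nat n + 1)%Z - g (- Z.of_nat n)%Z).
  { intros n. unfold zrange. rewrite lsum_map.
    rewrite (lsum_ext _ (fun j => g (Z.of_nat (S j) - Z.of_nat n)%Z - g (Z.of_nat j - Z.of_nat n)%Z)).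
    - replace (Z.of_nat n + 1)%Z with (Z.of_nat (2 * n + 1) - Z.of_nat n)%Z by lia.
      replace (- Z.of_nat n)%Z with (Z.of_nat 0 - Z.of_nat n)%Z by lia.
      generalize (2 * n + 1)%nat. induction n0.
      + simpl. ring.
      + rewrite seq_S, lsum_app, IHn0. cbn [lsum fold_right Nat.add]. ring.
    - intros j _. unfold g. replace (Z.of_nat (S j) - Z.of_nat n)%Z with
        (Z.of_nat j - Z.of_nat n + 1)%Z by lia. rewrite (plus_IZR _ 1), RtoC_plus.
      replace (z + (RtoC (IZR (Z.of_nat j - Z.of_nat n)) + RtoC (IZR 1))) with
       (z + 1 + RtoC (IZR (Z.of_nat j - Z.of_nat n))) by ring. ring. }
  destruct (archimed (2 * B / e)) as [Ha _]. set (N := Z.to_nat (up (2 * B / e))).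
  assert (0 < 2 * B / e)%R by (apply Rdiv_lt_0_compat; lra).
  assert (HN : (2 * B / e < INR N)%R).
  { unfold N. rewrite INR_IZR_INZ, Z2Nat.id; auto. apply le_IZR; lra. }
  exists N. intros n Hn. rewrite sum_sym_lsum, T.
  apply le_INR in Hn.
  assert (Bd : forall k, (INR n <= IZR (Z.abs k))%R -> (Cmod (g k) < e / 2)%R).
  { intros k Hk. unfold g. rewrite Cmod_inv by now apply shift_nz.
    eapply Rle_lt_trans; [apply HB|]. unfold zn.
    apply Rmult_lt_reg_r with (1 + IZR (Z.abs k))%R; [lra|].
    unfold Rdiv at 1. rewrite Rmult_assoc, Rinv_l, Rmult_1_r by lra.
    apply Rlt_le_trans with (e / 2 * (2 * B / e + 1))%R.
    - replace (e / 2 * (2 * B / e + 1))%R with (B + e / 2)%R by (field; lra). lra.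
    - apply Rmult_le_compat_l; lra. }
  pose proof (Bd (Z.of_nat n + 1)%Z) as B1. pose proof (Bd (- Z.of_nat n)%Z) as B2.
  rewrite INR_IZR_INZ in B1, B2.
  specialize (B1 ltac:(apply IZR_le; lia)). specialize (B2 ltac:(apply IZR_le; lia)).
  replace (g (Z.of_nat n + 1)%Z - g (- Z.of_nat n)%Z - 0) with
    (g (Z.of_nat n + 1)%Z + - g (- Z.of_nat n)%Z) by ring.
  eapply Rle_lt_trans; [apply Cmod_triangle|]. rewrite Cmod_opp. lra.
Qed.
Lemma cder_csum z : ~ isint z -> cder csum z (- sd 0 z).
Proof.
  intros H. destruct (inv_shift_bound_pos z) as [B [PB HB]].
  (* A bound B on all 1 / |z + m| is also a distance 1 / B from z to the integers; half of it is the
     radius used below. *)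
  assert (Lo : forall m, (/ B <= Cmod (z + RtoC (IZR m)))%R).
  { intros m. pose proof (proj1 (Cmod_gt_0 _) (shift_nz z m H)) as P.
    rewrite <- (Rinv_inv (Cmod (z + _))). apply Rinv_le_contravar.
    now apply Rinv_0_lt_compat.
    eapply Rle_trans; [apply HB|]. pose proof (zn_ge1 m).
    unfold Rdiv. rewrite <- (Rmult_1_r B) at 2. apply Rmult_le_compat_l; [lra|].
    rewrite <- Rinv_1. apply Rinv_le_contravar; lra. }
  assert (PB' : (0 < / B)%R) by now apply Rinv_0_lt_compat.
  assert (Lo2 : forall m h, (Cmod h < / B / 2)%R ->
    (Cmod (z + RtoC (IZR m)) / 2 <= Cmod (z + h + RtoC (IZR m)))%R).
  { intros m h Hh. specialize (Lo m). pose proof (Cmod_tri_rev (z + RtoC (IZR m)) h) as T.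
    replace (z + RtoC (IZR m) + h) with (z + h + RtoC (IZR m)) in T by ring. lra. }
  assert (Nh : forall h m, (Cmod h < / B / 2)%R -> z + h + RtoC (IZR m) <> 0).
  { intros h m Hh. apply Cmod_gt_0. specialize (Lo2 m h Hh). specialize (Lo m). lra. }
  apply (has_sum_cder (fun m w => / (w + RtoC (IZR m)) - / RtoC (IZR m))
    (fun m => - / (z + RtoC (IZR m)) ^ 2) csum _ z (/ B / 2) (fun m => 2 * B ^ 3 * / zn m ^ 3)%R nil).
  - lra.
  - constructor.
  - intros h Hh. apply csum_spec. intros [k E]. apply (Nh h (- k)%Z Hh).
    rewrite E, opp_IZR, RtoC_opp. ring.
  - replace (- sd 0 z) with (-(1) * sd 0 z) by ring.
    eapply has_sum_ext; [|exact (has_sum_scal (-(1)) _ _ (pf2 z H))]. intros; cbv beta; ring.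
  - apply bdd_sums_scal. pose proof (pow_lt B 3 PB); lra. apply bdd_sums_pow; lia.
  - intros m. pose proof (pow_lt B 3 PB). apply Rmult_le_pos; [lra|].
    apply Rlt_le, Rinv_0_lt_compat, pow_lt. pose proof (zn_ge1 m); lra.
  - intros m [].
  - intros m h _ Hh. specialize (Nh h m Hh). pose proof (shift_nz z m H) as Nz.
    specialize (Lo2 m h Hh). pose proof (proj1 (Cmod_gt_0 _) Nz) as Pz.
    generalize (/ RtoC (IZR m)). intros q.
    replace (/ (z + h + RtoC (IZR m)) - q - (/ (z + RtoC (IZR m)) - q)
      - - / (z + RtoC (IZR m)) ^ 2 * h) with
      (h ^ 2 * (/ (z + RtoC (IZR m)) ^ 2 * / (z + h + RtoC (IZR m)))) by (field; auto).
    rewrite !Cmod_mult, Cmod_pow, !Cmod_inv, Cmod_pow by (auto; now apply Cpow_nz).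
    rewrite (Rmult_comm (2 * B ^ 3 * _)). apply Rmult_le_compat_l; [apply pow2_ge_0|].
    set (u := Cmod (z + RtoC (IZR m))) in *.
    assert (I2 : (/ Cmod (z + h + RtoC (IZR m)) <= 2 * / u)%R).
    { replace (2 * / u)%R with (/ (u / 2))%R by (field; lra). apply Rinv_le_contravar; lra. }
    assert (Pu : (0 < / u)%R) by now apply Rinv_0_lt_compat.
    apply Rle_trans with (2 * (/ u) ^ 3)%R.
    + replace (2 * (/ u) ^ 3)%R with (/ u ^ 2 * (2 * / u))%R by (field; lra).
      apply Rmult_le_compat_l; auto. apply Rlt_le, Rinv_0_lt_compat, pow_lt; auto.
    + rewrite Rmult_assoc. apply Rmult_le_compat_l; [lra|].
      rewrite <- pow_inv, <- Rpow_mult_distr. apply pow_incr. split; [lra|apply HB].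
Qed.
(* [csum - ct] has derivative zero and vanishes at 1/2, by oddness and periodicity; the
   segments used avoid the integers. *)
Lemma ct_csum z : ~ isint z -> csum z = ct z.
Proof.
  intros Hz. set (D := fun w => csum w - ct w).
  assert (D' : forall w, ~ isint w -> cder D w 0).
  { intros w Hw. eapply cder_eq; [|apply cder_minus; [now apply cder_csum|now apply cder_ct]].
    ring. }
  assert (seg : forall a b, (forall t : R, (0 <= t <= 1)%R -> ~ isint (a + RtoC t * (b - a))) ->
    D b = D a).
  { intros a b Hab. apply Csub_0, Cmod_eq_0. apply Rle_antisym; [|apply Cmod_ge_0].
    pose proof (cder_mvt D (fun _ => 0) a (b - a) 0) as M.
    replace (a + (b - a)) with b in M by ring.
    eapply Rle_trans; [apply M|]. 2: right; ring.
    intros t Ht. split; [|rewrite Cmod_0; lra]. apply D', Hab; auto. }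
  pose proof C2_nz as N2.
  assert (D0 : D (/ 2) = 0).
  { unfold D. rewrite ct_half.
    assert (E : csum (/ 2) = - csum (/ 2)).
    { rewrite <- csum_opp by apply not_isint_half.
      rewrite <- (csum_shift (- / 2)) by (rewrite isint_opp; apply not_isint_half).
      f_equal. field; auto. }
    assert (E2 : 2 * csum (/ 2) = 0).
    { replace (2 * csum (/ 2)) with (csum (/ 2) - - csum (/ 2)) by ring. rewrite <- E; ring. }
    replace (csum (/ 2)) with (/ 2 * (2 * csum (/ 2))) by (field; auto). rewrite E2; ring. }
  (* A segment from 1/2 to a nonreal point meets the real axis only at 1/2. A real z is then joined
     vertically to z + i. *)
  assert (nonreal : forall w, Im w <> 0%R -> D w = 0).
  { intros w Hw. rewrite <- D0. apply seg. intros t Ht [k E].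
    assert (t = 0%R).
    { apply (f_equal Im) in E. rewrite <- RtoC_inv in E by lra.
      destruct w as [x y]; simpl in *.
      assert (t * y = 0)%R by lra. apply Rmult_integral in H. tauto. }
    subst t. apply not_isint_half. exists k. rewrite <- E. ring. }
  apply Csub_0. change (D z = 0).
  destruct (Req_dec (Im z) 0) as [Hi|Hi]; auto.
  rewrite <- (nonreal (z + Ci)).
  - symmetry. apply seg. intros t Ht [k E].
    assert (t = 0%R).
    { apply (f_equal Im) in E. destruct z as [x y]; simpl in *. lra. }
    subst t. apply Hz. exists k. rewrite <- E. ring.
  - destruct z as [x y]; simpl in *. lra.
Qed.
Lemma lsum_odd_zrange (a : Z -> C) N : (forall m, a (- m)%Z = - a m) -> lsum a (zrange N) = 0.
Proof.
  intros H. pose proof C2_nz as N2.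
  assert (E : lsum a (zrange N) = -(1) * lsum a (zrange N)).
  { rewrite <- lsum_scal. rewrite (lsum_perm a (zrange N) (map Z.opp (zrange N))).
    - rewrite lsum_map. apply lsum_ext. intros i _. rewrite H. ring.
    - apply NoDup_Permutation. apply zrange_NoDup.
      apply FinFun.Injective_map_NoDup; [intros u v E; lia|apply zrange_NoDup].
      intros i. rewrite in_map_iff, zrange_In. split.
      + intros Hi. exists (- i)%Z. rewrite zrange_In. lia.
      + intros [j [<- Hj]]. rewrite zrange_In in Hj. lia. }
  set (x := lsum a (zrange N)) in *.
  assert (E2 : 2 * x = 0) by (replace (2 * x) with (x - -(1) * x) by ring; rewrite <- E; ring).
  replace x with (/ 2 * (2 * x)) by (field; auto). rewrite E2; ring.
Qed.
(** In symmetric partial sums the odd terms 1 / m cancel, which removes the convergence correction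
    built into [csum]. *)
Lemma cot_expansion z : ~ isint z ->
  Clim_seq (fun M => sum_sym M (fun m => 1 / (z + RtoC (IZR m)))) = ct z.
Proof.
  intros Hz. rewrite <- ct_csum by auto.
  rewrite <- (has_sum_sym_lim _ _ (csum_spec z Hz)).
  f_equal. apply FunctionalExtensionality.functional_extensionality. intros N.
  rewrite !sum_sym_lsum.
  assert (O : lsum (fun m => / RtoC (IZR m)) (zrange N) = 0).
  { apply lsum_odd_zrange. intros m. rewrite opp_IZR, RtoC_opp.
    destruct (Z.eq_dec m 0) as [->|Nm].
    - replace (- RtoC (IZR 0)) with (RtoC 0) by (simpl; ring).
      change (RtoC (IZR 0)) with (RtoC 0). rewrite Cinv_0. ring.
    - apply IZR_nz in Nm. field; auto. }
  rewrite (lsum_ext (fun m => / (z + RtoC (IZR m)) - / RtoC (IZR m))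
    (fun m => 1 / (z + RtoC (IZR m)) + (-(1)) * / RtoC (IZR m))).
  - rewrite lsum_plus, lsum_scal, O. ring.
  - intros m _. unfold Cdiv. ring.
Qed.

(** * Sums over the points z + n tau *)

Definition pt (tau z : C) (n : Z) : C := z + RtoC (IZR n) * tau.
Definition sg (n : Z) : C := RtoC (IZR (Z.sgn n)).

Lemma Im_pt tau z n : Im (pt tau z n) = (Im z + IZR n * Im tau)%R.
Proof. unfold pt. destruct tau, z; simpl; ring. Qed.

Lemma zn_pos n : (0 < zn n)%R.
Proof. pose proof (zn_ge1 n); lra. Qed.
Lemma zn_add m k : (zn k <= zn (m + k) * zn m)%R.
Proof.
  unfold zn. assert (IZR (Z.abs k) <= IZR (Z.abs (m + k)) + IZR (Z.abs m))%R
    by (rewrite <- plus_IZR; apply IZR_le; lia).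
  assert (0 <= IZR (Z.abs (m + k)))%R by (apply IZR_le; lia).
  assert (0 <= IZR (Z.abs m))%R by (apply IZR_le; lia). nra.
Qed.

(** Uniform near (tau0, z0), as differentiation requires. There Im tau >= y / 2 and |Im z| <= Y - 1,
    so once |n| y > 4 Y the term n Im tau decides the size and the sign of the imaginary part. *)
Lemma far_points tau0 z0 : (0 < Im tau0)%R -> exists (N : nat) (c : R), (0 < c)%R /\
  forall n tau z, (Z.of_nat N < Z.abs n)%Z ->
  (Cmod (tau - tau0) <= Im tau0 / 2)%R -> (Cmod (z - z0) <= 1)%R ->
  (c * zn n <= Rabs (Im (pt tau z n)))%R /\
  ((1 <= Im (pt tau z n))%R /\ (0 < n)%Z \/ (Im (pt tau z n) <= -1)%R /\ (n < 0)%Z).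
Proof.
  intros Hy. set (y := Im tau0) in *. set (Y := (Rabs (Im z0) + 2)%R).
  assert (HY : (2 <= Y)%R) by (unfold Y; pose proof (Rabs_pos (Im z0)); lra).
  exists (Z.to_nat (up (4 * Y / y))), (y / 8)%R. split; [lra|].
  intros n tau z Hn Ht Hz.
  assert (P : (0 < 4 * Y / y)%R) by (apply Rdiv_lt_0_compat; lra).
  destruct (archimed (4 * Y / y)) as [Ha _].
  rewrite Z2Nat.id in Hn by (apply le_IZR; lra). apply IZR_lt in Hn.
  assert (Hn' : (4 * Y < IZR (Z.abs n) * y)%R).
  { apply Rmult_lt_reg_r with (/ y)%R; [now apply Rinv_0_lt_compat|].
    replace (IZR (Z.abs n) * y * / y)%R with (IZR (Z.abs n)) by (field; lra). unfold Rdiv in *. lra. }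
  assert (T1 : (y / 2 <= Im tau)%R).
  { pose proof (Im_le (tau - tau0)) as T. apply (Rle_trans _ _ _) with (2 := Ht) in T.
    apply Rabs_le_between in T. destruct tau as [a b], tau0 as [a0 b0]; simpl in *.
    unfold y in *. lra. }
  assert (T2 : (Rabs (Im z) <= Y - 1)%R).
  { pose proof (Im_le (z - z0)) as T. apply (Rle_trans _ _ _) with (2 := Hz) in T.
    unfold Y. replace (Im z) with (Im (z - z0) + Im z0)%R
      by (destruct z, z0; simpl; ring).
    pose proof (Rabs_triang (Im (z - z0)) (Im z0)). lra. }
  apply Rabs_le_between in T2. rewrite Im_pt. unfold zn.
  set (t := Im tau) in *. clearbody t.
  destruct (Z_lt_le_dec n 0) as [L|L].
  - assert (E : IZR (Z.abs n) = (- IZR n)%R) by (rewrite <- opp_IZR; f_equal; lia).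
    rewrite E in *. assert (IZR n <= -1)%R by (apply IZR_le; lia).
    assert (IZR n * t <= IZR n * (y / 2))%R by nra.
    rewrite Rabs_left by nra. split; [nra|]. right. split; [nra|auto].
  - assert (n <> 0)%Z. { intros ->. simpl in Hn'. lra. }
    assert (E : IZR (Z.abs n) = IZR n) by (f_equal; lia).
    rewrite E in *. assert (1 <= IZR n)%R by (apply IZR_le; lia).
    assert (IZR n * (y / 2) <= IZR n * t)%R by nra.
    rewrite Rabs_pos_eq by nra. split; [nra|]. left. split; [nra|lia].
Qed.

Lemma isint_Im w : isint w -> Im w = 0%R.
Proof. intros [k ->]. reflexivity. Qed.

(** The cotangent tends to -pii upwards and to pii downwards in the imaginary direction;
    [pii * sg n] cancels these limits. *)
Lemma far_terms tau0 z0 : (0 < Im tau0)%R -> exists (N : nat) (B : R), (0 < B)%R /\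
  forall n tau z, (Z.of_nat N < Z.abs n)%Z ->
  (Cmod (tau - tau0) <= Im tau0 / 2)%R -> (Cmod (z - z0) <= 1)%R ->
  ~ isint (pt tau z n) /\
  (Cmod (ct (pt tau z n) + pii * sg n) <= B / zn n ^ 8)%R /\
  forall j, (j <= 4)%nat -> (Cmod (sd j (pt tau z n)) <= B / zn n ^ 8)%R.
Proof.
  intros Hy. destruct (far_points tau0 z0 Hy) as [N [c [Pc H]]].
  destruct far_bounds as [K [PK [Hu [Hd Hs]]]].
  exists N, (K / c ^ 8)%R. split. { apply Rdiv_lt_0_compat; auto. now apply pow_lt. }
  intros n tau z Hn Ht Hz. destruct (H n tau z Hn Ht Hz) as [H1 H2]. clear H.
  set (w := pt tau z n) in *. pose proof (zn_pos n) as Pz.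
  assert (L : (K / Rabs (Im w) ^ 8 <= K / c ^ 8 / zn n ^ 8)%R).
  { replace (K / c ^ 8 / zn n ^ 8)%R with (K * / (c * zn n) ^ 8)%R by (field; lra).
    unfold Rdiv. apply Rmult_le_compat_l; [lra|]. apply Rinv_le_contravar.
    apply pow_lt, Rmult_lt_0_compat; auto. apply pow_incr; split; auto.
    apply Rlt_le, Rmult_lt_0_compat; auto. }
  repeat split.
  - intros I. apply isint_Im in I. rewrite I in H2. lra.
  - eapply Rle_trans; [|exact L]. unfold sg. destruct H2 as [[Hi Hn']|[Hi Hn']].
    + rewrite Z.sgn_pos by auto. rewrite Cmult_1_r. auto.
    + rewrite Z.sgn_neg by auto.
      replace (ct w + pii * RtoC (IZR (-1))) with (ct w - pii). auto.
      change (IZR (-1)) with (-(1))%R. rewrite RtoC_opp. ring.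
  - intros j Hj. eapply Rle_trans; [|exact L]. apply Hs; auto.
    destruct H2 as [[Hi _]|[Hi _]]; [rewrite Rabs_pos_eq|rewrite Rabs_left]; lra.
Qed.

(** The finitely many small n are absorbed in the constant, whatever the values there, even at a
    pole, where [ct] is 0 by convention. *)
Lemma point_terms tau z : (0 < Im tau)%R -> exists B : R, (0 < B)%R /\ forall n,
  (Cmod (ct (pt tau z n) + pii * sg n) <= B / zn n ^ 8)%R /\
  forall j, (j <= 4)%nat -> (Cmod (sd j (pt tau z n)) <= B / zn n ^ 8)%R.
Proof.
  intros Hy. destruct (far_terms tau z Hy) as [N [B [PB H]]].
  assert (H' : forall n, (Z.of_nat N < Z.abs n)%Z ->
   (Cmod (ct (pt tau z n) + pii * sg n) <= B / zn n ^ 8)%R /\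
    forall j, (j <= 4)%nat -> (Cmod (sd j (pt tau z n)) <= B / zn n ^ 8)%R).
  { intros n Hn. apply H; auto.
    replace (tau - tau) with (RtoC 0) by ring. rewrite Cmod_0; lra.
    replace (z - z) with (RtoC 0) by ring. rewrite Cmod_0; lra. }
  destruct (eventually_bound _ B 8 N (fun n Hn => proj1 (H' n Hn))) as [B0 H0].
  assert (G : forall J, (J <= 5)%nat -> exists B1, (0 < B1)%R /\ forall n j, (j < J)%nat ->
     (Cmod (sd j (pt tau z n)) <= B1 / zn n ^ 8)%R).
  { induction J; intros HJ. exists 1%R; split; [lra|intros; lia].
    destruct IHJ as [B1 [P1 H1]]; [lia|].
    destruct (eventually_bound (fun n => Cmod (sd J (pt tau z n))) B 8 N) as [B2 H2].
    { intros n Hn. apply H'; auto. lia. }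
    exists (B1 + Rabs B2)%R. pose proof (Rabs_pos B2). pose proof (Rle_abs B2). split; [lra|].
    intros n j Hj. pose proof (pow_lt (zn n) 8 (zn_pos n)) as Pz.
    apply Rinv_0_lt_compat in Pz.
    destruct (Nat.eq_dec j J) as [->|Nj].
    - eapply Rle_trans; [apply H2|]. unfold Rdiv. apply Rmult_le_compat_r; lra.
    - eapply Rle_trans; [apply H1; lia|]. unfold Rdiv. apply Rmult_le_compat_r; lra. }
  destruct (G 5%nat (le_n _)) as [B1 [P1 H1]].
  exists (B1 + Rabs B0)%R. pose proof (Rabs_pos B0). pose proof (Rle_abs B0). split; [lra|].
  intros n. pose proof (pow_lt (zn n) 8 (zn_pos n)) as Pz. apply Rinv_0_lt_compat in Pz. split.
  - eapply Rle_trans; [apply H0|]. unfold Rdiv. apply Rmult_le_compat_r; lra.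
  - intros j Hj. eapply Rle_trans; [apply H1; lia|]. unfold Rdiv. apply Rmult_le_compat_r; lra.
Qed.

Lemma zn_abs n : (Cmod (RtoC (IZR n)) <= zn n)%R.
Proof. rewrite Cmod_R, <- abs_IZR. unfold zn. lra. Qed.
Lemma div_pow_le B n p q : (0 <= B)%R -> (q <= p)%nat -> (B / zn n ^ p <= B / zn n ^ q)%R.
Proof.
  intros HB Hq. unfold Rdiv. apply Rmult_le_compat_l; auto.
  apply Rinv_le_contravar. apply pow_lt, zn_pos. apply Rle_pow; auto. apply zn_ge1.
Qed.
Lemma mul_zn_le (a b : C) B n p : (0 <= B)%R -> (Cmod a <= zn n)%R ->
  (Cmod b <= B / zn n ^ S p)%R -> (Cmod (a * b) <= B / zn n ^ p)%R.
Proof.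
  intros HB Ha Hb. rewrite Cmod_mult.
  replace (B / zn n ^ p)%R with (zn n * (B / zn n ^ S p))%R.
  apply Rmult_le_compat; auto; apply Cmod_ge_0.
  pose proof (zn_pos n). assert (zn n ^ p <> 0)%R by (apply pow_nonzero; lra).
  simpl. field. split; auto; lra.
Qed.
Lemma Cmod_restr {I} (P : I -> Prop) (a : I -> C) i M :
  (Cmod (a i) <= M)%R -> (Cmod (restr P a i) <= M)%R.
Proof.
  intros H. unfold restr. destruct (excluded_middle_informative _); auto.
  rewrite Cmod_0. eapply Rle_trans; [apply Cmod_ge_0|exact H].
Qed.

Definition wz (a : nat) (n : Z) : C := match a with O => 1 | _ => RtoC (IZR n) end.
Lemma wz_bound a n : (Cmod (wz a n) <= zn n)%R.
Proof. destruct a; [|apply zn_abs]. simpl. rewrite Cmod_1. apply zn_ge1. Qed.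

(* [SJ a j] sums [n^a * sd j (z + n tau)] for a = 0, 1; [Es] is the Eisenstein series [E1], made
   absolutely convergent by the sign terms, which cancel in symmetric sums; [GJ] is [SJ] at
   z = 0 without its polar term. *)
Definition SJ (a j : nat) (tau z : C) : C := tsum (fun n => wz a n * sd j (pt tau z n)).
Definition Es (tau z : C) : C := tsum (fun n => ct (pt tau z n) + pii * sg n).
Definition nz (n : Z) : Prop := n <> 0%Z.
Definition GJ (a j : nat) (tau : C) : C :=
  tsum (restr nz (fun n => wz a n * sd j (pt tau 0 n))).

Lemma SJ_spec a j tau z : (0 < Im tau)%R -> (j <= 4)%nat ->
  has_sum (fun n => wz a n * sd j (pt tau z n)) (SJ a j tau z).
Proof.
  intros Hy Hj. apply tsum_spec. destruct (point_terms tau z Hy) as [B [PB H]].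
  apply (summable_pow_bound _ B 7); [lia|]. intros n. apply mul_zn_le; [lra|apply wz_bound|].
  now apply H.
Qed.
Lemma S0_spec j tau z : (0 < Im tau)%R -> (j <= 4)%nat ->
  has_sum (fun n => sd j (pt tau z n)) (SJ 0 j tau z).
Proof.
  intros. eapply has_sum_ext; [|apply SJ_spec; auto]. intros; simpl; ring.
Qed.
Lemma Es_spec tau z : (0 < Im tau)%R ->
  has_sum (fun n => ct (pt tau z n) + pii * sg n) (Es tau z).
Proof.
  intros Hy. apply tsum_spec. destruct (point_terms tau z Hy) as [B [PB H]].
  apply (summable_pow_bound _ B 8); [lia|]. intros n. apply H.
Qed.
Lemma GJ_spec a j tau : (0 < Im tau)%R -> (j <= 4)%nat ->
  has_sum (restr nz (fun n => wz a n * sd j (pt tau 0 n))) (GJ a j tau).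
Proof.
  intros Hy Hj. apply tsum_spec. destruct (point_terms tau 0 Hy) as [B [PB H]].
  apply (summable_pow_bound _ B 7); [lia|]. intros n. apply Cmod_restr.
  apply mul_zn_le; [lra|apply wz_bound|]. now apply H.
Qed.
Lemma G0_spec j tau : (0 < Im tau)%R -> (j <= 4)%nat ->
  has_sum (restr nz (fun n => sd j (pt tau 0 n))) (GJ 0 j tau).
Proof.
  intros. eapply has_sum_ext; [|apply GJ_spec; eauto]. intros n; unfold restr; simpl.
  destruct (excluded_middle_informative _); ring.
Qed.

Lemma summable2 (a : Z * Z -> C) B :
  (forall m k, (Cmod (a (m, k)) <= B / (zn m ^ 2 * zn k ^ 2))%R) -> summable a.
Proof.
  intros H. destruct (bdd_sums_pow 2 (le_n _)) as [M HM].
  assert (HB : (0 <= B)%R).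
  { specialize (H 0%Z 0%Z). pose proof (Cmod_ge_0 (a (0%Z, 0%Z))). unfold zn in H.
    simpl in H. rewrite Rplus_0_r, !Rmult_1_r in H. lra. }
  apply (bdd_sums_prod _ (fun m => B * M * / zn m ^ 2)%R).
  - intros; apply Cmod_ge_0.
  - intros m l Nl. apply Rle_trans with (rsum (fun k => B * / zn m ^ 2 * / zn k ^ 2)%R l).
    + apply rsum_le. intros k _. eapply Rle_trans; [apply H|]. right.
      pose proof (zn_pos m); pose proof (zn_pos k). field. lra.
    + rewrite rsum_scal. replace (B * M * / zn m ^ 2)%R with (B * / zn m ^ 2 * M)%R by ring.
      apply Rmult_le_compat_l; auto. apply Rmult_le_pos; auto.
      apply Rlt_le, Rinv_0_lt_compat, pow_lt, zn_pos.
  - assert (0 <= M)%R by (apply (HM nil); constructor).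
    apply bdd_sums_scal; [nra|]. now apply bdd_sums_pow.
Qed.

Lemma has_sum_shift (a : Z -> C) k s : has_sum a s -> has_sum (fun n => a (n + k)%Z) s.
Proof.
  intros H. apply (has_sum_bij (fun n => n - k)%Z (fun n => n + k)%Z); try (intros; lia).
  eapply has_sum_ext; [|exact H]. intros n; cbv beta. f_equal; lia.
Qed.
Lemma has_sum_odd (a : Z -> C) s : (forall n, a (- n)%Z = - a n) -> has_sum a s -> s = 0.
Proof.
  intros Ho H. pose proof C2_nz.
  assert (E : s = -(1) * s).
  { apply (has_sum_unique a); auto. apply (has_sum_bij Z.opp Z.opp); try (intros; lia).
    eapply has_sum_ext; [|exact (has_sum_scal (-(1)) _ _ H)].
    intros n; cbv beta. rewrite Ho; ring. }
  assert (E2 : 2 * s = 0) by (replace (2 * s) with (s - -(1) * s) by ring; rewrite <- E; ring).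
  replace s with (/ 2 * (2 * s)) by (field; auto). rewrite E2; ring.
Qed.
(** For k = 1 only n = -1 and n = 0 contribute, 1 each; other k are reached by unit steps in either
    direction. *)
Lemma has_sum_sg k : has_sum (fun n => sg (n + k) - sg n) (2 * RtoC (IZR k)).
Proof.
  assert (H1 : has_sum (fun n => sg (n + 1) - sg n) 2).
  { replace (RtoC 2) with (lsum (fun n => sg (n + 1) - sg n) [(-1)%Z; 0%Z]).
    - apply has_sum_finite. repeat constructor; simpl; intuition lia.
      intros i Hi. unfold sg.
      assert (i < -1 \/ 0 < i)%Z as [L|L].
      { simpl in Hi. lia. }
      rewrite !Z.sgn_neg by lia. ring. rewrite !Z.sgn_pos by lia. ring.
    - unfold lsum, sg. simpl. change (IZR (-1)) with (-(1))%R. rewrite RtoC_opp. ring. }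
  assert (step : forall k, has_sum (fun n => sg (n + k + 1) - sg (n + k)) 2).
  { intros j. apply (has_sum_shift _ j) in H1. eapply has_sum_ext; [|exact H1].
    intros n; reflexivity. }
  induction k using Z.peano_ind.
  - replace (2 * RtoC (IZR 0)) with (RtoC 0) by (simpl; ring).
    eapply has_sum_ext; [|exact has_sum_0]. intros n. rewrite Z.add_0_r. simpl. ring.
  - rewrite succ_IZR, RtoC_plus.
    replace (2 * (RtoC (IZR k) + RtoC 1)) with (2 * RtoC (IZR k) + 2) by ring.
    eapply has_sum_ext; [|exact (has_sum_plus _ _ _ _ IHk (step k))]. intros n. cbv beta.
    replace (n + Z.succ k)%Z with (n + k + 1)%Z by lia. ring.
  - rewrite <- Z.sub_1_r, minus_IZR, RtoC_minus.
    replace (2 * (RtoC (IZR k) - RtoC 1)) with (2 * RtoC (IZR k) - 2) by ring.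
    eapply has_sum_ext; [|exact (has_sum_minus _ _ _ _ IHk (step (k - 1)%Z))].
    intros n. cbv beta. replace (n + (k - 1) + 1)%Z with (n + k)%Z by lia. ring.
Qed.
(** As n runs from minus to plus infinity the cotangent goes from pii to -pii, and a shift by k
    collects this jump k times. *)
Lemma ct_telescope tau z k : (0 < Im tau)%R ->
  has_sum (fun n => ct (pt tau z (n + k)) - ct (pt tau z n)) (- (2 * pii * RtoC (IZR k))).
Proof.
  intros Hy. pose proof (Es_spec tau z Hy) as HE.
  pose proof (has_sum_minus _ _ _ _ (has_sum_shift _ k _ HE) HE) as H1.
  pose proof (has_sum_scal pii _ _ (has_sum_sg k)) as H2.
  replace (- (2 * pii * RtoC (IZR k))) with (Es tau z - Es tau z - pii * (2 * RtoC (IZR k))) by ring.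
  eapply has_sum_ext; [|exact (has_sum_minus _ _ _ _ H1 H2)]. intros n; cbv beta. ring.
Qed.
(** The series is [Es] at z + m tau, so this is the quasi-periodicity of E1 in the direction tau. *)
Lemma Es_shift tau z m : (0 < Im tau)%R ->
  has_sum (fun k => ct (pt tau z (m + k)) + pii * sg k) (Es tau z - 2 * pii * RtoC (IZR m)).
Proof.
  intros Hy. pose proof (has_sum_shift _ m _ (Es_spec tau z Hy)) as H1.
  pose proof (has_sum_scal pii _ _ (has_sum_sg m)) as H2.
  replace (2 * pii * RtoC (IZR m)) with (pii * (2 * RtoC (IZR m))) by ring.
  eapply has_sum_ext; [|exact (has_sum_minus _ _ _ _ H1 H2)]. intros n; cbv beta.
  rewrite (Z.add_comm n m). ring.
Qed.

(** * Quadratic identities *)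

(** This formula is the x-derivative of the addition formula c_x c_y = pii^2 - c_(x-y) (c_x - c_y),
    and [sd0_mul] is the y-derivative of this one. Both are checked as rational identities in [ee x]
    and [ee y]. *)
Lemma sd0_ct_mul x y : ~ isint x -> ~ isint y -> ~ isint (x - y) ->
  sd 0 x * ct y = - (sd 0 (x - y) * (ct x - ct y)) - ct (x - y) * sd 0 x.
Proof.
  intros Hx Hy Hxy. apply ee_ne1 in Hx, Hy, Hxy. unfold sd, ct. rewrite ee_sub in *.
  pose proof (ee_nz y). pose proof (ee_nz x).
  set (X := ee x) in *. set (Y := ee y) in *. clearbody X Y.
  assert (X - Y <> 0).
  { intros E. apply Hxy. apply Csub_0 in E. rewrite E. field; auto. }
  field. auto.
Qed.
Lemma sd0_mul x y : ~ isint x -> ~ isint y -> ~ isint (x - y) ->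
  sd 0 x * sd 0 y = sd 0 (x - y) * (sd 0 x + sd 0 y) - sd 1 (x - y) * (ct x - ct y).
Proof.
  intros Hx Hy Hxy. apply ee_ne1 in Hx, Hy, Hxy. unfold sd, ct. rewrite ee_sub in *.
  pose proof (ee_nz y). pose proof (ee_nz x).
  set (X := ee x) in *. set (Y := ee y) in *. clearbody X Y.
  assert (X - Y <> 0).
  { intros E. apply Hxy. apply Csub_0 in E. rewrite E. field; auto. }
  field. auto.
Qed.

Lemma pt0_nonint tau n : (0 < Im tau)%R -> n <> 0%Z -> ~ isint (pt tau 0 n).
Proof.
  intros Hy Hn I. apply isint_Im in I. rewrite Im_pt in I. simpl in I.
  rewrite Rplus_0_l in I. apply Rmult_integral in I. destruct I as [I|I]; [|lra].
  apply eq_IZR in I; auto.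
Qed.
Lemma pt_opp tau n : pt tau 0 (- n) = - pt tau 0 n.
Proof. unfold pt. rewrite opp_IZR, RtoC_opp. ring. Qed.
Lemma pt_diff tau z m k : pt tau z (m + k) - pt tau z m = pt tau 0 k.
Proof. unfold pt. rewrite plus_IZR, RtoC_plus. ring. Qed.
Lemma pt_diff' tau z m k : pt tau z m - pt tau z (m + k) = - pt tau 0 k.
Proof. rewrite <- (pt_diff tau z m k). ring. Qed.
Lemma pt_0 tau z : pt tau z 0 = z.
Proof. unfold pt. simpl. ring. Qed.
Lemma ct_0 : ct 0 = 0.
Proof.
  unfold ct. replace (ee 0) with (RtoC 1). replace (1 - 1) with (RtoC 0) by ring.
  unfold Cdiv. rewrite Cinv_0. ring.
  symmetry. apply ee_1_iff. exists 0%Z. reflexivity.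
Qed.
Lemma sg_opp n : sg (- n) = - sg n.
Proof. unfold sg. now rewrite Z.sgn_opp, opp_IZR, RtoC_opp. Qed.
Lemma restr_ext {I} (P : I -> Prop) (a b : I -> C) i : (P i -> a i = b i) -> restr P a i = restr P b i.
Proof. unfold restr. destruct (excluded_middle_informative _); auto. Qed.

Lemma has_sum_delta {I} (j : I) Q : has_sum (restr (fun k => k = j) (fun _ => Q)) Q.
Proof.
  pose proof (has_sum_single (restr (fun k => k = j) (fun _ => Q)) j
    (fun i Hi => restr_out _ _ i Hi)) as H.
  now rewrite restr_in in H.
Qed.

(** The two signs agree unless |k| <= |m|, and then zn k <= zn m. *)
Lemma sg_diff_bound m k : (Cmod (sg k - sg (m + k)) <= 2 * zn m ^ 2 / zn k ^ 2)%R.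
Proof.
  pose proof (zn_ge1 m). pose proof (zn_ge1 k).
  destruct (Z_le_gt_dec (Z.abs k) (Z.abs m)) as [L|L].
  - apply Rle_trans with 2%R.
    + eapply Rle_trans; [apply Cmod_triangle|]. rewrite Cmod_opp. unfold sg.
      rewrite !Cmod_R, <- !abs_IZR.
      assert (forall j, (IZR (Z.abs (Z.sgn j)) <= 1)%R) by (intros; apply IZR_le; lia).
      pose proof (H1 k). pose proof (H1 (m + k)%Z). lra.
    + assert (Hz : (zn k <= zn m)%R) by (unfold zn; apply Rplus_le_compat_l, IZR_le; lia).
      assert ((zn k ^ 2 <= zn m ^ 2)%R) by (apply pow_incr; lra).
      assert (0 < zn k ^ 2)%R by (apply pow_lt; lra).
      apply Rmult_le_reg_r with (zn k ^ 2)%R; auto. unfold Rdiv.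
      rewrite Rmult_assoc, Rinv_l, Rmult_1_r by lra. lra.
  - replace (sg k - sg (m + k)) with (RtoC 0).
    + rewrite Cmod_0. apply Rmult_le_pos. apply Rmult_le_pos; [lra|apply pow2_ge_0].
      apply Rlt_le, Rinv_0_lt_compat, pow_lt; lra.
    + unfold sg. destruct (Z_lt_le_dec k 0).
      rewrite !Z.sgn_neg by lia. ring. rewrite !Z.sgn_pos by lia. ring.
Qed.
Lemma inv_zn_shift m k : (/ zn (m + k) ^ 2 <= zn m ^ 2 / zn k ^ 2)%R.
Proof.
  pose proof (zn_ge1 m). pose proof (zn_ge1 k). pose proof (zn_ge1 (m + k)).
  replace (zn m ^ 2 / zn k ^ 2)%R with (/ (zn k / zn m) ^ 2)%R by (field; lra).
  apply Rinv_le_contravar. apply pow_lt, Rdiv_lt_0_compat; lra.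
  apply pow_incr. split. apply Rlt_le, Rdiv_lt_0_compat; lra.
  apply Rmult_le_reg_r with (zn m); [lra|]. unfold Rdiv.
  rewrite Rmult_assoc, Rinv_l, Rmult_1_r by lra. apply zn_add.
Qed.
(** The growth in m allowed for [v] is absorbed by the decay of [u], so that a factor at m + k can
    be bounded through k. *)
Lemma summable_conv (u : Z -> C) (v : Z -> Z -> C) B B' :
  (0 <= B)%R -> (0 <= B')%R ->
  (forall m, (Cmod (u m) <= B / zn m ^ 8)%R) ->
  (forall m k, (Cmod (v m k) <= B' * (zn m ^ 2 / zn k ^ 2))%R) ->
  summable (fun p => u (fst p) * v (fst p) (snd p)).
Proof.
  intros HB HB' Hu Hv. apply (summable2 _ (B * B')). intros m k. simpl fst; simpl snd.
  rewrite Cmod_mult.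
  pose proof (zn_pos m). pose proof (zn_pos k).
  apply Rle_trans with (B / zn m ^ 4 * (B' * (zn m ^ 2 / zn k ^ 2)))%R.
  - apply Rmult_le_compat; try apply Cmod_ge_0; auto.
    eapply Rle_trans; [apply Hu|]. apply div_pow_le; auto.
  - right. field. lra.
Qed.

(* Recentring [Es] at its m-th term costs [2 pi i m]; in the double sum of [s_m c_(m+k)] the
   addition formula then makes the columns [k] and [-k] cancel. *)
Lemma Es_mul_S tau z : (0 < Im tau)%R -> (forall n, ~ isint (pt tau z n)) ->
  2 * (Es tau z * SJ 0 0 tau z) = 4 * pii * SJ 1 0 tau z - SJ 0 1 tau z.
Proof.
  intros Hy Hd. destruct (point_terms tau z Hy) as [B [PB HB]].
  destruct (point_terms tau 0 Hy) as [B0 [PB0 HB0]].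
  pose proof PI_RGT_0 as HP.
  set (s := fun n => sd 0 (pt tau z n)). set (c := fun n => ct (pt tau z n)).
  set (F2 := SJ 0 0 tau z).
  assert (HF2 : has_sum s F2) by (apply S0_spec; auto; lia).
  (* The sign correction is indexed by the column k, which makes row m exactly the series of
     [Es_shift]; the cost [sg k - sg (m + k)] vanishes for |k| > |m|. *)
  set (v := fun m k => c (m + k)%Z + pii * sg k).
  assert (Sa : summable (fun p => s (fst p) * v (fst p) (snd p))).
  { apply (summable_conv s v B (B + PI * 2)); try lra.
    - intros m. apply HB; lia.
    - intros m k. replace (v m k) with ((c (m + k)%Z + pii * sg (m + k)) + pii * (sg k - sg (m + k)))
        by (unfold v; ring).
      eapply Rle_trans; [apply Cmod_triangle|]. rewrite Rmult_plus_distr_r.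
      apply Rplus_le_compat.
      + eapply Rle_trans; [apply HB|]. eapply Rle_trans; [apply (div_pow_le _ _ 8 2); [lra|lia]|].
        unfold Rdiv at 1. apply Rmult_le_compat_l; [lra|]. apply inv_zn_shift.
      + rewrite Cmod_mult, Cmod_pii, Rmult_assoc. apply Rmult_le_compat_l; [lra|].
        eapply Rle_trans; [apply sg_diff_bound|]. right. unfold Rdiv; ring. }
  set (q := fun k => - (2 * pii * RtoC (IZR k)) * sd 0 (pt tau 0 k) + (ct (pt tau 0 k) + pii * sg k) * F2).
  destruct (has_sum_fubini_swap (fun p => s (fst p) * v (fst p) (snd p))
    (fun m => s m * (Es tau z - 2 * pii * RtoC (IZR m)))
    (fun k => q k + restr (fun k => k = 0%Z) (fun _ => - / 2 * SJ 0 1 tau z) k) Sa) as [t [T1 T2]].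
  - intros m. simpl fst; simpl snd. apply has_sum_scal. apply (Es_shift tau z m Hy).
  - intros k. simpl fst; simpl snd. destruct (Z.eq_dec k 0) as [->|Nk].
    + rewrite restr_in by auto.
      replace (q 0%Z + - / 2 * SJ 0 1 tau z) with (- / 2 * SJ 0 1 tau z).
      2:{ unfold q. rewrite pt_0, ct_0. unfold sg. simpl. ring. }
      eapply has_sum_ext; [|exact (has_sum_scal (- / 2) _ _ (S0_spec 1 tau z Hy ltac:(lia)))].
      (* In the column k = 0 the summand is s c = - s' / 2. *)
      intros m. cbv beta. unfold v, s, c. rewrite Z.add_0_r, sd1. unfold sg. simpl. field.
    + rewrite restr_out by auto.
      replace (q k + 0) with (sd 0 (pt tau 0 k) * - (2 * pii * RtoC (IZR k)) +
        (ct (pt tau 0 k) + pii * sg k) * F2) by (unfold q; ring).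
      eapply has_sum_ext; [|exact (has_sum_plus _ _ _ _
        (has_sum_scal (sd 0 (pt tau 0 k)) _ _ (ct_telescope tau z k Hy))
        (has_sum_scal (ct (pt tau 0 k) + pii * sg k) _ _ HF2))].
      intros m. cbv beta. unfold v.
      pose proof (sd0_ct_mul (pt tau z m) (pt tau z (m + k)) (Hd _) (Hd _)) as E.
      rewrite pt_diff', sd0_opp, ct_opp in E.
      specialize (E ltac:(rewrite isint_opp; apply pt0_nonint; auto)).
      replace (s m * (c (m + k)%Z + pii * sg k)) with
        (sd 0 (pt tau z m) * ct (pt tau z (m + k)) + pii * sg k * s m) by (unfold s, c; ring).
      rewrite E. unfold s. ring.
  - assert (Q0 : has_sum q 0).
    { assert (HG : summable q).
      { apply (summable_pow_bound _ (2 * PI * B0 + B0 * Cmod F2) 7); [lia|]. intros k.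
        unfold q. eapply Rle_trans; [apply Cmod_triangle|]. unfold Rdiv. rewrite Rmult_plus_distr_r.
        apply Rplus_le_compat.
        - replace (- (2 * pii * RtoC (IZR k)) * sd 0 (pt tau 0 k)) with
            (- (2 * pii) * (RtoC (IZR k) * sd 0 (pt tau 0 k))) by ring.
          rewrite Cmod_mult, Cmod_opp, Cmod_mult, Cmod_pii, Cmod_R, Rabs_pos_eq by lra.
          rewrite (Rmult_assoc (2 * PI)). apply Rmult_le_compat_l; [lra|].
          apply mul_zn_le; [lra|apply zn_abs|]. apply HB0; lia.
        - rewrite Cmod_mult, Rmult_assoc, (Rmult_comm (Cmod F2)), <- Rmult_assoc.
          apply Rmult_le_compat_r; [apply Cmod_ge_0|].
          eapply Rle_trans; [apply HB0|]. apply div_pow_le; [lra|lia]. }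
      destruct (summable_has_sum q HG) as [u Hu].
      replace (RtoC 0) with u; auto. apply (has_sum_odd q); auto.
      intros n. unfold q. rewrite pt_opp, sd0_opp, ct_opp, sg_opp, opp_IZR, RtoC_opp. ring. }
    assert (T3 : t = 0 + - / 2 * SJ 0 1 tau z).
    { apply (has_sum_unique _ _ _ T2). apply has_sum_plus; auto.
      apply has_sum_delta. }
    assert (T4 : t = Es tau z * F2 - 2 * pii * SJ 1 0 tau z).
    { apply (has_sum_unique _ _ _ T1).
      eapply has_sum_ext; [|exact (has_sum_minus _ _ _ _ (has_sum_scal (Es tau z) _ _ HF2)
        (has_sum_scal (2 * pii) _ _ (SJ_spec 1 0 tau z Hy ltac:(lia))))].
      intros m. unfold s. simpl wz. cbv beta. ring. }
    rewrite T3 in T4.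
    replace (2 * (Es tau z * F2)) with (2 * (Es tau z * F2 - 2 * pii * SJ 1 0 tau z) + 4 * pii * SJ 1 0 tau z) by ring.
    rewrite <- T4. field.
Qed.

(* Sum [s_m s_(m+k)] along the columns [k], with the addition formula for [s]. *)
Lemma S_square tau z : (0 < Im tau)%R -> (forall n, ~ isint (pt tau z n)) ->
  SJ 0 2 tau z = 6 * (SJ 0 0 tau z * SJ 0 0 tau z) - 12 * pii * GJ 1 1 tau
    - 12 * (SJ 0 0 tau z * GJ 0 0 tau) + 4 * (pii * pii) * SJ 0 0 tau z.
Proof.
  intros Hy Hd. destruct (point_terms tau z Hy) as [B [PB HB]].
  set (s := fun n => sd 0 (pt tau z n)). set (F2 := SJ 0 0 tau z).
  assert (HF2 : has_sum s F2) by (apply S0_spec; auto; lia).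
  assert (Sa : summable (fun p => s (fst p) * s (fst p + snd p)%Z)).
  { apply (summable_conv s (fun m k => s (m + k)%Z) B B); try lra.
    - intros m. apply HB; lia.
    - intros m k. eapply Rle_trans; [apply HB; lia|].
      eapply Rle_trans; [apply (div_pow_le _ _ 8 2); [lra|lia]|].
      unfold Rdiv at 1. apply Rmult_le_compat_l; [lra|]. apply inv_zn_shift. }
  (* The addition formula does not cover the column k = 0; its sum of squares comes from s'' = 6 s^2
     + 4 pii^2 s. *)
  set (Q := / 6 * (SJ 0 2 tau z - 4 * (pii * pii) * F2)).
  assert (HQ : has_sum (fun m => s m * s m) Q).
  { eapply has_sum_ext; [|exact (has_sum_scal (/ 6) _ _ (has_sum_minus _ _ _ _
      (S0_spec 2 tau z Hy ltac:(lia)) (has_sum_scal (4 * (pii * pii)) _ _ HF2)))].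
    intros m; cbv beta. unfold s. rewrite sd2. field. }
  destruct (has_sum_fubini_swap (fun p => s (fst p) * s (fst p + snd p)%Z)
    (fun m => s m * F2)
    (fun k => 2 * pii * restr nz (fun k => wz 1 k * sd 1 (pt tau 0 k)) k
       + 2 * F2 * restr nz (fun k => sd 0 (pt tau 0 k)) k
       + restr (fun k => k = 0%Z) (fun _ => Q) k) Sa) as [t [T1 T2]].
  - intros m. simpl fst; simpl snd. apply has_sum_scal.
    eapply has_sum_ext; [|exact (has_sum_shift _ m _ HF2)]. intros k; cbv beta.
    now rewrite Z.add_comm.
  - intros k. simpl fst; simpl snd. destruct (Z.eq_dec k 0) as [->|Nk].
    + rewrite !restr_out, restr_in by (auto; unfold nz; tauto).
      replace (2 * pii * 0 + 2 * F2 * 0 + Q) with Q by ring.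
      eapply has_sum_ext; [|exact HQ]. intros m; cbv beta. now rewrite Z.add_0_r.
    + rewrite !(restr_in nz), restr_out by auto.
      replace (2 * pii * (wz 1 k * sd 1 (pt tau 0 k)) + 2 * F2 * sd 0 (pt tau 0 k) + 0) with
        (- sd 1 (pt tau 0 k) * - (2 * pii * RtoC (IZR k)) + sd 0 (pt tau 0 k) * (F2 + F2))
        by (simpl wz; ring).
      eapply has_sum_ext; [|exact (has_sum_plus _ _ _ _
        (has_sum_scal (- sd 1 (pt tau 0 k)) _ _ (ct_telescope tau z k Hy))
        (has_sum_scal (sd 0 (pt tau 0 k)) _ _
           (has_sum_plus _ _ _ _ (has_sum_shift _ k _ HF2) HF2)))].
      intros m. cbv beta. unfold s. rewrite (Cmult_comm (sd 0 (pt tau z m))).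
      rewrite sd0_mul; auto; rewrite pt_diff; [ring|]. now apply pt0_nonint.
  - assert (T3 : t = 2 * pii * GJ 1 1 tau + 2 * F2 * GJ 0 0 tau + Q).
    { apply (has_sum_unique _ _ _ T2). apply has_sum_plus; [apply has_sum_plus|].
      - apply has_sum_scal, GJ_spec; auto; lia.
      - apply has_sum_scal, G0_spec; auto; lia.
      - apply has_sum_delta. }
    assert (T4 : t = F2 * F2).
    { apply (has_sum_unique _ _ _ T1).
      eapply has_sum_ext; [|exact (has_sum_scal F2 _ _ HF2)]. intros; cbv beta; ring. }
    rewrite T3 in T4. rewrite <- T4. unfold Q. field.
Qed.

(* As [S_square] at z = 0; [corr] restores the terms m = 0 and m = -k. *)
Lemma G_square tau : (0 < Im tau)%R ->
  2 * pii * GJ 1 1 tau = 5 * (/ 6 * (GJ 0 2 tau - 4 * (pii * pii) * GJ 0 0 tau))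
    + 4 * (pii * pii) * GJ 0 0 tau - GJ 0 0 tau * GJ 0 0 tau.
Proof.
  intros Hy. destruct (point_terms tau 0 Hy) as [B [PB HB]].
  set (s := restr nz (fun n => sd 0 (pt tau 0 n))). set (g := GJ 0 0 tau).
  assert (Hg : has_sum s g) by (apply G0_spec; auto; lia).
  assert (s0 : s 0%Z = 0) by (apply restr_out; unfold nz; tauto).
  assert (s1 : forall n, n <> 0%Z -> s n = sd 0 (pt tau 0 n)) by (intros n Hn; unfold s; now rewrite restr_in).
  assert (sb : forall m, (Cmod (s m) <= B / zn m ^ 8)%R) by (intros; apply Cmod_restr, HB; lia).
  assert (Sa : summable (fun p => s (fst p) * s (fst p + snd p)%Z)).
  { apply (summable_conv s (fun m k => s (m + k)%Z) B B); try lra; auto.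
    intros m k. eapply Rle_trans; [apply sb|].
      eapply Rle_trans; [apply (div_pow_le _ _ 8 2); [lra|lia]|].
      unfold Rdiv at 1. apply Rmult_le_compat_l; [lra|]. apply inv_zn_shift. }
  set (Q := / 6 * (GJ 0 2 tau - 4 * (pii * pii) * g)).
  assert (HQ : has_sum (fun m => s m * s m) Q).
  { eapply has_sum_ext; [|exact (has_sum_scal (/ 6) _ _ (has_sum_minus _ _ _ _
      (G0_spec 2 tau Hy ltac:(lia)) (has_sum_scal (4 * (pii * pii)) _ _ Hg)))].
    intros m; cbv beta. destruct (Z.eq_dec m 0) as [->|Nm].
    rewrite restr_out, s0 by (unfold nz; tauto). ring.
    rewrite restr_in, s1 by auto. rewrite sd2. field. }
  (* At m = 0 and m = -k the restricted summand is 0, whereas the right-hand side of the addition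
     formula gives 3 s_k^2 + 2 pii^2 s_k, as [ct 0 = 0] and -s' c = 2 c^2 s. The correction cancels
     this value. *)
  set (corr := fun k => - (3 * (s k * s k)) - 2 * (pii * pii) * s k).
  destruct (has_sum_fubini_swap (fun p => s (fst p) * s (fst p + snd p)%Z)
    (fun m => s m * g)
    (fun k => 2 * pii * restr nz (fun k => wz 1 k * sd 1 (pt tau 0 k)) k
       + 2 * g * s k + 2 * corr k + restr (fun k => k = 0%Z) (fun _ => Q) k) Sa) as [t [T1 T2]].
  - intros m. simpl fst; simpl snd. apply has_sum_scal.
    eapply has_sum_ext; [|exact (has_sum_shift _ m _ Hg)]. intros k; cbv beta.
    now rewrite Z.add_comm.
  - intros k. simpl fst; simpl snd. destruct (Z.eq_dec k 0) as [->|Nk].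
    + unfold corr. rewrite s0, restr_out, restr_in by (auto; unfold nz; tauto).
      match goal with |- has_sum _ ?x => replace x with Q by ring end.
      eapply has_sum_ext; [|exact HQ]. intros m; cbv beta. now rewrite Z.add_0_r.
    + rewrite (restr_in nz), restr_out by auto.
      set (dl := fun j : Z => restr (fun m => m = j) (fun _ => corr k)).
      assert (Hdl : forall j, has_sum (dl j) (corr k)).
      { intros j. apply has_sum_delta. }
      match goal with |- has_sum _ ?x => replace x with
        (- sd 1 (pt tau 0 k) * - (2 * pii * RtoC (IZR k)) + s k * (g + g) + (corr k + corr k))
        by (simpl wz; ring) end.
      eapply has_sum_ext; [|exact (has_sum_plus _ _ _ _ (has_sum_plus _ _ _ _
        (has_sum_scal (- sd 1 (pt tau 0 k)) _ _ (ct_telescope tau 0 k Hy))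
        (has_sum_scal (s k) _ _
           (has_sum_plus _ _ _ _ (has_sum_shift _ k _ Hg) Hg)))
        (has_sum_plus _ _ _ _ (Hdl 0%Z) (Hdl (- k)%Z)))].
      assert (C2 : ct (pt tau 0 k) * ct (pt tau 0 k) = s k + pii * pii).
      { rewrite s1 by auto. rewrite sd0. ring. }
      assert (Ek : - sd 1 (pt tau 0 k) * ct (pt tau 0 k) = 2 * (s k + pii * pii) * s k).
      { rewrite <- C2, sd1, <- s1 by auto. ring. }
      intros m. cbv beta. unfold dl.
      destruct (Z.eq_dec m 0) as [->|Nm]; [|destruct (Z.eq_dec m (- k)) as [->|Nmk]].
      * rewrite (restr_in (fun m => m = 0%Z)), restr_out by lia.
        rewrite s0, Z.add_0_l, pt_0, ct_0.
        replace (- sd 1 (pt tau 0 k) * (ct (pt tau 0 k) - 0)) with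
          (- sd 1 (pt tau 0 k) * ct (pt tau 0 k)) by ring. rewrite Ek. unfold corr. ring.
      * rewrite restr_out, restr_in by lia.
        replace (- k + k)%Z with 0%Z by lia. rewrite pt_0, ct_0, s0, pt_opp, ct_opp.
        replace (s (- k)%Z) with (s k).
        2:{ rewrite !s1 by lia. now rewrite pt_opp, sd0_opp. }
        replace (- sd 1 (pt tau 0 k) * (0 - - ct (pt tau 0 k))) with
          (- sd 1 (pt tau 0 k) * ct (pt tau 0 k)) by ring. rewrite Ek. unfold corr. ring.
      * rewrite !restr_out by lia. rewrite (Cmult_comm (s m)).
        rewrite !s1 by lia. rewrite sd0_mul; rewrite ?pt_diff; try apply pt0_nonint; auto; try lia.
        ring.
  - assert (T3 : t = 2 * pii * GJ 1 1 tau + 2 * g * g + 2 * (- (3 * Q) - 2 * (pii * pii) * g) + Q).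
    { apply (has_sum_unique _ _ _ T2). apply has_sum_plus; [apply has_sum_plus; [apply has_sum_plus|]|].
      - apply has_sum_scal, GJ_spec; auto; lia.
      - apply has_sum_scal; auto.
      - apply has_sum_scal. unfold corr.
        replace (- (3 * Q) - 2 * (pii * pii) * g) with (-(3) * Q - 2 * (pii * pii) * g) by ring.
        eapply has_sum_ext; [|exact (has_sum_minus _ _ _ _ (has_sum_scal (-(3)) _ _ HQ)
          (has_sum_scal (2 * (pii * pii)) _ _ Hg))].
        intros k; cbv beta; ring.
      - apply has_sum_delta. }
    assert (T4 : t = g * g).
    { apply (has_sum_unique _ _ _ T1).
      eapply has_sum_ext; [|exact (has_sum_scal g _ _ Hg)]. intros; cbv beta; ring. }
    rewrite T3 in T4. fold Q.
    replace (g * g) with (2 * (g * g) - g * g) by ring. rewrite <- T4 at 2. ring.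
Qed.

(** * Termwise differentiation *)

(** One statement serves both variables: z + n tau is affine in z with slope 1 and in tau with slope
    n. In the Taylor remainder, zn^(-8) loses one power of zn to the coefficient and two to the
    squared slope, which leaves zn^(-5). The alternative [k n = 0] covers an index whose point is a
    pole. *)
Lemma termwise_affine (phi0 phi1 phi2 : C -> C) (k al be q : Z -> C) (v r : _) B (N : nat)
  (F : C -> C) (L : C) :
  (0 < r)%R -> (0 <= B)%R ->
  (forall h, (Cmod h < r)%R ->
     has_sum (fun n => k n * phi0 (al n + be n * (v + h)) + q n) (F (v + h))) ->
  has_sum (fun n => k n * be n * phi1 (al n + be n * v)) L ->
  (forall n, (Cmod (k n) <= zn n)%R) -> (forall n, (Cmod (be n) <= zn n)%R) ->
  (forall n, (Z.abs n <= Z.of_nat N)%Z -> k n = 0 \/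
     cder phi0 (al n + be n * v) (phi1 (al n + be n * v))) ->
  (forall n h, (Z.of_nat N < Z.abs n)%Z -> (Cmod h < r)%R ->
     let p := al n + be n * (v + h) in
     cder phi0 p (phi1 p) /\ cder phi1 p (phi2 p) /\ (Cmod (phi2 p) <= B / zn n ^ 8)%R) ->
  cder F v L.
Proof.
  intros Hr HB HF HL Hk Hbe Hsm Hbig.
  apply (has_sum_cder (fun n w => k n * phi0 (al n + be n * w) + q n)
    (fun n => k n * be n * phi1 (al n + be n * v)) F L v r (fun n => 4 * B * / zn n ^ 5)%R (zrange N));
    auto using zrange_NoDup.
  - apply bdd_sums_scal; [lra|]. apply bdd_sums_pow; lia.
  - intros n. apply Rmult_le_pos; [lra|]. apply Rlt_le, Rinv_0_lt_compat, pow_lt, zn_pos.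
  - intros n Hn. apply zrange_In in Hn.
    destruct (Hsm n Hn) as [E|D].
    + rewrite E. eapply cder_eq; [|eapply cder_ext; [|apply (cder_const (q n))]].
      ring. intros w; cbv beta; ring.
    + eapply cder_eq; [|apply cder_plus; [apply cder_scal, (cder_comp phi0 (fun w => al n + be n * w));
        [|exact D]|apply cder_const]].
      2: apply cder_plus; [apply cder_const|apply cder_scal, cder_id]. cbv beta; ring.
  - intros n h Hn Hh. assert (Hn' : (Z.of_nat N < Z.abs n)%Z).
    { rewrite zrange_In in Hn. lia. }
    set (p := al n + be n * v).
    replace (k n * phi0 (al n + be n * (v + h)) + q n - (k n * phi0 p + q n)
       - k n * be n * phi1 p * h) with
       (k n * (phi0 (p + be n * h) - phi0 p - phi1 p * (be n * h))).
    2:{ replace (al n + be n * (v + h)) with (p + be n * h) by (unfold p; ring). ring. }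
    pose proof (zn_ge1 n) as Z1. pose proof (Cmod_ge_0 h) as Ph.
    assert (Pz : (0 < / zn n ^ 8)%R) by (apply Rinv_0_lt_compat, pow_lt; lra).
    assert (T : (Cmod (phi0 (p + be n * h)%C - phi0 p - phi1 p * (be n * h))
       <= 4 * (B / zn n ^ 8) * Cmod (be n * h) ^ 2)%R).
    { apply (cder_taylor2 phi0 phi1 phi2). intros t Ht.
      replace (p + RtoC t * (be n * h)) with (al n + be n * (v + RtoC t * h)) by (unfold p; ring).
      apply Hbig; auto. rewrite Cmod_mult, Cmod_R, Rabs_pos_eq by lra. nra. }
    rewrite Cmod_mult.
    apply Rle_trans with (zn n * (4 * (B / zn n ^ 8) * (zn n * Cmod h) ^ 2))%R.
    + apply Rmult_le_compat; auto; try apply Cmod_ge_0.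
      eapply Rle_trans; [exact T|]. apply Rmult_le_compat_l. unfold Rdiv; nra.
      apply pow_incr. split; [apply Cmod_ge_0|]. rewrite Cmod_mult.
      apply Rmult_le_compat_r; auto.
    + right. field. lra.
Qed.

Lemma Cmod_diff_add (a h : C) : Cmod (a + h - a) = Cmod h.
Proof. f_equal; ring. Qed.
Lemma Im_near tau h : (Cmod h < Im tau / 2)%R -> (0 < Im (tau + h))%R.
Proof.
  intros Hh. pose proof (Im_le h) as T. assert (T' : (Rabs (Im h) < Im tau / 2)%R) by lra.
  apply Rabs_def2 in T'. destruct tau, h; simpl in *. lra.
Qed.

(** The second derivative is compared with [sd j] in modulus only, so that the derivatives of [ct],
    which carry a sign, qualify too. *)
Definition kernel (phi0 phi1 phi2 : C -> C) : Prop :=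
  (forall w, ~ isint w -> cder phi0 w (phi1 w)) /\
  (forall w, ~ isint w -> cder phi1 w (phi2 w)) /\
  exists j, (j <= 4)%nat /\ forall w, Cmod (phi2 w) = Cmod (sd j w).
Lemma kernel_sd j : (j <= 2)%nat -> kernel (sd j) (sd (S j)) (sd (S (S j))).
Proof.
  intros Hj. split; [|split]; try (intros w Hw; apply cder_sd; auto; lia).
  exists (S (S j)). split; [lia|auto].
Qed.
Lemma kernel_ct : kernel ct (fun w => - sd 0 w) (fun w => - sd 1 w).
Proof.
  split; [|split].
  - apply cder_ct.
  - intros w Hw. apply cder_opp, cder_sd; auto; lia.
  - exists 1%nat. split; [lia|]. intros w. apply Cmod_opp.
Qed.

Lemma termwise_dz phi0 phi1 phi2 (k q : Z -> C) tau z (F : C -> C) L :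
  kernel phi0 phi1 phi2 -> (0 < Im tau)%R -> (forall n, ~ isint (pt tau z n)) ->
  (forall n, (Cmod (k n) <= zn n)%R) ->
  (forall w, has_sum (fun n => k n * phi0 (pt tau w n) + q n) (F w)) ->
  has_sum (fun n => k n * phi1 (pt tau z n)) L -> cder F z L.
Proof.
  intros [K1 [K2 [j [Hj K3]]]] Hy Hd Hk HF HL.
  destruct (far_terms tau z Hy) as [N [B [PB H]]].
  assert (E : forall w n, RtoC (IZR n) * tau + 1 * w = pt tau w n) by (intros; unfold pt; ring).
  apply (termwise_affine phi0 phi1 phi2 k (fun n => RtoC (IZR n) * tau) (fun _ => 1) q z 1 B N);
    try lra; auto.
  - intros h _. eapply has_sum_ext; [|apply HF]. intros n. now rewrite E.
  - eapply has_sum_ext; [|exact HL]. intros n. rewrite E. cbv beta; ring.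
  - intros n. rewrite Cmod_1. apply zn_ge1.
  - intros n _. right. rewrite E. auto.
  - intros n h Hn Hh. cbv zeta. rewrite E.
    destruct (H n tau (z + h) Hn) as [H1 [_ H3]].
    { replace (tau - tau) with (RtoC 0) by ring. rewrite Cmod_0; lra. }
    { rewrite Cmod_diff_add; lra. }
    rewrite K3. auto.
Qed.
Lemma termwise_dtau phi0 phi1 phi2 (k q : Z -> C) tau z (F : C -> C) L :
  kernel phi0 phi1 phi2 -> (0 < Im tau)%R -> (forall n, k n = 0 \/ ~ isint (pt tau z n)) ->
  (forall n, (Cmod (k n) <= zn n)%R) ->
  (forall t, (0 < Im t)%R -> has_sum (fun n => k n * phi0 (pt t z n) + q n) (F t)) ->
  has_sum (fun n => k n * RtoC (IZR n) * phi1 (pt tau z n)) L -> cder F tau L.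
Proof.
  intros [K1 [K2 [j [Hj K3]]]] Hy Hd Hk HF HL.
  destruct (far_terms tau z Hy) as [N [B [PB H]]].
  apply (termwise_affine phi0 phi1 phi2 k (fun _ => z) (fun n => RtoC (IZR n)) q tau (Im tau / 2) B N);
    try lra; auto using zn_abs.
  - intros h Hh. apply (HF (tau + h)). now apply Im_near.
  - intros n _. destruct (Hd n); auto.
  - intros n h Hn Hh. cbv zeta. fold (pt (tau + h) z n).
    destruct (H n (tau + h) z Hn) as [H1 [_ H3]].
    { rewrite Cmod_diff_add; lra. }
    { replace (z - z) with (RtoC 0) by ring. rewrite Cmod_0; lra. }
    rewrite K3. auto.
Qed.

Lemma Cmod_1_le n : (Cmod 1 <= zn n)%R.
Proof. rewrite Cmod_1. apply zn_ge1. Qed.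
Lemma SJ_dz a j tau z : (0 < Im tau)%R -> (forall n, ~ isint (pt tau z n)) -> (j <= 2)%nat ->
  cder (fun z => SJ a j tau z) z (SJ a (S j) tau z).
Proof.
  intros Hy Hd Hj. apply (termwise_dz _ _ _ (wz a) (fun _ => 0) tau z _ _ (kernel_sd j Hj));
    auto using wz_bound.
  - intros w. eapply has_sum_ext; [|apply SJ_spec; auto; lia]. intros n; cbv beta; ring.
  - apply SJ_spec; auto; lia.
Qed.
Lemma Es_dz tau z : (0 < Im tau)%R -> (forall n, ~ isint (pt tau z n)) ->
  cder (fun z => Es tau z) z (- SJ 0 0 tau z).
Proof.
  intros Hy Hd. apply (termwise_dz _ _ _ (fun _ => 1) (fun n => pii * sg n) tau z _ _ kernel_ct);
    auto using Cmod_1_le.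
  - intros w. eapply has_sum_ext; [|apply Es_spec; auto]. intros n; cbv beta; ring.
  - replace (- SJ 0 0 tau z) with (-(1) * SJ 0 0 tau z) by ring.
    eapply has_sum_ext; [|apply has_sum_scal, S0_spec; auto; lia]. intros n; cbv beta; ring.
Qed.
Lemma SJ_dtau j tau z : (0 < Im tau)%R -> (forall n, ~ isint (pt tau z n)) -> (j <= 2)%nat ->
  cder (fun tau => SJ 0 j tau z) tau (SJ 1 (S j) tau z).
Proof.
  intros Hy Hd Hj. apply (termwise_dtau _ _ _ (fun _ => 1) (fun _ => 0) tau z _ _ (kernel_sd j Hj));
    auto using Cmod_1_le.
  - intros t Ht. eapply has_sum_ext; [|apply S0_spec; auto; lia]. intros n; cbv beta; ring.
  - eapply has_sum_ext; [|apply (SJ_spec 1); auto; lia]. intros n; cbv beta; simpl wz; ring.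
Qed.
Lemma Es_dtau tau z : (0 < Im tau)%R -> (forall n, ~ isint (pt tau z n)) ->
  cder (fun tau => Es tau z) tau (- SJ 1 0 tau z).
Proof.
  intros Hy Hd. apply (termwise_dtau _ _ _ (fun _ => 1) (fun n => pii * sg n) tau z _ _ kernel_ct);
    auto using Cmod_1_le.
  - intros t Ht. eapply has_sum_ext; [|apply Es_spec; auto]. intros n; cbv beta; ring.
  - replace (- SJ 1 0 tau z) with (-(1) * SJ 1 0 tau z) by ring.
    eapply has_sum_ext; [|apply has_sum_scal, (SJ_spec 1); auto; lia].
    intros n; cbv beta; simpl wz; ring.
Qed.
(** The restriction is moved into the coefficients: the one at n = 0 vanishes, so the pole of [sd 0]
    at 0 is never differentiated. *)
Lemma GJ_dtau tau : (0 < Im tau)%R -> cder (fun tau => GJ 0 0 tau) tau (GJ 1 1 tau).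
Proof.
  intros Hy.
  assert (Er : forall (a : Z -> C) n, restr nz (fun _ => 1) n * a n = restr nz a n).
  { intros a n. unfold restr. destruct (excluded_middle_informative _); ring. }
  apply (termwise_dtau _ _ _ (restr nz (fun _ => 1)) (fun _ => 0) tau 0 _ _ (kernel_sd 0 (Nat.le_0_l _)));
    auto.
  - intros n. destruct (Z.eq_dec n 0) as [->|Nn].
    + left. apply restr_out. unfold nz; tauto.
    + right. now apply pt0_nonint.
  - intros n. apply Cmod_restr, Cmod_1_le.
  - intros t Ht. eapply has_sum_ext; [|apply G0_spec; [exact Ht|lia]].
    intros n. rewrite <- Er. ring.
  - eapply has_sum_ext; [|apply (GJ_spec 1 1); auto; lia].
    intros n. rewrite <- Er. simpl wz. ring.
Qed.

Lemma nonint_open w : ~ isint w -> exists r, (0 < r)%R /\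
  forall h, (Cmod h < r)%R -> ~ isint (w + h).
Proof.
  intros H. pose proof (ee_ne1 w H) as N1. apply Cmod_gt_0 in N1.
  destruct (cder_local_lip _ _ _ (cder_ee w)) as [d [Pd Hl]].
  set (K := (Cmod (2 * pii * ee w) + 1)%R) in *.
  assert (PK : (0 < K)%R) by (unfold K; pose proof (Cmod_ge_0 (2 * pii * ee w)); lra).
  exists (Rmin d (Cmod (ee w - 1) / K)). split.
  { apply Rmin_glb_lt; auto. now apply Rdiv_lt_0_compat. }
  intros h Hh I. apply ee_1_iff in I.
  pose proof (Rmin_l d (Cmod (ee w - 1) / K)). pose proof (Rmin_r d (Cmod (ee w - 1) / K)).
  specialize (Hl h ltac:(lra)). rewrite I in Hl.
  rewrite Cmod_sub_sym in Hl.
  assert (K * Cmod h < Cmod (ee w - 1))%R; [|lra].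
  apply Rlt_le_trans with (K * (Cmod (ee w - 1) / K))%R. apply Rmult_lt_compat_l; lra.
  right; field; lra.
Qed.
Lemma dom_iff tau z : dom tau z <-> (0 < Im tau)%R /\ forall n, ~ isint (pt tau z n).
Proof.
  unfold dom, lattice. split; intros [H1 H2]; split; auto.
  - intros n [m E]. apply H2. exists m, (- n)%Z.
    rewrite <- E, opp_IZR, RtoC_opp. unfold pt. ring.
  - intros [m [n E]]. apply (H2 (- n)%Z). exists m. unfold pt.
    rewrite E, opp_IZR, RtoC_opp. ring.
Qed.
(** Large n are handled uniformly by [far_terms] and the remaining ones by [nonint_open]; a change h
    of tau moves the n-th point by n h, hence the radii r1 / zn n. *)
Lemma dom_open tau z : dom tau z -> exists r, (0 < r)%R /\
  forall h, (Cmod h < r)%R -> dom (tau + h) z /\ dom tau (z + h).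
Proof.
  rewrite dom_iff. intros [Hy Hd]. destruct (far_terms tau z Hy) as [N [B [PB H]]].
  assert (fin : forall l : list Z, exists r, (0 < r)%R /\ forall h, (Cmod h < r)%R ->
     forall n, In n l -> ~ isint (pt (tau + h) z n) /\ ~ isint (pt tau (z + h) n)).
  { induction l as [|n l [r [Pr IH]]]. exists 1%R; split; [lra|intros h _ n []].
    destruct (nonint_open _ (Hd n)) as [r1 [P1 H1]].
    pose proof (zn_pos n) as Pz.
    exists (Rmin r (Rmin r1 (r1 / zn n))). split.
    { repeat apply Rmin_glb_lt; auto. now apply Rdiv_lt_0_compat. }
    intros h Hh. pose proof (Rmin_l r (Rmin r1 (r1 / zn n))).
    pose proof (Rmin_r r (Rmin r1 (r1 / zn n))).
    pose proof (Rmin_l r1 (r1 / zn n)). pose proof (Rmin_r r1 (r1 / zn n)).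
    intros m [<-|Hm]; [|apply IH; auto; lra]. split.
    - replace (pt (tau + h) z n) with (pt tau z n + RtoC (IZR n) * h) by (unfold pt; ring).
      apply H1. rewrite Cmod_mult.
      apply Rle_lt_trans with (zn n * Cmod h)%R.
      apply Rmult_le_compat_r; [apply Cmod_ge_0|apply zn_abs].
      apply Rlt_le_trans with (zn n * (r1 / zn n))%R. apply Rmult_lt_compat_l; lra.
      right; field; lra.
    - replace (pt tau (z + h) n) with (pt tau z n + h) by (unfold pt; ring). apply H1. lra. }
  destruct (fin (zrange N)) as [r [Pr Hr]].
  exists (Rmin r (Rmin 1 (Im tau / 2))). split.
  { repeat apply Rmin_glb_lt; lra. }
  intros h Hh. pose proof (Rmin_l r (Rmin 1 (Im tau / 2))).
  pose proof (Rmin_r r (Rmin 1 (Im tau / 2))).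
  pose proof (Rmin_l 1 (Im tau / 2)). pose proof (Rmin_r 1 (Im tau / 2)).
  rewrite !dom_iff. split; split; auto.
  - apply Im_near; lra.
  - intros n. destruct (Z_le_gt_dec (Z.abs n) (Z.of_nat N)) as [L|L].
    + apply (Hr h ltac:(lra)). now apply zrange_In.
    + apply H; [lia| |]. rewrite Cmod_diff_add; lra.
      replace (z - z) with (RtoC 0) by ring. rewrite Cmod_0; lra.
  - intros n. destruct (Z_le_gt_dec (Z.abs n) (Z.of_nat N)) as [L|L].
    + apply (Hr h ltac:(lra)). now apply zrange_In.
    + apply H; [lia| |]; [|rewrite Cmod_diff_add; lra].
      replace (tau - tau) with (RtoC 0) by ring. rewrite Cmod_0; lra.
Qed.

(** * The functions of the statement *)

Lemma E1_eq tau z : dom tau z -> E1 tau z = Es tau z.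
Proof.
  rewrite dom_iff. intros [Hy Hd]. unfold E1.
  rewrite <- (has_sum_sym_lim _ _ (Es_spec tau z Hy)). f_equal. apply functional_extensionality.
  intros N. rewrite !sum_sym_lsum.
  rewrite (lsum_ext _ (fun n => (ct (pt tau z n) + pii * sg n) + -(1) * (pii * sg n))).
  - rewrite lsum_plus. rewrite (lsum_odd_zrange (fun n => -(1) * (pii * sg n))). ring.
    intros m. rewrite sg_opp. ring.
  - intros n _. rewrite <- (cot_expansion (pt tau z n)) by auto.
    replace (Clim_seq (fun M => sum_sym M (fun m => 1 / (z + RtoC (IZR m) + RtoC (IZR n) * tau))))
      with (Clim_seq (fun M => sum_sym M (fun m => 1 / (pt tau z n + RtoC (IZR m))))). ring.
    do 2 f_equal. apply functional_extensionality; intros M. f_equal.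
    apply functional_extensionality; intros m. f_equal. unfold pt. ring.
Qed.

(** * Lattice sums evaluated by rows *)

Lemma summable_off_finite {I} (a : I -> C) (b : I -> R) l0 : NoDup l0 ->
  (forall i, (0 <= b i)%R) -> bdd_sums b ->
  (forall i, ~ In i l0 -> (Cmod (a i) <= b i)%R) -> summable a.
Proof.
  intros N0 Hb [M HM] H. exists (rsum (fun i => Cmod (a i)) l0 + M)%R. intros l Nl.
  destruct (union_list l l0 Nl N0) as [k [Nk [i1 i2]]].
  eapply Rle_trans. apply (rsum_incl _ l k); auto. intros; apply Cmod_ge_0.
  rewrite (rsum_perm _ _ _ (incl_perm _ _ N0 Nk i2)), rsum_app. apply Rplus_le_compat_l.
  eapply Rle_trans; [apply (rsum_le _ b)|apply HM; now apply filt_NoDup].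
  intros i Hi. apply filt_In in Hi. apply H; tauto.
Qed.

(** The row index n comes first, so that [has_sum_fubini] sums over m for fixed n. *)
Definition lw (tau : C) (p : Z * Z) : C := RtoC (IZR (snd p)) + RtoC (IZR (fst p)) * tau.
Definition pnz (p : Z * Z) : Prop := p <> (0%Z, 0%Z).

Lemma lw_Im tau p : Im (lw tau p) = (IZR (fst p) * Im tau)%R.
Proof. unfold lw. destruct tau; simpl; ring. Qed.
Lemma lw_inj tau p p' : (0 < Im tau)%R -> lw tau p = lw tau p' -> p = p'.
Proof.
  intros Hy E. destruct p as [n m], p' as [n' m'].
  assert (En : n = n').
  { apply eq_IZR. apply (f_equal Im) in E. rewrite !lw_Im in E. simpl in E.
    apply Rmult_eq_reg_r in E; lra. }
  subst n'. f_equal. apply eq_IZR, RtoC_inj. unfold lw in E; simpl in E.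
  replace (RtoC (IZR m)) with (RtoC (IZR m) + RtoC (IZR n) * tau - RtoC (IZR n) * tau) by ring.
  rewrite E. ring.
Qed.
Lemma lw_nz tau p : (0 < Im tau)%R -> pnz p -> lw tau p <> 0.
Proof.
  intros Hy Hp E. apply Hp. apply (lw_inj tau); auto. rewrite E. unfold lw; simpl. ring.
Qed.
Lemma lattice_sum_eq tau a s : (0 < Im tau)%R ->
  has_sum (restr pnz (fun p => a (lw tau p))) s -> lattice_sum tau a = s.
Proof.
  intros Hy H. apply sum_over_has_sum.
  apply (has_sum_reindex (lw tau) pnz (restr pnz (fun p => a (lw tau p)))); auto.
  - intros j j' _ _. now apply lw_inj.
  - intros j Hj. now apply restr_out.
  - intros w Hw. apply restr_out. intros [[m [n E]] Hw0].
    apply (Hw (n, m)); [|unfold lw; simpl; auto]. intros E0. inversion E0; subst.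
    apply Hw0. simpl. ring.
  - intros j Hj. rewrite !restr_in; auto. split.
    + exists (snd j), (fst j). reflexivity.
    + now apply lw_nz.
Qed.

Lemma lw_lower tau : (0 < Im tau)%R -> exists c, (0 < c)%R /\ forall p, pnz p ->
  (c * (zn (fst p) + zn (snd p)) <= Cmod (lw tau p))%R.
Proof.
  intros Hy. set (y := Im tau) in *. set (T := Cmod tau).
  assert (HT : (0 <= T)%R) by apply Cmod_ge_0.
  (* |n| is at most W / y and |m| at most W + |n| T. The factor 3 accounts for the two units in zn n
     + zn m, since |n| + |m| >= 1. *)
  exists (/ (3 * (1 + (1 + T) / y)))%R.
  assert (PT : (0 < (1 + T) / y)%R) by (apply Rdiv_lt_0_compat; lra).
  split. { apply Rinv_0_lt_compat; lra. }
  intros [n m] Hp. simpl fst; simpl snd. set (W := Cmod (lw tau (n, m))).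
  assert (H1 : (IZR (Z.abs n) * y <= W)%R).
  { pose proof (Im_le (lw tau (n, m))) as H. rewrite lw_Im, Rabs_mult, <- abs_IZR in H.
    simpl fst in H. fold y in H. rewrite (Rabs_pos_eq y) in H; auto; lra. }
  assert (H2 : (IZR (Z.abs m) <= W + IZR (Z.abs n) * T)%R).
  { pose proof (Cmod_triangle (lw tau (n, m)) (- (RtoC (IZR n) * tau))) as H.
    replace (lw tau (n, m) + - (RtoC (IZR n) * tau)) with (RtoC (IZR m)) in H
      by (unfold lw; simpl; ring).
    rewrite Cmod_opp, Cmod_mult, !Cmod_R, <- !abs_IZR in H. exact H. }
  assert (H3 : (1 <= IZR (Z.abs n) + IZR (Z.abs m))%R).
  { rewrite <- plus_IZR. apply IZR_le. unfold pnz in Hp.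
    destruct (Z.eq_dec n 0) as [->|], (Z.eq_dec m 0) as [->|]; try lia. tauto. }
  assert (Hn : (IZR (Z.abs n) <= W / y)%R).
  { apply Rmult_le_reg_r with y; auto. unfold Rdiv. rewrite Rmult_assoc, Rinv_l; lra. }
  assert (Hs : (IZR (Z.abs n) + IZR (Z.abs m) <= W * (1 + (1 + T) / y))%R).
  { replace (W * (1 + (1 + T) / y))%R with (W + W / y * (1 + T))%R by (field; lra).
    assert (IZR (Z.abs n) * (1 + T) <= W / y * (1 + T))%R by (apply Rmult_le_compat_r; lra). lra. }
  apply Rmult_le_reg_l with (3 * (1 + (1 + T) / y))%R; [lra|].
  rewrite <- Rmult_assoc, Rinv_r, Rmult_1_l by lra. unfold zn. lra.
Qed.

(** A product majorant for cubic decay on the lattice, since zn n + zn m >= sqrt (zn n zn m); each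
    factor is summable by [bdd_sums_32]. *)
Definition b32 (p : Z * Z) : R := (/ sqrt (zn (fst p)) ^ 3 * / sqrt (zn (snd p)) ^ 3)%R.
Lemma s32_pos n : (0 < / sqrt (zn n) ^ 3)%R.
Proof. apply Rinv_0_lt_compat, pow_lt, sqrt_lt_R0, zn_pos. Qed.
Lemma b32_pos p : (0 <= b32 p)%R.
Proof. apply Rmult_le_pos; apply Rlt_le, s32_pos. Qed.
Lemma bdd_b32 : bdd_sums b32.
Proof.
  destruct bdd_sums_32 as [M HM]. assert (0 <= M)%R by (apply (HM nil); constructor).
  apply (bdd_sums_prod _ (fun n => M * / sqrt (zn n) ^ 3)%R).
  - apply b32_pos.
  - intros i l Nl. unfold b32. simpl fst; simpl snd. rewrite rsum_scal, Rmult_comm.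
    apply Rmult_le_compat_r; auto. apply Rlt_le, s32_pos.
  - apply bdd_sums_scal; auto. apply bdd_sums_32.
Qed.
Lemma cube_b32 p : (/ (zn (fst p) + zn (snd p)) ^ 3 <= b32 p)%R.
Proof.
  unfold b32. set (u := sqrt (zn (fst p))). set (v := sqrt (zn (snd p))).
  assert (Pu : (0 < u)%R) by (apply sqrt_lt_R0, zn_pos).
  assert (Pv : (0 < v)%R) by (apply sqrt_lt_R0, zn_pos).
  replace (zn (fst p)) with (u * u)%R by (apply sqrt_sqrt, Rlt_le, zn_pos).
  replace (zn (snd p)) with (v * v)%R by (apply sqrt_sqrt, Rlt_le, zn_pos).
  rewrite <- Rinv_mult, <- Rpow_mult_distr. apply Rinv_le_contravar.
  apply pow_lt; nra. apply pow_incr. split; [nra|]. pose proof (pow2_ge_0 (u - v)). nra.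
Qed.
Lemma lattice_summable tau (a : C -> C) K W : (0 < Im tau)%R -> (0 <= K)%R ->
  (forall w : C, w <> 0 -> (W <= Cmod w)%R -> (Cmod (a w) <= K / Cmod w ^ 3)%R) ->
  summable (restr pnz (fun p => a (lw tau p))).
Proof.
  intros Hy HK Ha. destruct (lw_lower tau Hy) as [c [Pc Hc]].
  destruct (archimed (Rabs W / c)) as [Har _].
  assert (HW : (0 <= Rabs W / c)%R).
  { apply Rmult_le_pos; [apply Rabs_pos|]. now apply Rlt_le, Rinv_0_lt_compat. }
  set (N := Z.to_nat (up (Rabs W / c))).
  assert (HN : (Rabs W / c <= INR N)%R).
  { unfold N. rewrite INR_IZR_INZ, Z2Nat.id; [lra|]. apply le_IZR; lra. }
  apply (summable_off_finite _ (fun p => K / c ^ 3 * b32 p)%R (list_prod (zrange N) (zrange N))).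
  - apply list_prod_NoDup; apply zrange_NoDup.
  - intros p. apply Rmult_le_pos; [|apply b32_pos]. apply Rmult_le_pos; auto.
    apply Rlt_le, Rinv_0_lt_compat, pow_lt; auto.
  - apply bdd_sums_scal; [|apply bdd_b32]. apply Rmult_le_pos; auto.
    apply Rlt_le, Rinv_0_lt_compat, pow_lt; auto.
  - intros p Hp. destruct (classic (pnz p)) as [Np|Np].
    2:{ rewrite restr_out, Cmod_0 by auto. apply Rmult_le_pos; [|apply b32_pos].
        apply Rmult_le_pos; auto. apply Rlt_le, Rinv_0_lt_compat, pow_lt; auto. }
    rewrite restr_in by auto. specialize (Hc p Np).
    set (R := (zn (fst p) + zn (snd p))%R) in *.
    assert (PR : (0 < R)%R) by (unfold R; pose proof (zn_pos (fst p)); pose proof (zn_pos (snd p)); lra).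
    assert (HR : (INR N <= R)%R).
    { destruct p as [n m]. rewrite in_prod_iff, !zrange_In in Hp. unfold R, zn; simpl fst; simpl snd.
      rewrite INR_IZR_INZ.
      assert (0 <= IZR (Z.abs n))%R by (apply IZR_le; lia).
      assert (0 <= IZR (Z.abs m))%R by (apply IZR_le; lia).
      destruct (Z_le_gt_dec (Z.abs n) (Z.of_nat N)).
      - assert (IZR (Z.of_nat N) <= IZR (Z.abs m))%R by (apply IZR_le; lia). lra.
      - assert (IZR (Z.of_nat N) <= IZR (Z.abs n))%R by (apply IZR_le; lia). lra. }
    assert (PcR : (0 < c * R)%R) by now apply Rmult_lt_0_compat.
    eapply Rle_trans; [apply Ha; [now apply lw_nz|]|].
    + pose proof (Rle_abs W). assert (c * (Rabs W / c) <= c * R)%R by (apply Rmult_le_compat_l; lra).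
      replace (c * (Rabs W / c))%R with (Rabs W) in * by (field; lra). lra.
    + apply Rle_trans with (K * / (c * R) ^ 3)%R.
      * unfold Rdiv. apply Rmult_le_compat_l; auto. apply Rinv_le_contravar.
        now apply pow_lt. apply pow_incr; lra.
      * rewrite Rpow_mult_distr, Rinv_mult. unfold Rdiv. rewrite Rmult_assoc.
        apply Rmult_le_compat_l; auto. apply Rmult_le_compat_l.
        apply Rlt_le, Rinv_0_lt_compat, pow_lt; auto. apply cube_b32.
Qed.

(** Row 0 lacks the lattice point 0 and so has its own value [r0]; every other row is a full sum
    over the integers. *)
Lemma lattice_sum_rows tau a r0 (r : Z -> C) t : (0 < Im tau)%R ->
  summable (restr pnz (fun p => a (lw tau p))) ->
  has_sum (restr nz (fun m => a (RtoC (IZR m)))) r0 ->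
  (forall n, n <> 0%Z -> has_sum (fun m => a (RtoC (IZR m) + RtoC (IZR n) * tau)) (r n)) ->
  has_sum (restr nz r) t -> lattice_sum tau a = r0 + t.
Proof.
  intros Hy Sm H0 Hr Ht. destruct (summable_has_sum _ Sm) as [s Hs].
  rewrite (lattice_sum_eq tau a s Hy Hs).
  assert (R : has_sum (fun n => restr (fun n => n = 0%Z) (fun _ => r0) n + restr nz r n) s).
  { apply (has_sum_fubini _ _ _ Hs). intros n. destruct (Z.eq_dec n 0) as [->|Nn].
    - rewrite restr_in, restr_out by (auto; unfold nz; tauto). rewrite Cplus_0_r.
      eapply has_sum_ext; [|exact H0]. intros m. unfold restr, nz, pnz.
      destruct (excluded_middle_informative (m <> 0%Z)) as [Nm|Nm],
        (excluded_middle_informative ((0%Z, m) <> (0%Z, 0%Z))) as [Np|Np]; auto.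
      + unfold lw; simpl. f_equal; ring.
      + exfalso; apply Np; congruence.
      + exfalso; apply Nm; congruence.
    - rewrite restr_out, restr_in by auto. rewrite Cplus_0_l.
      eapply has_sum_ext; [|exact (Hr n Nn)]. intros m. rewrite restr_in; auto.
      unfold pnz; congruence. }
  apply (has_sum_unique _ _ _ R). apply has_sum_plus; auto. apply has_sum_delta.
Qed.

Lemma pt_neg_swap tau n m : RtoC (IZR m) + RtoC (IZR n) * tau = pt tau 0 n + RtoC (IZR m).
Proof. unfold pt; ring. Qed.

Lemma e4_eq tau z : (0 < Im tau)%R ->
  e4 tau z = (pii * pii) * (pii * pii) / 45 + / 6 * GJ 0 2 tau.
Proof.
  intros Hy. unfold e4.
  apply (lattice_sum_rows tau _ _ (fun n => s4 (pt tau 0 n)) _ Hy).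
  - apply (lattice_summable tau (fun w => 1 / w ^ 4) 1 1 Hy); [lra|]. intros w Hw HW.
    unfold Cdiv. rewrite Cmult_1_l, Cmod_inv, Cmod_pow by now apply Cpow_nz.
    unfold Rdiv. rewrite Rmult_1_l. apply Rinv_le_contravar. apply pow_lt; lra.
    apply Rle_pow; auto; lra.
  - eapply has_sum_ext; [|exact zeta4]. intros m. apply restr_ext. intros _.
    unfold Cdiv. now rewrite Cmult_1_l.
  - intros n Hn. eapply has_sum_ext; [|exact (pf4 (pt tau 0 n) (pt0_nonint _ _ Hy Hn))].
    intros m. cbv beta. rewrite pt_neg_swap. unfold Cdiv. now rewrite Cmult_1_l.
  - eapply has_sum_ext; [|exact (has_sum_scal (/ 6) _ _ (G0_spec 2 tau Hy ltac:(lia)))].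
    intros n. cbv beta. unfold restr. destruct (excluded_middle_informative _); [reflexivity|ring].
Qed.

Lemma has_sum_neg (a : Z -> C) s : has_sum a s -> has_sum (fun n => a (- n)%Z) s.
Proof.
  intros H. apply (has_sum_bij Z.opp Z.opp); try (intros; lia).
  eapply has_sum_ext; [|exact H]. intros n; cbv beta. f_equal; lia.
Qed.

(** The lattice sum involves z - w, so row n yields the point of index -n; the sum over n is
    reversed at the end. *)
Lemma wp_SJ tau z : dom tau z ->
  wp tau z = SJ 0 0 tau z + (pii * pii) / 3 - GJ 0 0 tau.
Proof.
  rewrite dom_iff. intros [Hy Hd]. unfold wp.
  set (a := fun w => 1 / (z - w) ^ 2 - 1 / w ^ 2).
  assert (Hz : ~ isint z) by (rewrite <- (pt_0 tau z); auto).
  assert (Nz : z <> 0). { intros ->. apply Hz. now exists 0%Z. }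
  set (r0 := sd 0 z - 1 / z ^ 2 + (pii * pii) / 3).
  rewrite (lattice_sum_rows tau a r0 (fun n => sd 0 (pt tau z (- n)) - sd 0 (pt tau 0 n))
    (SJ 0 0 tau z - sd 0 z - GJ 0 0 tau) Hy).
  - unfold r0. ring.
  (* For |w| >= 2 |z| one has |z - w| >= |w| / 2 and |2 w - z| <= (5/2) |w|, whence the constant 10
     = 4 (5/2). *)
  - apply (lattice_summable tau a (10 * Cmod z) (2 * Cmod z) Hy).
    { pose proof (Cmod_ge_0 z); lra. }
    intros w Hw HW. pose proof (proj1 (Cmod_gt_0 _) Nz) as Pz.
    pose proof (proj1 (Cmod_gt_0 _) Hw) as Pw.
    assert (L : (Cmod w / 2 <= Cmod (z - w))%R).
    { pose proof (Cmod_tri_rev w (- z)) as T. rewrite Cmod_opp in T.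
      replace (w + - z) with (- (z - w)) in T by ring. rewrite Cmod_opp in T. lra. }
    assert (Nzw : z - w <> 0) by (apply Cmod_gt_0; lra).
    unfold a. replace (1 / (z - w) ^ 2 - 1 / w ^ 2) with
      (z * (2 * w - z) * / (w ^ 2 * (z - w) ^ 2)) by (field; auto).
    rewrite !Cmod_mult, Cmod_inv, Cmod_mult, !Cmod_pow
      by (apply Cmult_neq_0; now apply Cpow_nz).
    assert (T : (Cmod (2 * w - z) <= 5 / 2 * Cmod w)%R).
    { eapply Rle_trans; [apply Cmod_triangle|].
      rewrite Cmod_opp, Cmod_mult, Cmod_R, Rabs_pos_eq; lra. }
    apply Rle_trans with (Cmod z * (5 / 2 * Cmod w) * / (Cmod w ^ 2 * (Cmod w / 2) ^ 2))%R.
    2:{ right. field. lra. }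
    apply Rmult_le_compat.
    + apply Rmult_le_pos; apply Cmod_ge_0.
    + apply Rlt_le, Rinv_0_lt_compat, Rmult_lt_0_compat; apply pow_lt; lra.
    + apply Rmult_le_compat_l; lra.
    + apply Rinv_le_contravar. apply Rmult_lt_0_compat; apply pow_lt; lra.
      apply Rmult_le_compat_l. apply pow2_ge_0. apply pow_incr; lra.
  - assert (H1 : has_sum (restr nz (fun m => / (z - RtoC (IZR m)) ^ 2)) (sd 0 z - / z ^ 2)).
    { eapply has_sum_ext; [|exact (has_sum_minus _ _ _ _ (has_sum_neg _ _ (pf2 z Hz))
        (has_sum_delta 0%Z (/ z ^ 2)))].
      intros m. cbv beta. rewrite opp_IZR, RtoC_opp. destruct (Z.eq_dec m 0) as [->|Nm].
      - rewrite restr_in, restr_out by (auto; unfold nz; tauto).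
        replace (z + - RtoC (IZR 0)) with z by (simpl; ring). ring.
      - rewrite restr_out, restr_in by auto. unfold Cminus. ring. }
    replace r0 with (sd 0 z - / z ^ 2 - - (pii * pii) / 3).
    2:{ unfold r0. field; auto. }
    eapply has_sum_ext; [|exact (has_sum_minus _ _ _ _ H1 zeta2)].
    intros m. cbv beta. unfold a, restr, nz. destruct (excluded_middle_informative _).
    unfold Cdiv. ring. ring.
  - intros n Hn. unfold a.
    pose proof (has_sum_minus _ _ _ _ (has_sum_neg _ _ (pf2 (pt tau z (- n)) (Hd _)))
      (pf2 _ (pt0_nonint tau n Hy Hn))) as H1.
    eapply has_sum_ext; [|exact H1]. intros m. cbv beta.
    replace (pt tau z (- n) + RtoC (IZR (- m))) with (z - (RtoC (IZR m) + RtoC (IZR n) * tau)).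
    2:{ unfold pt. rewrite !opp_IZR, !RtoC_opp. ring. }
    rewrite <- pt_neg_swap. unfold Cdiv. ring.
  - pose proof (has_sum_minus _ _ _ _ (has_sum_neg _ _ (S0_spec 0 tau z Hy ltac:(lia)))
      (has_sum_delta 0%Z (sd 0 z))) as H1.
    eapply has_sum_ext; [|exact (has_sum_minus _ _ _ _ H1 (G0_spec 0 tau Hy ltac:(lia)))].
    intros n. cbv beta. destruct (Z.eq_dec n 0) as [->|Nn].
    + rewrite restr_in, !restr_out by (auto; unfold nz; tauto).
      change (- 0)%Z with 0%Z. rewrite pt_0. ring.
    + rewrite restr_out, !restr_in by auto. ring.
Qed.

(** * The q-expansion of [e2] *)

Lemma exp_decay_gen t : (0 < t)%R -> (exp (- t) <= 8 ^ 8 / t ^ 8)%R.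
Proof.
  intros Ht. rewrite exp_Ropp.
  replace (8 ^ 8 / t ^ 8)%R with (/ (t / 8) ^ 8)%R by (field; lra).
  apply Rinv_le_contravar. apply pow_lt; lra.
  replace t with (INR 8 * (t / 8))%R at 2 by (simpl; field).
  rewrite exp_nat_mult. apply pow_incr. pose proof (exp_ineq1_le (t / 8)). lra.
Qed.
Lemma ee_nat_mult (k : nat) tau : ee (RtoC (INR k) * tau) = ee tau ^ k.
Proof.
  induction k. simpl. rewrite Cmult_0_l. unfold ee. rewrite Cmult_0_r. apply Cexp_0.
  rewrite S_INR, RtoC_plus, Cmult_plus_distr_r, ee_add, IHk, Cmult_1_l. simpl. ring.
Qed.
Lemma Im_Rmul (r : R) t : Im (RtoC r * t) = (r * Im t)%R.
Proof. destruct t; simpl; ring. Qed.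
Lemma Cmod_q_pow tau (k : nat) : (0 < Im tau)%R -> (0 < k)%nat ->
  (Cmod (ee tau ^ k) <= 8 ^ 8 / (2 * PI * Im tau) ^ 8 / INR k ^ 8)%R.
Proof.
  intros Hy Hk. pose proof PI_RGT_0 as HP. apply lt_0_INR in Hk.
  rewrite <- ee_nat_mult, Cmod_ee.
  rewrite Im_Rmul.
  assert (P2 : (0 < 2 * PI * Im tau)%R) by (apply Rmult_lt_0_compat; lra).
  assert (P3 : (0 < 2 * PI * (INR k * Im tau))%R).
  { replace (2 * PI * (INR k * Im tau))%R with (2 * PI * Im tau * INR k)%R by ring.
    now apply Rmult_lt_0_compat. }
  eapply Rle_trans; [now apply exp_decay_gen|]. right. field. repeat split; lra.
Qed.

Lemma has_sum_nat_shift (a : nat -> C) s : has_sum a s ->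
  has_sum (fun d => match d with O => RtoC 0 | S d' => a d' end) s.
Proof.
  apply (has_sum_reindex S (fun _ => True)); auto; try tauto.
  intros [|i] Hi; auto. exfalso; apply (Hi i); auto.
Qed.
Lemma has_sum_nat_first (a : nat -> C) s : has_sum (fun d => a (S d)) s ->
  has_sum a (a O + s).
Proof.
  intros H. pose proof (has_sum_plus _ _ _ _ (has_sum_delta O (a O)) (has_sum_nat_shift _ _ H)) as H1.
  eapply has_sum_ext; [|exact H1]. intros [|d]; cbv beta.
  rewrite restr_in by auto. ring. rewrite restr_out by auto. ring.
Qed.
Lemma Cmult_cancel (c a b : C) : c <> 0 -> c * a = c * b -> a = b.
Proof.
  intros H E. replace a with (/ c * (c * a)) by (field; auto). rewrite E. field; auto.
Qed.
(** Shifting the index gives T = x + x T for the geometric series and U - x U = T for the sum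
    sought: two linear equations. *)
Lemma geom_deriv_sum (x : C) : x <> 1 ->
  summable (fun d : nat => x ^ S d) -> summable (fun d : nat => RtoC (INR (S d)) * x ^ S d) ->
  has_sum (fun d : nat => RtoC (INR (S d)) * x ^ S d) (x / ((x - 1) * (x - 1))).
Proof.
  intros Hx S1 S2. destruct (summable_has_sum _ S1) as [T HT].
  destruct (summable_has_sum _ S2) as [U HU].
  assert (N1 : x - 1 <> 0). { intros E. apply Hx. now apply Csub_0. }
  assert (E1 : T = x ^ 1 + x * T).
  { apply (has_sum_unique _ _ _ HT).
    apply (has_sum_nat_first (fun d => x ^ S d)).
    eapply has_sum_ext; [|exact (has_sum_scal x _ _ HT)]. intros d; reflexivity. }
  assert (E2 : U - x * U = T).
  { refine (has_sum_unique _ _ _ (has_sum_minus _ _ _ _ HU (has_sum_nat_shift _ _ (has_sum_scal x _ _ HU))) _).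
    eapply has_sum_ext; [|exact HT]. intros [|d]; cbv beta.
    - simpl. ring.
    - rewrite (S_INR (S d)), RtoC_plus. rewrite !(Cpow_S x (S d)). ring. }
  replace U with (x / ((x - 1) * (x - 1))) in HU; auto.
  assert (ET : (x - 1) * T = - x).
  { replace ((x - 1) * T) with (x * T - T) by ring. rewrite E1 at 2. ring. }
  apply (Cmult_cancel ((x - 1) * (x - 1))); [now apply Cmult_neq_0|].
  replace ((x - 1) * (x - 1) * U) with (- ((x - 1) * (U - x * U))) by ring.
  rewrite E2, ET. field; auto.
Qed.

Lemma q_ne1 tau n : (0 < Im tau)%R -> ee tau ^ S n <> 1.
Proof.
  intros Hy E. rewrite <- ee_nat_mult in E. apply ee_1_iff, isint_Im in E.
  rewrite Im_Rmul in E.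
  pose proof (lt_0_INR (S n) ltac:(lia)). apply Rmult_integral in E. lra.
Qed.
Lemma zn_of_nat n : zn (Z.of_nat n) = INR (S n).
Proof. rewrite zn_nat, Zabs2Nat.id, S_INR. ring. Qed.
Lemma q_terms tau : (0 < Im tau)%R -> exists B, (0 < B)%R /\ forall n d : nat,
  (Cmod (RtoC (INR (S d)) * ee tau ^ (S n * S d)) <= B / (zn (Z.of_nat n) ^ 2 * zn (Z.of_nat d) ^ 2))%R.
Proof.
  intros Hy. pose proof PI_RGT_0 as HP.
  assert (P2 : (0 < 2 * PI * Im tau)%R) by (apply Rmult_lt_0_compat; lra).
  exists (8 ^ 8 / (2 * PI * Im tau) ^ 8)%R. split.
  { apply Rdiv_lt_0_compat; [lra|]. now apply pow_lt. }
  intros n d. set (B := (8 ^ 8 / _)%R).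
  assert (PB : (0 < B)%R). { apply Rdiv_lt_0_compat; [lra|]. now apply pow_lt. }
  rewrite Cmod_mult, Cmod_R, Rabs_pos_eq by apply pos_INR.
  assert (Hp := Cmod_q_pow tau (S n * S d) Hy ltac:(lia)). fold B in Hp.
  rewrite mult_INR in Hp. rewrite !zn_of_nat.
  assert (Pn : (1 <= INR (S n))%R) by (rewrite S_INR; pose proof (pos_INR n); lra).
  assert (Pd : (1 <= INR (S d))%R) by (rewrite S_INR; pose proof (pos_INR d); lra).
  set (u := INR (S n)) in *. set (v := INR (S d)) in *. clearbody u v B.
  eapply Rle_trans; [apply Rmult_le_compat_l; [lra|exact Hp]|].
  replace (v * (B / (u * v) ^ 8))%R with (B * / (u ^ 8 * v ^ 7))%R by (field; lra).
  unfold Rdiv. apply Rmult_le_compat_l; [lra|]. apply Rinv_le_contravar.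
  { apply Rmult_lt_0_compat; apply pow_lt; lra. }
  apply Rmult_le_compat; try apply pow2_ge_0; apply Rle_pow; auto; lia.
Qed.
Lemma summable_nat2 (a : nat * nat -> C) B :
  (forall n d, (Cmod (a (n, d)) <= B / (zn (Z.of_nat n) ^ 2 * zn (Z.of_nat d) ^ 2))%R) -> summable a.
Proof.
  intros H.
  set (a' := fun p : Z * Z => restr (fun p => (0 <= fst p)%Z /\ (0 <= snd p)%Z)
     (fun p => a (Z.to_nat (fst p), Z.to_nat (snd p))) p).
  assert (HB : (0 <= B)%R).
  { specialize (H 0%nat 0%nat). pose proof (Cmod_ge_0 (a (0%nat, 0%nat))). unfold zn in H.
    simpl in H. rewrite Rplus_0_r, !Rmult_1_r in H. lra. }
  assert (Sm : summable a').
  { apply (summable2 _ B). intros m k. unfold a', restr; simpl fst; simpl snd.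
    destruct (excluded_middle_informative _) as [[Hm Hk]|_].
    - eapply Rle_trans; [apply H|]. rewrite !Z2Nat.id by auto. lra.
    - rewrite Cmod_0. apply Rmult_le_pos; auto. apply Rlt_le, Rinv_0_lt_compat, Rmult_lt_0_compat;
        apply pow_lt, zn_pos. }
  apply (bdd_sums_inj (fun p : nat * nat => (Z.of_nat (fst p), Z.of_nat (snd p)))) in Sm.
  - eapply bdd_sums_le; [|exact Sm]. intros [n d]. simpl. unfold a'.
    rewrite restr_in by (simpl; lia). simpl fst; simpl snd. rewrite !Nat2Z.id. lra.
  - intros [n d] [n' d'] E. simpl in E. inversion E. f_equal; lia.
Qed.

(** A bridge from MathComp's boolean membership, [uniq] and divisibility to propositions on
    lists. *)
Lemma divisors_spec n : NoDup (prime.divisors (S n)) /\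
  forall d, In d (prime.divisors (S n)) <-> exists e, (e * d = S n)%nat.
Proof.
  set (T := ssrnat.Datatypes_nat__canonical__eqtype_Equality).
  assert (mem : forall (s : list nat) d, @seq.mem_seq T s d = true <-> In d s).
  { induction s as [|x s IH]; intros d.
    - split; [discriminate|intros []].
    - simpl. rewrite Bool.orb_true_iff, IH.
      destruct (@eqtype.eqP T d x) as [->|N]; simpl; intuition congruence. }
  split.
  - pose proof (prime.divisors_uniq (S n)) as U. revert U. generalize (prime.divisors (S n)).
    induction l as [|x l IH]; intros U; constructor;
      change ((negb (@seq.mem_seq T l x) && @seq.uniq T l)%bool = true) in U;
      apply andb_prop in U; destruct U as [U1 U2]; auto.
    intros I. apply mem in I. rewrite I in U1. discriminate.
  - intros d. apply iff_trans with (1 := iff_sym (mem (prime.divisors (S n)) d)).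
    pose proof (@prime.dvdn_divisors d (S n) eq_refl) as D.
    change (div.dvdn d (S n) = @seq.mem_seq T (prime.divisors (S n)) d) in D.
    rewrite <- D. destruct (@div.dvdnP d (S n)) as [H|H].
    + split; auto. intros _. destruct H as [e E]. exists e. now rewrite E.
    + split; [discriminate|]. intros [e E]. exfalso. apply H. exists e. now rewrite <- E.
Qed.
Lemma sumn_lsum (l : list nat) (x : C) :
  lsum (fun d => RtoC (INR d) * x) l = RtoC (INR (seq.sumn l)) * x.
Proof.
  induction l; simpl. ring. rewrite IHl.
  change (ssrnat.addn a (seq.foldr ssrnat.addn 0%nat l)) with (a + seq.sumn l)%nat.
  rewrite plus_INR, RtoC_plus. unfold seq.sumn. ring.
Qed.

(** The double series of d q^(n d) over n, d >= 1 is summed over d by [geom_deriv_sum]; grouped by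
    the product n d, it gives the divisor sums. *)
Lemma lambert tau h : (0 < Im tau)%R ->
  has_sum (fun n : nat => ee tau ^ S n / ((ee tau ^ S n - 1) * (ee tau ^ S n - 1))) h ->
  has_sum (fun n => RtoC (INR (sigma1 (S n))) * ee tau ^ S n) h.
Proof.
  intros Hy Hh. set (q := ee tau) in *. destruct (q_terms tau Hy) as [B [PB HB]]. fold q in HB.
  set (a := fun p : nat * nat => RtoC (INR (S (snd p))) * q ^ (S (fst p) * S (snd p))).
  assert (Sa : summable a) by (apply (summable_nat2 _ B); intros; apply HB).
  destruct (summable_has_sum a Sa) as [t Ht].
  replace h with t.
  - apply (has_sum_fibers (fun p : nat * nat => (S (fst p) * S (snd p) - 1)%nat) a _ t Ht).
    intros N. destruct (divisors_spec N) as [Nd Hd].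
    (* The pairs of factors of N + 1, both stored less 1. *)
    set (L := map (fun d => ((S N / d - 1)%nat, (d - 1)%nat)) (prime.divisors (S N))).
    assert (Hdp : forall d, In d (prime.divisors (S N)) -> (d <> 0 /\ S N / d * d = S N /\ S N / d <> 0)%nat).
    { intros d I. apply Hd in I. destruct I as [e E].
      assert (d <> 0)%nat by (intros ->; lia).
      assert (S N / d = e)%nat by (rewrite <- E; now apply Nat.div_mul).
      split; auto. split; [congruence|]. intros E0. rewrite H0 in E0. subst e. lia. }
    replace (RtoC (INR (sigma1 (S N))) * q ^ S N) with
      (lsum (restr (fun p : nat * nat => (S (fst p) * S (snd p) - 1)%nat = N) a) L).
    + apply has_sum_finite.
      * assert (G : forall l, NoDup l -> (forall d, In d l -> d <> 0%nat) ->
          NoDup (map (fun d => ((S N / d - 1)%nat, (d - 1)%nat)) l)).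
        { induction 1; simpl; intros Hl; constructor; auto. rewrite in_map_iff.
          intros [y [E Hy']]. assert (y - 1 = x - 1)%nat by congruence.
          pose proof (Hl y (or_intror Hy')). pose proof (Hl x (or_introl eq_refl)).
          assert (y = x) by lia. congruence. }
        apply G; auto. intros d I; now apply Hdp.
      * intros [n d] Hi. apply restr_out. simpl fst; simpl snd. intros E. apply Hi.
        unfold L. apply in_map_iff. exists (S d).
        assert (E' : (S n * S d)%nat = S N) by lia.
        split.
        -- rewrite <- E', Nat.div_mul by lia. f_equal; lia.
        -- apply Hd. exists (S n). exact E'.
    + unfold L. rewrite lsum_map. unfold sigma1. rewrite <- sumn_lsum. apply lsum_ext.
      intros d I. destruct (Hdp d I) as [H1 [H2 H3]].
      assert (E1 : S (S N / d - 1) = (S N / d)%nat) by lia.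
      assert (E2 : S (d - 1) = d) by lia.
      rewrite restr_in.
      * unfold a. simpl fst; simpl snd. rewrite E1, E2, H2. reflexivity.
      * simpl fst; simpl snd. rewrite E1, E2, H2. lia.
  - symmetry. refine (has_sum_unique _ _ _ Hh _).
    apply (has_sum_fubini a); auto. intros n.
    assert (Hb : forall d, (Cmod (RtoC (INR (S d)) * (q ^ S n) ^ S d) <= B / (zn (Z.of_nat n) ^ 2 * zn (Z.of_nat d) ^ 2))%R).
    { intros d. rewrite <- Cpow_mult_r. apply HB. }
    assert (Sb : bdd_sums (fun d : nat => B / (zn (Z.of_nat n) ^ 2 * zn (Z.of_nat d) ^ 2))%R).
    { apply (bdd_sums_inj Z.of_nat (fun d => B / (zn (Z.of_nat n) ^ 2 * zn d ^ 2))%R).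
      intros; lia. eapply bdd_sums_le; [|apply (bdd_sums_scal (B / zn (Z.of_nat n) ^ 2))].
      2:{ apply Rmult_le_pos; [lra|]. apply Rlt_le, Rinv_0_lt_compat, pow_lt, zn_pos. }
      2:{ apply (bdd_sums_pow 2 (le_n _)). }
      intros d. right. pose proof (zn_pos (Z.of_nat n)). pose proof (zn_pos d). field. lra. }
    eapply has_sum_ext; [|apply (geom_deriv_sum (q ^ S n))].
    + intros d. unfold a. simpl fst; simpl snd. now rewrite Cpow_mult_r.
    + now apply q_ne1.
    + eapply bdd_sums_le; [|exact Sb]. intros d. eapply Rle_trans; [|apply Hb]. cbv beta.
      rewrite Cmod_mult, Cmod_R, Rabs_pos_eq by apply pos_INR.
      rewrite <- (Rmult_1_l (Cmod _)) at 1. apply Rmult_le_compat_r; [apply Cmod_ge_0|].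
      rewrite S_INR. pose proof (pos_INR d). lra.
    + eapply bdd_sums_le; [|exact Sb]. intros d. apply Hb.
Qed.

(** [sd 0] is even and equals 4 pii^2 q^n / (q^n - 1)^2 at n tau, so [GJ 0 0] is 8 pii^2 times the
    Lambert series; 8 pii^2 is the factor -24 pi^2 / 3 in [e2]. *)
Lemma e2_eq tau z : (0 < Im tau)%R -> e2 tau z = GJ 0 0 tau - (pii * pii) / 3.
Proof.
  intros Hy. pose proof (G0_spec 0 tau Hy ltac:(lia)) as HG.
  set (s := fun n : nat => sd 0 (pt tau 0 (Z.of_nat (S n)))).
  destruct (point_terms tau 0 Hy) as [B [PB HB]].
  assert (Ss : summable s).
  { eapply bdd_sums_le; [intros n; apply HB; lia|].
    apply (bdd_sums_inj (fun n : nat => Z.of_nat (S n)) (fun n => B / zn n ^ 8)%R).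
    intros; lia. apply bdd_sums_scal; [lra|]. apply bdd_sums_pow; lia. }
  destruct (summable_has_sum s Ss) as [h Hh].
  assert (EG : GJ 0 0 tau = 2 * h).
  { apply (has_sum_unique _ _ _ HG).
    assert (Hp : has_sum (restr (fun n => (0 < n)%Z) (fun n => sd 0 (pt tau 0 n))) h).
    { apply (has_sum_reindex (fun n : nat => Z.of_nat (S n)) (fun _ => True) s); auto; try tauto.
      - intros; lia.
      - intros i Hi. apply restr_out. intros L. apply (Hi (Z.to_nat (i - 1))); auto. lia.
      - intros j _. rewrite restr_in by lia. reflexivity. }
    replace (2 * h) with (h + h) by ring.
    eapply has_sum_ext; [|exact (has_sum_plus _ _ _ _ Hp (has_sum_neg _ _ Hp))].
    intros n. cbv beta. destruct (Z.eq_dec n 0) as [->|Nn].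
    - rewrite !restr_out by (unfold nz; lia). ring.
    - rewrite (restr_in nz) by auto. destruct (Z_lt_le_dec 0 n).
      + rewrite restr_in, restr_out by lia. ring.
      + rewrite restr_out, restr_in by lia. rewrite pt_opp, sd0_opp. ring. }
  pose proof pii_nz as NP.
  assert (Hl : has_sum (fun n => RtoC (INR (sigma1 (S n))) * ee tau ^ S n) (/ (4 * (pii * pii)) * h)).
  { apply lambert; auto. eapply has_sum_ext; [|exact (has_sum_scal (/ (4 * (pii * pii))) _ _ Hh)].
    intros n. cbv beta. unfold s. rewrite sd0_ee by (apply pt0_nonint; auto; lia).
    replace (ee (pt tau 0 (Z.of_nat (S n)))) with (ee tau ^ S n).
    2:{ rewrite <- ee_nat_mult. f_equal. unfold pt. rewrite INR_IZR_INZ. ring. }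
    assert (N1 : ee tau ^ S n - 1 <> 0).
    { intros E. apply (q_ne1 tau n Hy). now apply Csub_0. }
    field. auto. }
  unfold e2.
  replace (Clim_seq _) with (/ (4 * (pii * pii)) * h).
  - rewrite EG. replace (RtoC PI ^ 2) with (- (pii * pii)) by (rewrite pii_sq; ring). field. auto.
  - rewrite <- (has_sum_nat_lim _ _ Hl). do 2 f_equal. apply functional_extensionality. intros n.
    f_equal. rewrite <- ee_nat_mult. unfold ee. f_equal. unfold pii. ring.
Qed.

(** * The derivatives of the generators *)

Definition ztau : C := RtoC PI / (2 * Ci).
Lemma ztau_eq : ztau = - (pii / 2).
Proof. unfold ztau, pii. pose proof Ci_nz. pose proof Ci_sq as E.
  apply (Cmult_cancel Ci); auto. replace (Ci * - (RtoC PI * Ci / 2)) with (- (RtoC PI * (Ci * Ci) / 2)) by field.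
  rewrite E. field. auto. Qed.

(** An identity on [dom] may be differentiated in z, because [dom] is open. *)
Lemma cder_unique_dom_z (f g : C -> C) tau z l m : dom tau z ->
  (forall w, dom tau w -> f w = g w) -> cder f z l -> cder g z m -> l = m.
Proof.
  intros Hd E Hf Hg. destruct (dom_open _ _ Hd) as [r [Pr Hr]].
  apply (cder_unique g z); auto. apply (cder_ext_loc f g z l r Pr); auto.
  intros h Hh. apply E, Hr; auto.
Qed.
Lemma cder_dom_tau (f g : fn) tau z l : dom tau z -> eqD f g ->
  cder (fun t => f t z) tau l -> cder (fun t => g t z) tau l.
Proof.
  intros Hd E Hf. destruct (dom_open _ _ Hd) as [r [Pr Hr]].
  apply (cder_ext_loc (fun t => f t z) _ tau l r Pr); auto.
  intros h Hh. apply E, Hr; auto.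
Qed.
Lemma cder_dom_z (f g : fn) tau z l : dom tau z -> eqD f g ->
  cder (f tau) z l -> cder (g tau) z l.
Proof.
  intros Hd E Hf. destruct (dom_open _ _ Hd) as [r [Pr Hr]].
  apply (cder_ext_loc (f tau) _ z l r Pr); auto.
  intros h Hh. apply E, Hr; auto.
Qed.

Definition e2c (tau : C) : C := GJ 0 0 tau - (pii * pii) / 3.
Definition e4c (tau : C) : C := (pii * pii) * (pii * pii) / 45 + / 6 * GJ 0 2 tau.

Lemma wp_eq : eqD (fun tau z => SJ 0 0 tau z - e2c tau) wp.
Proof. intros tau z H. rewrite wp_SJ by auto. unfold e2c. ring. Qed.
Lemma e2_eqD : eqD (fun tau _ => e2c tau) e2.
Proof. intros tau z H. symmetry. now apply e2_eq, (proj1 H). Qed.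
Lemma e4_eqD : eqD (fun tau _ => e4c tau) e4.
Proof. intros tau z H. symmetry. now apply e4_eq, (proj1 H). Qed.
Lemma E1_eqD : eqD Es E1.
Proof. intros tau z H. symmetry. now apply E1_eq. Qed.

Lemma cder_wp_z tau z : dom tau z -> cder (wp tau) z (SJ 0 1 tau z).
Proof.
  intros H. apply (cder_dom_z _ _ _ _ _ H wp_eq). apply dom_iff in H as [Hy Hd].
  eapply cder_eq; [|apply cder_minus; [apply SJ_dz; auto|apply cder_const]]. ring.
Qed.
Lemma wp1_eq : eqD (SJ 0 1) (dz wp).
Proof. intros tau z H. symmetry. unfold dz. now apply cder_C_derive, cder_wp_z. Qed.

Lemma GJ11_eq tau : (0 < Im tau)%R -> 2 * pii * GJ 1 1 tau = 5 * e4c tau - e2c tau * e2c tau.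
Proof. intros Hy. rewrite G_square by auto. unfold e4c, e2c. field. Qed.
(** As [SJ 0 0 - e2c] is wp, this is its second-order differential equation. *)
Lemma SJ02_eq tau z : dom tau z -> SJ 0 2 tau z =
  6 * ((SJ 0 0 tau z - e2c tau) * (SJ 0 0 tau z - e2c tau)) - 30 * e4c tau.
Proof.
  intros H. apply dom_iff in H as [Hy Hd]. rewrite S_square by auto.
  replace (12 * pii * GJ 1 1 tau) with (6 * (2 * pii * GJ 1 1 tau)) by ring.
  rewrite GJ11_eq by auto. unfold e2c. field.
Qed.
Lemma SJ03_eq tau z : dom tau z -> SJ 0 3 tau z =
  12 * ((SJ 0 0 tau z - e2c tau) * SJ 0 1 tau z).
Proof.
  intros H. pose proof H as H'. apply dom_iff in H' as [Hy Hd].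
  apply (cder_unique_dom_z (SJ 0 2 tau) (fun w =>
   6 * ((SJ 0 0 tau w - e2c tau) * (SJ 0 0 tau w - e2c tau)) - 30 * e4c tau) tau z); auto.
  - intros w Hw. now apply SJ02_eq.
  - apply SJ_dz; auto.
  - assert (D : cder (fun w => SJ 0 0 tau w - e2c tau) z (SJ 0 1 tau z - 0)).
    { apply cder_minus; [apply SJ_dz; auto|apply cder_const]. }
    eapply cder_eq; [|apply cder_minus; [apply cder_scal, cder_mult; exact D|apply cder_const]].
    cbv beta. ring.
Qed.
(** The heat equation for E1, whose tau-derivative is - [SJ 1 0]. Its successive z-derivatives give
    [SJ 1 1], [SJ 1 2] and [SJ 1 3], the tau-derivatives of [SJ 0 0], [SJ 0 1] and [SJ 0 2]. *)
Lemma SJ10_eq tau z : dom tau z ->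
  4 * pii * SJ 1 0 tau z = 2 * (Es tau z * SJ 0 0 tau z) + SJ 0 1 tau z.
Proof. intros H. apply dom_iff in H as [Hy Hd]. rewrite Es_mul_S by auto. ring. Qed.
Lemma SJ11_eq tau z : dom tau z ->
  4 * pii * SJ 1 1 tau z = 2 * (Es tau z * SJ 0 1 tau z - SJ 0 0 tau z * SJ 0 0 tau z) + SJ 0 2 tau z.
Proof.
  intros H. pose proof H as H'. apply dom_iff in H' as [Hy Hd].
  apply (cder_unique_dom_z (fun w => 4 * pii * SJ 1 0 tau w) (fun w =>
    2 * (Es tau w * SJ 0 0 tau w) + SJ 0 1 tau w) tau z); auto.
  - intros w Hw. now apply SJ10_eq.
  - apply cder_scal, SJ_dz; auto.
  - eapply cder_eq; [|apply cder_plus; [apply cder_scal, cder_mult;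
      [apply Es_dz; auto|apply SJ_dz; auto]|apply SJ_dz; auto]].
    cbv beta. ring.
Qed.
Lemma SJ12_eq tau z : dom tau z ->
  4 * pii * SJ 1 2 tau z = 2 * (Es tau z * SJ 0 2 tau z - 3 * (SJ 0 0 tau z * SJ 0 1 tau z)) + SJ 0 3 tau z.
Proof.
  intros H. pose proof H as H'. apply dom_iff in H' as [Hy Hd].
  apply (cder_unique_dom_z (fun w => 4 * pii * SJ 1 1 tau w) (fun w =>
    2 * (Es tau w * SJ 0 1 tau w - SJ 0 0 tau w * SJ 0 0 tau w) + SJ 0 2 tau w) tau z); auto.
  - intros w Hw. now apply SJ11_eq.
  - apply cder_scal, SJ_dz; auto.
  - eapply cder_eq; [|apply cder_plus; [apply cder_scal, cder_minus; [apply cder_mult;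
      [apply Es_dz; auto|apply SJ_dz; auto]|apply cder_mult; apply SJ_dz; auto]|apply SJ_dz; auto]].
    cbv beta. ring.
Qed.
(** [SJ 0 3] is replaced by its closed form before differentiation, because [SJ_dz] stops at j =
    2. *)
Lemma SJ13_eq tau z : dom tau z ->
  4 * pii * SJ 1 3 tau z = 2 * (Es tau z * SJ 0 3 tau z - 4 * (SJ 0 0 tau z * SJ 0 2 tau z)
     - 3 * (SJ 0 1 tau z * SJ 0 1 tau z))
   + 12 * ((SJ 0 0 tau z - e2c tau) * SJ 0 2 tau z + SJ 0 1 tau z * SJ 0 1 tau z).
Proof.
  intros H. pose proof H as H'. apply dom_iff in H' as [Hy Hd].
  apply (cder_unique_dom_z (fun w => 4 * pii * SJ 1 2 tau w) (fun w =>
    2 * (Es tau w * SJ 0 2 tau w - 3 * (SJ 0 0 tau w * SJ 0 1 tau w)) +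
    12 * ((SJ 0 0 tau w - e2c tau) * SJ 0 1 tau w)) tau z); auto.
  - intros w Hw. rewrite SJ12_eq, SJ03_eq by auto. reflexivity.
  - apply cder_scal, SJ_dz; auto.
  - eapply cder_eq; [|apply cder_plus; [apply cder_scal, cder_minus; [apply cder_mult;
      [apply Es_dz; auto|apply SJ_dz; auto]|apply cder_scal, cder_mult; apply SJ_dz; auto]|
      apply cder_scal, cder_mult; [apply cder_minus; [apply SJ_dz; auto|apply cder_const]|
        apply SJ_dz; auto]]].
    cbv beta. ring.
Qed.

(* Besides [dtau f = l] this records that [f] is differentiable in [tau], which [C_derive] does
   not guarantee. *)
Definition dtau_is (f l : fn) : Prop :=
  forall tau z, dom tau z -> exists l', cder (fun t => f t z) tau l' /\ l tau z = ztau * l'.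
Lemma dtau_is_eq f l : dtau_is f l -> eqD (dtau f) l.
Proof.
  intros H tau z Hd. destruct (H tau z Hd) as [l' [H1 H2]]. unfold dtau.
  rewrite (cder_C_derive _ _ _ H1). now rewrite H2.
Qed.

(** The formulas for the generators of JS0 are arranged as weight times e2 / 4 times the generator
    plus an element of JS0, the shape that [hom_dtau] needs. *)
Lemma dtau_E1 : dtau_is E1 (fun tau z =>
  e2 tau z / 4 * E1 tau z + (/ 4 * (E1 tau z * wp tau z) + / 8 * dz wp tau z)).
Proof.
  intros tau z H. exists (- SJ 1 0 tau z). split.
  - apply (cder_dom_tau _ _ _ _ _ H E1_eqD). apply dom_iff in H as [Hy Hd]. now apply Es_dtau.
  - rewrite <- (e2_eqD tau z H), <- (E1_eqD tau z H), <- (wp_eq tau z H), <- (wp1_eq tau z H).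
    rewrite ztau_eq.
    replace (- (pii / 2) * - SJ 1 0 tau z) with (/ 8 * (4 * pii * SJ 1 0 tau z)) by field.
    rewrite SJ10_eq by auto. field.
Qed.
Lemma dtau_e2 : dtau_is e2 (fun tau z => (e2 tau z * e2 tau z - 5 * e4 tau z) / 4).
Proof.
  intros tau z H. exists (GJ 1 1 tau). split.
  - apply (cder_dom_tau _ _ _ _ _ H e2_eqD).
    eapply cder_eq; [|apply cder_minus; [apply GJ_dtau, (proj1 H)|apply cder_const]]. ring.
  - rewrite <- (e2_eqD tau z H), <- (e4_eqD tau z H), ztau_eq.
    replace (- (pii / 2) * GJ 1 1 tau) with (- / 4 * (2 * pii * GJ 1 1 tau)) by field.
    rewrite GJ11_eq by apply (proj1 H). field.
Qed.
Lemma wp_cder_tau tau z : dom tau z ->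
  cder (fun t => SJ 0 0 t z - e2c t) tau (SJ 1 1 tau z - GJ 1 1 tau).
Proof.
  intros H. apply dom_iff in H as [Hy Hd].
  apply cder_minus. apply SJ_dtau; auto.
  eapply cder_eq; [|apply cder_minus; [apply GJ_dtau; auto|apply cder_const]]. ring.
Qed.
Lemma dtau_wp : dtau_is wp (fun tau z => 2 * (e2 tau z / 4) * wp tau z +
  / 4 * (-(2) * (wp tau z * wp tau z) - E1 tau z * dz wp tau z + 20 * e4 tau z)).
Proof.
  intros tau z H. exists (SJ 1 1 tau z - GJ 1 1 tau). split.
  - apply (cder_dom_tau _ _ _ _ _ H wp_eq). now apply wp_cder_tau.
  - rewrite <- (e2_eqD tau z H), <- (e4_eqD tau z H), <- (E1_eqD tau z H), <- (wp_eq tau z H), <- (wp1_eq tau z H), ztau_eq.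
    replace (- (pii / 2) * (SJ 1 1 tau z - GJ 1 1 tau)) with
     (- / 8 * (4 * pii * SJ 1 1 tau z) + / 4 * (2 * pii * GJ 1 1 tau)) by field.
    rewrite SJ11_eq, SJ02_eq, GJ11_eq by (auto; apply (proj1 H)). field.
Qed.
Lemma dtau_wp1 : dtau_is (dz wp) (fun tau z => 3 * (e2 tau z / 4) * dz wp tau z +
  / 4 * (-(3) * (wp tau z * dz wp tau z) - E1 tau z * (6 * (wp tau z * wp tau z) - 30 * e4 tau z))).
Proof.
  intros tau z H. exists (SJ 1 2 tau z). split.
  - apply (cder_dom_tau _ _ _ _ _ H wp1_eq). apply dom_iff in H as [Hy Hd]. apply SJ_dtau; auto.
  - rewrite <- (e2_eqD tau z H), <- (e4_eqD tau z H), <- (E1_eqD tau z H), <- (wp_eq tau z H), <- (wp1_eq tau z H), ztau_eq.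
    replace (- (pii / 2) * SJ 1 2 tau z) with (- / 8 * (4 * pii * SJ 1 2 tau z)) by field.
    rewrite SJ12_eq, SJ03_eq, SJ02_eq by auto. field.
Qed.
(* [e4] is recovered from the differential equation [wp'' = 6 wp^2 - 30 e4]. *)
Lemma dtau_e4 : dtau_is e4 (fun tau z => 4 * (e2 tau z / 4) * e4 tau z +
  / 40 * (dz wp tau z * dz wp tau z - 4 * (wp tau z * (wp tau z * wp tau z)) + 60 * (e4 tau z * wp tau z))).
Proof.
  intros tau z H. set (W := SJ 0 0 tau z - e2c tau).
  exists (/ 30 * (12 * (W * (SJ 1 1 tau z - GJ 1 1 tau)) - SJ 1 3 tau z)). split.
  - apply (cder_dom_tau (fun t w => / 30 * (6 * ((SJ 0 0 t w - e2c t) * (SJ 0 0 t w - e2c t)) - SJ 0 2 t w)) _ _ _ _ H).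
    + intros t w Hw. rewrite <- (e4_eqD t w Hw), SJ02_eq by auto. field.
    + pose proof (wp_cder_tau tau z H) as D. apply dom_iff in H as [Hy Hd].
      eapply cder_eq; [|apply cder_scal, cder_minus; [apply cder_scal, cder_mult; exact D|
        apply SJ_dtau; auto]].
      cbv beta. unfold W. ring.
  - rewrite <- (e2_eqD tau z H), <- (e4_eqD tau z H), <- (wp_eq tau z H), <- (wp1_eq tau z H), ztau_eq.
    replace (- (pii / 2) * (/ 30 * (12 * (W * (SJ 1 1 tau z - GJ 1 1 tau)) - SJ 1 3 tau z))) with
     (/ 30 * (12 * W * (- / 8 * (4 * pii * SJ 1 1 tau z) + / 4 * (2 * pii * GJ 1 1 tau))
        + / 8 * (4 * pii * SJ 1 3 tau z))) by field.
    rewrite SJ13_eq, SJ11_eq, SJ03_eq, SJ02_eq, GJ11_eq by (auto; apply (proj1 H)).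
    unfold W. field.
Qed.

(** * Rankin-Cohen brackets *)

Lemma dtau_is_ext f g l m : eqD f g -> eqD l m -> dtau_is f l -> dtau_is g m.
Proof.
  intros E1 E2 H tau z Hd. destruct (H tau z Hd) as [l' [H1 H2]]. exists l'. split.
  - now apply (cder_dom_tau f).
  - rewrite <- E2; auto.
Qed.
Lemma dtau_is_const c : dtau_is (fconst c) (fconst 0).
Proof. intros tau z Hd. exists 0. split. exact (cder_const c tau). unfold fconst; ring. Qed.
Lemma dtau_is_add f g l m : dtau_is f l -> dtau_is g m -> dtau_is (fadd f g) (fadd l m).
Proof.
  intros Hf Hg tau z Hd. destruct (Hf tau z Hd) as [l' [F1 F2]], (Hg tau z Hd) as [m' [G1 G2]].
  exists (l' + m'). split. exact (cder_plus _ _ _ _ _ F1 G1). unfold fadd. rewrite F2, G2; ring.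
Qed.
Lemma dtau_is_mul f g l m : dtau_is f l -> dtau_is g m ->
  dtau_is (fmul f g) (fadd (fmul l g) (fmul f m)).
Proof.
  intros Hf Hg tau z Hd. destruct (Hf tau z Hd) as [l' [F1 F2]], (Hg tau z Hd) as [m' [G1 G2]].
  exists (l' * g tau z + f tau z * m'). split. exact (cder_mult _ _ _ _ _ F1 G1).
  unfold fadd, fmul. rewrite F2, G2; ring.
Qed.

Definition xe2 : fn := fun tau z => e2 tau z / 4.
Definition phi4 : fn := fun tau z => - (5 / 16) * e4 tau z.
Lemma dtau_xe2 : dtau_is xe2 (fun tau z => xe2 tau z * xe2 tau z + phi4 tau z).
Proof.
  apply (dtau_is_ext (fmul (fconst (/ 4)) e2) _ (fadd (fmul (fconst 0) e2)
    (fmul (fconst (/ 4)) (fun tau z => (e2 tau z * e2 tau z - 5 * e4 tau z) / 4)))).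
  - intros tau z _. unfold fmul, fconst, xe2. field.
  - intros tau z _. unfold fadd, fmul, fconst, xe2, phi4. field.
  - apply dtau_is_mul; [apply dtau_is_const|apply dtau_e2].
Qed.

Local Notation hom := (homog JS0_gens).
Lemma hom_cast k k' f : k = k' -> hom k f -> hom k' f.
Proof. now intros ->. Qed.
Lemma hom_scal k c f : hom k f -> hom k (fscal c f).
Proof.
  intros H. apply (homog_ext _ _ (fmul (fconst c) f)). now intros tau z _.
  apply (homog_mul _ 0 k); auto. apply homog_const.
Qed.
Lemma hom_E1 : hom 1 E1.
Proof. apply homog_gen. simpl; tauto. Qed.
Lemma hom_wp : hom 2 wp.
Proof. apply homog_gen. simpl; tauto. Qed.
Lemma hom_wp1 : hom 3 (dz wp).
Proof. apply homog_gen. simpl; tauto. Qed.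
Lemma hom_e4 : hom 4 e4.
Proof. apply homog_gen. simpl; tauto. Qed.
(** [homog_const] gives constants weight 0 only; multiplication by E1, of weight 1, lifts zero to
    every weight. *)
Lemma hom_zero k : hom k (fconst 0).
Proof.
  induction k. apply homog_const.
  apply (homog_ext _ _ (fmul E1 (fconst 0))).
  - intros tau z _. unfold fmul, fconst. ring.
  - apply (homog_mul _ 1 k); auto. apply hom_E1.
Qed.
Lemma hom_phi4 k f : hom k f -> hom (4 + k) (fmul phi4 f).
Proof. intros H. apply homog_mul; auto. apply (hom_scal 4 (- (5 / 16)) e4), hom_e4. Qed.

(* The part of [dtau f] that leaves JS0. *)
Definition euler_part (k : nat) (f : fn) : fn := fun tau z => RtoC (INR k) * xe2 tau z * f tau z.

(** Both [dtau] and the Euler part satisfy the Leibniz rule, the latter because weights add; so only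
    the generators need explicit formulas. *)
Lemma hom_dtau k f : hom k f -> exists df, hom (k + 2) df /\ dtau_is f (fadd (euler_part k f) df).
Proof.
  induction 1 as [c|k g Hg|k f g _ [df [F1 F2]] _ [dg [G1 G2]]
    |k l f g Hf [df [F1 F2]] Hg [dg [G1 G2]]|k f g E _ [df [F1 F2]]].
  - exists (fconst 0). split. apply hom_zero.
    eapply dtau_is_ext; [| |apply (dtau_is_const c)]; intros tau z _; auto.
    unfold fadd, euler_part, fconst. simpl. ring.
  - simpl in Hg. destruct Hg as [E|[E|[E|[E|[]]]]]; inversion E; subst; clear E.
    + exists (fscal (/ 4) (fadd (fscal (-(2)) (fmul wp wp)) (fadd (fscal (-(1)) (fmul E1 (dz wp))) (fscal 20 e4)))).
      split.
      * apply hom_scal, homog_add; [|apply homog_add]; apply hom_scal.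
        apply (homog_mul _ 2 2); apply hom_wp.
        apply (homog_mul _ 1 3); [apply hom_E1|apply hom_wp1]. apply hom_e4.
      * eapply dtau_is_ext; [| |apply dtau_wp]; intros tau z _; auto.
        unfold fadd, euler_part, fscal, fmul, xe2. simpl INR. rewrite RtoC_plus. ring.
    + exists (fscal (/ 4) (fadd (fscal (-(3)) (fmul wp (dz wp)))
        (fadd (fscal (-(6)) (fmul E1 (fmul wp wp))) (fscal 30 (fmul E1 e4))))).
      split.
      * apply hom_scal, homog_add; [|apply homog_add]; apply hom_scal.
        apply (homog_mul _ 2 3); [apply hom_wp|apply hom_wp1].
        apply (homog_mul _ 1 4); [apply hom_E1|]. apply (homog_mul _ 2 2); apply hom_wp.
        apply (homog_mul _ 1 4); [apply hom_E1|apply hom_e4].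
      * eapply dtau_is_ext; [| |apply dtau_wp1]; intros tau z _; auto.
        unfold fadd, euler_part, fscal, fmul, xe2. simpl INR. rewrite !RtoC_plus. ring.
    + exists (fscal (/ 40) (fadd (fmul (dz wp) (dz wp)) (fadd (fscal (-(4)) (fmul wp (fmul wp wp)))
        (fscal 60 (fmul e4 wp))))).
      split.
      * apply hom_scal, homog_add; [|apply homog_add; apply hom_scal].
        apply (homog_mul _ 3 3); apply hom_wp1.
        apply (homog_mul _ 2 4); [apply hom_wp|]. apply (homog_mul _ 2 2); apply hom_wp.
        apply (homog_mul _ 4 2); [apply hom_e4|apply hom_wp].
      * eapply dtau_is_ext; [| |apply dtau_e4]; intros tau z _; auto.
        unfold fadd, euler_part, fscal, fmul, xe2. simpl INR. rewrite !RtoC_plus. ring.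
    + exists (fadd (fscal (/ 4) (fmul E1 wp)) (fscal (/ 8) (dz wp))). split.
      * apply homog_add; apply hom_scal; [|apply hom_wp1].
        apply (homog_mul _ 1 2); [apply hom_E1|apply hom_wp].
      * eapply dtau_is_ext; [| |apply dtau_E1]; intros tau z _; auto.
        unfold fadd, euler_part, fscal, fmul, xe2. simpl INR. ring.
  - exists (fadd df dg). split. now apply homog_add.
    eapply dtau_is_ext; [| |apply (dtau_is_add _ _ _ _ F2 G2)]; intros tau z _; auto.
    unfold fadd, euler_part. ring.
  - exists (fadd (fmul df g) (fmul f dg)). split.
    + apply homog_add.
      apply (hom_cast (k + 2 + l)); [lia|]. now apply homog_mul.
      apply (hom_cast (k + (l + 2))); [lia|]. now apply homog_mul.
    + eapply dtau_is_ext; [| |apply (dtau_is_mul _ _ _ _ F2 G2)]; intros tau z _; auto.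
      unfold fadd, fmul, euler_part. rewrite plus_INR, RtoC_plus. ring.
  - exists df. split; auto. eapply dtau_is_ext; [exact E| |exact F2].
    intros tau z Hd. unfold fadd, euler_part. now rewrite E.
Qed.

(** [hom] is a proposition and holds no polynomial to compute with, so the remainder is chosen; on
    [dom] it can only be dtau f - k X f. *)
Definition dpart (k : nat) (f : fn) : fn :=
  epsilon (inhabits f) (fun df => hom (k + 2) df /\ dtau_is f (fadd (euler_part k f) df)).
Lemma dpart_spec k f : hom k f ->
  hom (k + 2) (dpart k f) /\ dtau_is f (fadd (euler_part k f) (dpart k f)).
Proof. intros H. exact (epsilon_spec (inhabits f) _ (hom_dtau k f H)). Qed.

(* The pair [(phi_(s-1), phi_s)], where
   [(s+1)(k+s) phi_(s+1) = dpart phi_s + phi4 * phi_(s-1)]. *)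
Fixpoint phis (k : nat) (f : fn) (s : nat) : fn * fn :=
  match s with
  | O => (fconst 0, f)
  | S s' => let (p, c) := phis k f s' in
     (c, fscal (/ (RtoC (INR (S s')) * RtoC (INR (k + s'))))
           (fadd (dpart (k + 2 * s') c) (fmul phi4 p)))
  end.
Definition phi (k : nat) (f : fn) (s : nat) : fn := snd (phis k f s).
Definition phip (k : nat) (f : fn) (s : nat) : fn := fst (phis k f s).
Lemma phip_S k f s : phip k f (S s) = phi k f s.
Proof. unfold phip, phi. simpl. destruct (phis k f s); reflexivity. Qed.
Lemma phi_S k f s : phi k f (S s) = fscal (/ (RtoC (INR (S s)) * RtoC (INR (k + s))))
           (fadd (dpart (k + 2 * s) (phi k f s)) (fmul phi4 (phip k f s))).
Proof. unfold phip, phi. simpl. destruct (phis k f s); reflexivity. Qed.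

Lemma phi_hom k f : hom k f -> forall s, hom (k + 2 * s) (phi k f s) /\
  hom (k + 2 * s + 2) (fmul phi4 (phip k f s)).
Proof.
  intros H. induction s as [|s [IH1 IH2]].
  - split. apply (hom_cast k); [lia|]. exact H.
    apply (homog_ext _ _ (fconst 0)); [|apply hom_zero].
    intros tau z _. unfold phip; simpl; unfold fmul, fconst; ring.
  - rewrite phi_S, phip_S. split.
    + apply hom_scal. apply (hom_cast (k + 2 * s + 2)); [lia|].
      apply homog_add; auto. now apply dpart_spec.
    + apply (hom_cast (4 + (k + 2 * s))); [lia|]. now apply hom_phi4.
Qed.
(** The recursion for [phi] solved for the derivative; k > 0 keeps the divisor k + s nonzero at s =
    0. *)
Lemma phi_dtau k f s : (0 < k)%nat -> hom k f -> dtau_is (phi k f s) (fun tau z =>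
   RtoC (INR (k + 2 * s)) * xe2 tau z * phi k f s tau z
   + RtoC (INR (S s)) * RtoC (INR (k + s)) * phi k f (S s) tau z - phi4 tau z * phip k f s tau z).
Proof.
  intros Hk H. destruct (phi_hom k f H s) as [H1 H2].
  eapply dtau_is_ext; [| |apply (dpart_spec _ _ H1)]; intros tau z _; auto.
  rewrite phi_S. unfold fadd, fscal, fmul, euler_part.
  assert (RtoC (INR (S s)) <> 0) by (apply RtoC_nz, not_0_INR; lia).
  assert (RtoC (INR (k + s)) <> 0) by (apply RtoC_nz, not_0_INR; lia).
  field; auto.
Qed.

(** The coefficient x^j / j! of T^j in exp (x T). *)
Fixpoint ex (x : C) (j : nat) : C :=
  match j with O => 1 | S j' => / RtoC (INR (S j')) * (x * ex x j') end.
Lemma ex_S x j : RtoC (INR (S j)) * ex x (S j) = x * ex x j.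
Proof.
  assert (RtoC (INR (S j)) <> 0) by (apply RtoC_nz, not_0_INR; lia).
  change (ex x (S j)) with (/ RtoC (INR (S j)) * (x * ex x j)). field; auto.
Qed.
Definition exd (x : C) (j : nat) : C := match j with O => 0 | S j' => ex x j' end.
Lemma cder_ex j x : cder (fun x => ex x j) x (exd x j).
Proof.
  induction j.
  - exact (cder_const 1 x).
  - assert (N : RtoC (INR (S j)) <> 0) by (apply RtoC_nz, not_0_INR; lia).
    eapply cder_eq; [|apply (cder_scal (/ RtoC (INR (S j)))), cder_mult; [apply cder_id|exact IHj]].
    cbv beta. destruct j as [|j].
    + simpl. field.
    + change (/ RtoC (INR (S (S j))) * (1 * (/ RtoC (INR (S j)) * (x * ex x j)) + x * ex x j) =
        / RtoC (INR (S j)) * (x * ex x j)).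
      assert (N' : RtoC (INR (S j)) <> 0) by (apply RtoC_nz, not_0_INR; lia).
      rewrite (S_INR (S j)), RtoC_plus in *. field; auto.
Qed.
(** The coefficient of T^r in exp (x T) times the generating series of a; [shift1] is multiplication
    by T. *)
Definition econv (x : C) (a : nat -> C) (r : nat) : C :=
  lsum (fun j => ex x j * a (r - j)%nat) (seq 0 (S r)).
Definition shift1 (u : nat -> C) (r : nat) : C := match r with O => 0 | S r' => u r' end.

Lemma lsum_seq_S (u : nat -> C) m : lsum u (seq 0 (S m)) = lsum u (seq 0 m) + u m.
Proof. rewrite seq_S, lsum_app. simpl. ring. Qed.
Lemma lsum_seq_shift (u : nat -> C) m : lsum u (seq 0 (S m)) = u O + lsum (fun j => u (S j)) (seq 0 m).
Proof. rewrite <- cons_seq, <- seq_shift. simpl. now rewrite lsum_map. Qed.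
Lemma cder_lsum {I} (u : I -> C -> C) (v : I -> C) x l :
  (forall i, In i l -> cder (u i) x (v i)) -> cder (fun x => lsum (fun i => u i x) l) x (lsum v l).
Proof.
  induction l; intros H. exact (cder_const 0 x).
  apply (cder_plus (u a) (fun x => lsum (fun i => u i x) l)).
  apply H; now left. apply IHl. intros; apply H; now right.
Qed.
(** Differentiating exp (x T) in x multiplies the series by T. *)
Lemma cder_econv a r x : cder (fun x => econv x a r) x (shift1 (econv x a) r).
Proof.
  eapply cder_eq; [|apply (cder_lsum (fun j x => ex x j * a (r - j)%nat) (fun j => exd x j * a (r - j)%nat))].
  - destruct r.
    + simpl. ring.
    + rewrite lsum_seq_shift. simpl exd at 1. simpl shift1. unfold econv.
      rewrite Cmult_0_l, Cplus_0_l. reflexivity.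
  - intros j _. eapply cder_eq; [|apply cder_mult; [apply cder_ex|apply cder_const]]. cbv beta; ring.
Qed.
Lemma econv_0 a r : econv 0 a r = a r.
Proof.
  unfold econv. rewrite lsum_seq_shift, lsum_zero. simpl ex. rewrite Nat.sub_0_r. ring.
  intros j _. simpl. ring.
Qed.

(* The left-hand side has derivative zero in [x]. *)
Lemma econv_alternating (a b : nat -> C) n x :
  lsum (fun r => (-(1)) ^ r * (econv x a r * econv x b (n - r))) (seq 0 (S n)) =
  lsum (fun r => (-(1)) ^ r * (a r * b (n - r)%nat)) (seq 0 (S n)).
Proof.
  set (W := fun x => lsum (fun r => (-(1)) ^ r * (econv x a r * econv x b (n - r))) (seq 0 (S n))).
  assert (D : forall y, cder W y 0).
  { intros y. set (F := econv y a). set (G := econv y b).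
    (* The Leibniz terms of consecutive r cancel by the alternating sign, so the partial sums
       telescope; the boundary term at m = n contains [shift1 G 0], which is 0. *)
    assert (T : forall m, (m <= n)%nat ->
      lsum (fun r => (-(1)) ^ r * (shift1 F r * G (n - r)%nat + F r * shift1 G (n - r))) (seq 0 (S m))
      = (-(1)) ^ m * (F m * shift1 G (n - m))).
    { induction m; intros Hm.
      - simpl. ring.
      - rewrite lsum_seq_S, IHm by lia. replace (n - m)%nat with (S (n - S m)) by lia.
        simpl shift1. rewrite Cpow_S. ring. }
    specialize (T n (le_n _)). rewrite Nat.sub_diag in T.
    eapply cder_eq; [|apply (cder_lsum (fun r y => (-(1)) ^ r * (econv y a r * econv y b (n - r))))].
    - rewrite T. simpl shift1. ring.
    - intros r _. eapply cder_eq; [|apply cder_scal, cder_mult; apply cder_econv].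
      reflexivity. }
  assert (E : W x = W 0).
  { apply Csub_0, Cmod_eq_0, Rle_antisym; [|apply Cmod_ge_0].
    pose proof (cder_mvt W (fun _ => 0) 0 x 0) as M. replace (0 + x) with x in M by ring.
    eapply Rle_trans; [apply M|]. 2: right; ring.
    intros t Ht. split; auto. rewrite Cmod_0; lra. }
  change (W x = lsum (fun r => (-(1)) ^ r * (a r * b (n - r)%nat)) (seq 0 (S n))).
  rewrite E. apply lsum_ext. intros r _. now rewrite !econv_0.
Qed.

Lemma dtau_is_comp (h h' : C -> C) f l : (forall x, cder h x (h' x)) -> dtau_is f l ->
  dtau_is (fun tau z => h (f tau z)) (fun tau z => h' (f tau z) * l tau z).
Proof.
  intros Hh Hf tau z Hd. destruct (Hf tau z Hd) as [l' [F1 F2]].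
  exists (h' (f tau z) * l'). split.
  - apply (cder_comp h (fun t => f t z)); auto.
  - rewrite F2; ring.
Qed.
Lemma dtau_is_lsum {I} (u v : I -> fn) l : (forall i, In i l -> dtau_is (u i) (v i)) ->
  dtau_is (fun tau z => lsum (fun i => u i tau z) l) (fun tau z => lsum (fun i => v i tau z) l).
Proof.
  induction l; intros H. apply (dtau_is_const 0).
  apply (dtau_is_add (u a) (fun tau z => lsum (fun i => u i tau z) l) (v a)).
  apply H; now left. apply IHl. intros; apply H; now right.
Qed.

(** For j + s = r + 1 the coefficient of [ex x j] times a_s is j (j - 1) + j (k + 2 s) + s (k + s -
    1) = (r + 1) (k + r). The terms in w cancel between neighbouring j, because ap is a shifted by
    one. *)
Lemma econv_recursion (a ap : nat -> C) (x w : C) (k r : nat) :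
  ap O = 0 -> (forall s, ap (S s) = a s) ->
  lsum (fun j => exd x j * (x * x + w) * a (r - j)%nat + ex x j *
     (RtoC (INR (k + 2 * (r - j))) * x * a (r - j)%nat +
      RtoC (INR (S (r - j))) * RtoC (INR (k + (r - j))) * a (S (r - j)) - w * ap (r - j)%nat))
    (seq 0 (S r)) =
  RtoC (INR (S r)) * RtoC (INR (k + r)) * econv x a (S r).
Proof.
  intros ap0 apS. set (c := RtoC (INR (S r)) * RtoC (INR (k + r))).
  set (u := fun j => _ + ex x j * _).
  (* The two boundary terms of a partial sum both vanish at m = r, the second because [ap 0 = 0]. *)
  assert (T : forall m, (m <= r)%nat -> lsum u (seq 0 (S m)) =
    c * lsum (fun j => ex x j * a (S r - j)%nat) (seq 0 (S (S m)))
    - (RtoC (INR r) - RtoC (INR m)) * (RtoC (INR k) + RtoC (INR r) - RtoC (INR m) - 1) * (ex x (S m) * a (r - m)%nat)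
    - w * ex x m * ap (r - m)%nat).
  { induction m as [|m IH]; intros Hm.
    - simpl seq. simpl lsum. unfold u. simpl exd. rewrite Nat.sub_0_r.
      replace (/ 1 * (x * 1)) with x by field.
      unfold c. rewrite !plus_INR, !S_INR, mult_INR, !RtoC_plus, RtoC_mult. simpl (INR 2). rewrite RtoC_plus. simpl ex.
      simpl (INR 0). simpl (INR 1). field.
    - rewrite lsum_seq_S, IH by lia. rewrite (lsum_seq_S _ (S (S m))).
      assert (Er : exists i, r = (S m + i)%nat) by (exists (r - S m)%nat; lia).
      destruct Er as [i Er].
      replace (r - m)%nat with (S i) by lia. replace (r - S m)%nat with i by lia.
      replace (S r - S (S m))%nat with i by lia.
      rewrite apS. unfold u. replace (r - S m)%nat with i by lia. simpl exd.
      pose proof (ex_S x m) as X1. pose proof (ex_S x (S m)) as X2.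
      set (e0 := ex x m) in *. set (e1 := ex x (S m)) in *. set (e2 := ex x (S (S m))) in *.
      clearbody e0 e1 e2.
      replace (e0 * (x * x + w) * a i) with (x * (x * e0) * a i + e0 * w * a i) by ring.
      rewrite <- X1.
      replace (x * (RtoC (INR (S m)) * e1)) with (RtoC (INR (S m)) * (x * e1)) by ring.
      replace (e1 * (RtoC (INR (k + 2 * i)) * x * a i +
        RtoC (INR (S i)) * RtoC (INR (k + i)) * a (S i) - w * ap i)) with
        (RtoC (INR (k + 2 * i)) * (x * e1) * a i + e1 *
        (RtoC (INR (S i)) * RtoC (INR (k + i)) * a (S i) - w * ap i)) by ring.
      rewrite <- X2. unfold c. rewrite Er.
      repeat rewrite ?S_INR, ?plus_INR, ?mult_INR, ?RtoC_plus, ?RtoC_mult. simpl (INR 2). simpl (INR 0).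
      rewrite ?RtoC_plus. ring. }
  rewrite (T r (le_n _)), Nat.sub_diag, ap0. unfold econv. ring.
Qed.

Definition Fr (k : nat) (f : fn) (r : nat) : fn :=
  fun tau z => econv (xe2 tau z) (fun s => phi k f s tau z) r.
(** The derivatives of X and of the [phi] combine by [econv_recursion]; the recursion defining [phi]
    is made for the result to be a multiple of the next [Fr]. *)
Lemma Fr_dtau k f r : (0 < k)%nat -> hom k f ->
  dtau_is (Fr k f r) (fun tau z => RtoC (INR (S r)) * RtoC (INR (k + r)) * Fr k f (S r) tau z).
Proof.
  intros Hk H. unfold Fr at 1. unfold econv.
  eapply dtau_is_ext; [| |apply (dtau_is_lsum (fun j => fmul (fun tau z => ex (xe2 tau z) j) (phi k f (r - j))))];
    [intros tau z _; reflexivity| |].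
  2:{ intros j _. apply dtau_is_mul; [apply (dtau_is_comp (fun x => ex x j) (fun x => exd x j));
        [apply cder_ex|apply dtau_xe2]|now apply phi_dtau]. }
  intros tau z _. unfold Fr.
  rewrite <- (econv_recursion (fun s => phi k f s tau z) (fun s => phip k f s tau z) _ (phi4 tau z)).
  - apply lsum_ext. intros j _. unfold fadd, fmul. reflexivity.
  - reflexivity.
  - intros s. now rewrite phip_S.
Qed.

(** r! times the rising factorial k (k + 1) ... (k + r - 1). *)
Fixpoint rho (k r : nat) : R :=
  match r with O => 1%R | S r' => (INR (S r') * INR (k + r') * rho k r')%R end.
Lemma iter_dtau k f r : (0 < k)%nat -> hom k f ->
  eqD (Nat.iter r dtau f) (fun tau z => RtoC (rho k r) * Fr k f r tau z).
Proof.
  intros Hk H. induction r.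
  - intros tau z _. simpl. unfold Fr, econv, phi; simpl. ring.
  - simpl Nat.iter. apply dtau_is_eq.
    eapply dtau_is_ext; [| |apply (dtau_is_mul _ _ _ _ (dtau_is_const (RtoC (rho k r))) (Fr_dtau k f r Hk H))].
    + intros tau z Hd. rewrite IHr by auto. reflexivity.
    + intros tau z _. unfold fadd, fmul, fconst.
      change (rho k (S r)) with (INR (S r) * INR (k + r) * rho k r)%R. rewrite !RtoC_mult. ring.
Qed.

(** * Binomial coefficients and brackets of homogeneous forms *)

Lemma leq_of_le m n : (m <= n)%nat -> ssrnat.leq m n = true.
Proof. intros H. destruct (@ssrnat.leP m n); [reflexivity|contradiction]. Qed.
Lemma binomial_fact n m : (m <= n)%nat ->
  (INR (binomial.binomial n m) * (INR (fact m) * INR (fact (n - m))) = INR (fact n))%R.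
Proof.
  intros H.
  assert (Hf : forall j, ssrnat.factorial j = fact j).
  { induction j; auto. change (ssrnat.factorial (S j)) with (S j * ssrnat.factorial j)%nat.
    rewrite IHj. reflexivity. }
  rewrite <- !mult_INR. f_equal.
  pose proof (@binomial.bin_fact n m (leq_of_le m n H)) as E.
  rewrite !Hf in E. exact E.
Qed.
Lemma rho_fact k r : (rho (S k) r * INR (fact k) = INR (fact r) * INR (fact (k + r)))%R.
Proof.
  induction r. simpl rho. rewrite Nat.add_0_r. simpl fact. simpl INR. ring.
  change (rho (S k) (S r)) with (INR (S r) * INR (S k + r) * rho (S k) r)%R.
  replace (INR (S r) * INR (S k + r) * rho (S k) r * INR (fact k))%R with
    (INR (S r) * INR (S k + r) * (rho (S k) r * INR (fact k)))%R by ring.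
  rewrite IHr. replace (k + S r)%nat with (S (k + r)) by lia.
  change (fact (S r)) with (S r * fact r)%nat. change (fact (S (k + r))) with (S (k + r) * fact (k + r))%nat.
  rewrite !mult_INR. simpl (S k + r)%nat. ring.
Qed.
(** The binomials of the bracket offset the factors [rho]: the product is the same for all r, which
    leaves one constant times an alternating convolution. *)
Lemma rc_coeff k l n r : (r <= n)%nat ->
  (INR (binomial.binomial (S k + n - 1) (n - r)) * INR (binomial.binomial (S l + n - 1) r)
    * (rho (S k) r * rho (S l) (n - r)) * (INR (fact k) * INR (fact l)) =
   INR (fact (k + n)) * INR (fact (l + n)))%R.
Proof.
  intros H. replace (S k + n - 1)%nat with (k + n)%nat by lia.
  replace (S l + n - 1)%nat with (l + n)%nat by lia.
  rewrite <- (binomial_fact (k + n) (n - r)) by lia.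
  rewrite <- (binomial_fact (l + n) r) by lia.
  replace (k + n - (n - r))%nat with (k + r)%nat by lia.
  replace (l + n - r)%nat with (l + (n - r))%nat by lia.
  pose proof (rho_fact k r) as E1. pose proof (rho_fact l (n - r)) as E2.
  set (b1 := INR (binomial.binomial _ _)). set (b2 := INR (binomial.binomial _ _)).
  transitivity (b1 * b2 * (rho (S k) r * INR (fact k)) * (rho (S l) (n - r) * INR (fact l)))%R; [ring|].
  rewrite E1, E2. ring.
Qed.

Lemma subalg_lsum gens {I} (u : I -> fn) l : (forall i, In i l -> subalg gens (u i)) ->
  subalg gens (fun tau z => lsum (fun i => u i tau z) l).
Proof.
  induction l; intros H. apply (subalg_const gens 0).
  apply (subalg_add gens (u a) (fun tau z => lsum (fun i => u i tau z) l)).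
  apply H; now left. apply IHl. intros; apply H; now right.
Qed.
Lemma homog_subalg gens k f : homog gens k f -> subalg (map snd gens) f.
Proof.
  induction 1.
  - apply subalg_const.
  - apply subalg_gen. now apply (in_map snd) in H.
  - now apply subalg_add.
  - now apply subalg_mul.
  - now apply subalg_ext with f.
Qed.
Lemma homog_incl gens gens' k f : incl gens gens' -> homog gens k f -> homog gens' k f.
Proof.
  intros Hi. induction 1.
  - apply homog_const.
  - apply homog_gen; auto.
  - now apply homog_add.
  - now apply homog_mul.
  - now apply homog_ext with f.
Qed.
Lemma hom_JS0 k f : hom k f -> JS0 f.
Proof. apply homog_subalg. Qed.
Lemma hom_JSinf_wt k f : hom k f -> JSinf_wt k f.
Proof. apply homog_incl. intros p Hp. apply in_or_app. auto. Qed.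
Lemma hom_JSinf k f : hom k f -> JSinf f.
Proof. intros H. apply (homog_subalg _ k), hom_JSinf_wt, H. Qed.

(** All generators have positive weight, so weight 0 is built from constants alone. *)
Lemma hom_weight0 k f : hom k f -> k = 0%nat -> exists c, eqD f (fconst c).
Proof.
  induction 1 as [c|k g Hg|k f g _ IHf _ IHg|k l f g _ IHf _ IHg|k f g E _ IH]; intros Hk.
  - exists c. now intros tau z _.
  - subst k. simpl in Hg. destruct Hg as [E|[E|[E|[E|[]]]]]; inversion E.
  - destruct (IHf Hk) as [c Hc], (IHg Hk) as [d Hd]. exists (c + d). intros tau z H.
    unfold fadd. rewrite Hc, Hd by auto. reflexivity.
  - destruct IHf as [c Hc]; [lia|]. destruct IHg as [d Hd]; [lia|]. exists (c * d). intros tau z H.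
    unfold fmul. rewrite Hc, Hd by auto. reflexivity.
  - destruct (IH Hk) as [c Hc]. exists c. intros tau z H. rewrite <- E, Hc; auto.
Qed.
Lemma iter_dtau_const f c r : eqD f (fconst c) -> eqD (Nat.iter (S r) dtau f) (fconst 0).
Proof.
  intros Hf. induction r.
  - apply dtau_is_eq. apply (dtau_is_ext (fconst c) _ (fconst 0)); [| |apply dtau_is_const].
    intros tau z H; now rewrite Hf. now intros tau z _.
  - change (Nat.iter (S (S r)) dtau f) with (dtau (Nat.iter (S r) dtau f)).
    apply dtau_is_eq. apply (dtau_is_ext (fconst 0) _ (fconst 0)); [| |apply dtau_is_const].
    intros tau z H; now rewrite IHr. now intros tau z _.
Qed.
Lemma binomial_small m n : (m < n)%nat -> binomial.binomial m n = 0%nat.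
Proof. intros H. apply binomial.bin_small. now apply leq_of_le. Qed.

Lemma rc_homog_lsum n k l f g tau z : rc_homog n k l f g tau z = lsum (fun r =>
    (- (1)) ^ r * RtoC (INR (binomial.binomial (k + n - 1) (n - r))) *
    RtoC (INR (binomial.binomial (l + n - 1) r)) *
    Nat.iter r dtau f tau z * Nat.iter (n - r) dtau g tau z) (seq 0 (S n)).
Proof.
  unfold rc_homog. rewrite sum_n_lsum. apply lsum_ext. intros r _.
  now replace (RtoC (-1)) with (- RtoC 1) by now rewrite <- RtoC_opp.
Qed.

Lemma rc_homog_JS0 n k l f g : hom k f -> hom l g -> JS0 (rc_homog n k l f g).
Proof.
  intros Hf Hg. destruct n as [|n].
  { apply (subalg_ext _ (fmul f g)).
    - intros tau z _. rewrite rc_homog_lsum. simpl seq. simpl lsum. rewrite !binomial.bin0.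
      simpl. unfold fmul. ring.
    - apply subalg_mul; [apply (hom_JS0 k f Hf)|apply (hom_JS0 l g Hg)]. }
  (* In weight 0, f is constant: terms with r >= 1 contain its derivative, and at r = 0 the first
     binomial has lower index one above its upper index. *)
  destruct k as [|k].
  { destruct (hom_weight0 _ _ Hf eq_refl) as [c Hc].
    apply (subalg_ext _ (fconst 0)); [|apply subalg_const].
    intros tau z H. rewrite rc_homog_lsum, lsum_zero; auto. intros [|r] _.
    - rewrite binomial_small by lia. simpl INR. ring.
    - rewrite (iter_dtau_const f c r Hc) by auto. unfold fconst. ring. }
  (* Symmetrically, only the last r escapes a derivative of g, and there the second binomial
     vanishes. *)
  destruct l as [|l].
  { destruct (hom_weight0 _ _ Hg eq_refl) as [c Hc].
    apply (subalg_ext _ (fconst 0)); [|apply subalg_const].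
    intros tau z H. rewrite rc_homog_lsum, lsum_zero; auto. intros r Hr. apply in_seq in Hr.
    destruct (Nat.eq_dec r (S n)) as [->|Nr].
    - rewrite (binomial_small (0 + S n - 1)) by lia. simpl INR. ring.
    - replace (S n - r)%nat with (S (n - r)) by lia.
      rewrite (iter_dtau_const g c _ Hc) by auto. unfold fconst. ring. }
  set (N := S n).
  set (K := (INR (fact (k + N)) * INR (fact (l + N)) / (INR (fact k) * INR (fact l)))%R).
  apply (subalg_ext _ (fmul (fconst (RtoC K)) (fun tau z =>
    lsum (fun r => fmul (fconst ((- (1)) ^ r)) (fmul (phi (S k) f r) (phi (S l) g (N - r))) tau z) (seq 0 (S N))))).
  - intros tau z H. rewrite rc_homog_lsum. fold N. unfold fmul, fconst.
    (* Reintroducing X turns each [phi] into the corresponding [Fr], hence into an iterated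
       derivative divided by [rho]. *)
    rewrite <- (econv_alternating (fun r => phi (S k) f r tau z) (fun r => phi (S l) g r tau z) N (xe2 tau z)).
    rewrite <- lsum_scal. apply lsum_ext. intros r Hr. apply in_seq in Hr.
    rewrite (iter_dtau (S k) f r) by (auto; lia). rewrite (iter_dtau (S l) g (N - r)) by (auto; lia).
    unfold Fr. set (u := econv _ _ r). set (v := econv _ _ (N - r)).
    assert (EK : (K = INR (binomial.binomial (S k + N - 1) (N - r)) * INR (binomial.binomial (S l + N - 1) r)
      * (rho (S k) r * rho (S l) (N - r)))%R).
    { unfold K. rewrite <- (rc_coeff k l N r) by lia.
      pose proof (INR_fact_neq_0 k). pose proof (INR_fact_neq_0 l). field. auto. }
    rewrite EK, !RtoC_mult. ring.
  - apply subalg_mul; [apply subalg_const|]. apply subalg_lsum. intros r _.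
    apply subalg_mul; [apply subalg_const|].
    apply subalg_mul; [apply (hom_JS0 _ _ (proj1 (phi_hom _ _ Hf r)))|
      apply (hom_JS0 _ _ (proj1 (phi_hom _ _ Hg (N - r))))].
Qed.

(** * Reduction to homogeneous forms *)

Definition fsum (L : list fn) : fn := fold_right fadd (fconst 0) L.
Definition homogeneous (f : fn) : Prop := exists k, hom k f.
Lemma fsum_app L M : eqD (fsum (L ++ M)) (fadd (fsum L) (fsum M)).
Proof.
  intros tau z H. induction L; simpl; unfold fadd in *.
  - unfold fconst; ring.
  - rewrite IHL. ring.
Qed.
Lemma fsum_mul L M : List.Forall homogeneous L -> List.Forall homogeneous M ->
  exists P, List.Forall homogeneous P /\ eqD (fmul (fsum L) (fsum M)) (fsum P).
Proof.
  intros HL HM. induction HL as [|f L [k Hf] _ [P [HP EP]]].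
  - exists nil. split; auto. intros tau z _. unfold fmul; simpl. unfold fconst; ring.
  - exists (map (fmul f) M ++ P). split.
    + apply Forall_app; split; auto. rewrite Forall_forall in *. intros h Hh.
      apply in_map_iff in Hh. destruct Hh as [g [<- Hg]]. destruct (HM g Hg) as [l Hl].
      exists (k + l)%nat. now apply homog_mul.
    + intros tau z H. rewrite fsum_app by auto. unfold fadd. rewrite <- EP by auto.
      assert (E : fsum (map (fmul f) M) tau z = f tau z * fsum M tau z).
      { clear. induction M; simpl; unfold fadd, fmul, fconst in *; [ring|rewrite IHM; ring]. }
      rewrite E. unfold fmul. simpl. unfold fadd. ring.
Qed.
(** [subalg] carries no weights, while the bracket is explicit on homogeneous arguments only; the
    decomposition follows the construction of f. *)
Lemma JS0_decompose f : JS0 f -> exists L, List.Forall homogeneous L /\ eqD f (fsum L).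
Proof.
  intros H. induction H as [c|g Hg|f g _ [L [HL EL]] _ [M [HM EM]]
    |f g _ [L [HL EL]] _ [M [HM EM]]|f g E _ [L [HL EL]]].
  - exists [fconst c]. split. repeat constructor. exists 0%nat. apply homog_const.
    intros tau z _. simpl. unfold fadd, fconst. ring.
  - exists [g]. split.
    + repeat constructor. apply in_map_iff in Hg. destruct Hg as [[k g'] [E Hg]]. simpl in E. subst g'.
      exists k. now apply homog_gen.
    + intros tau z _. simpl. unfold fadd, fconst. ring.
  - exists (L ++ M). split. now apply Forall_app.
    intros tau z H. rewrite fsum_app by auto. unfold fadd. rewrite EL, EM; auto.
  - destruct (fsum_mul L M HL HM) as [P [HP EP]]. exists P. split; auto.
    intros tau z H. rewrite <- EP by auto. unfold fmul. rewrite EL, EM; auto.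
  - exists L. split; auto. intros tau z H. rewrite <- E by auto. now apply EL.
Qed.
Lemma fsum_JSinf L : List.Forall homogeneous L -> JSinf (fsum L).
Proof.
  induction 1 as [|f L [k Hf] _ IH]. apply subalg_const.
  apply subalg_add; auto. now apply hom_JSinf with k.
Qed.
Lemma eqD_sym f g : eqD f g -> eqD g f.
Proof. intros E tau z H. symmetry. now apply E. Qed.

Lemma rankin_cohen_JS0 B n : is_rankin_cohen B -> forall L M,
  List.Forall homogeneous L -> List.Forall homogeneous M -> JS0 (B n (fsum L) (fsum M)).
Proof.
  intros HB.
  (* The empty sum is the constant 0, a form of weight 0, so the base cases also fall under
     [rc_wt]. *)
  assert (H0 : homogeneous (fconst 0)) by (exists 0%nat; apply homog_const).
  assert (H1 : forall f g, homogeneous f -> homogeneous g -> JS0 (B n f g)).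
  { intros f g [k Hf] [l Hg]. apply (subalg_ext _ (rc_homog n k l f g)).
    - apply eqD_sym. apply (rc_wt B HB); now apply hom_JSinf_wt.
    - now apply rc_homog_JS0. }
  assert (H2 : forall f M, homogeneous f -> List.Forall homogeneous M -> JS0 (B n f (fsum M))).
  { intros f M Hf HM. induction HM as [|g M Hg HM IH]; [now apply H1|].
    apply (subalg_ext _ (fadd (B n f g) (B n f (fsum M)))).
    - apply eqD_sym. destruct Hf as [k Hf], Hg as [l Hg].
      apply (rc_addr B HB); [now apply hom_JSinf with k|now apply hom_JSinf with l|now apply fsum_JSinf].
    - apply subalg_add; auto. now apply H1. }
  intros L M HL HM. induction HL as [|f L Hf HL IH]; [now apply H2|].
  apply (subalg_ext _ (fadd (B n f (fsum M)) (B n (fsum L) (fsum M)))).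
  - apply eqD_sym. destruct Hf as [k Hf].
    apply (rc_addl B HB); [now apply hom_JSinf with k|now apply fsum_JSinf|now apply fsum_JSinf].
  - apply subalg_add; auto. now apply H2.
Qed.

Theorem theorem31 :
  forall B : nat -> fn -> fn -> fn, is_rankin_cohen B ->
  forall (n : nat) (f g : fn), JS0 f -> JS0 g -> JS0 (B n f g).
Proof.
  intros B HB n f g Hf Hg.
  destruct (JS0_decompose f Hf) as [L [HL EL]], (JS0_decompose g Hg) as [M [HM EM]].
  apply (subalg_ext _ (B n (fsum L) (fsum M))); [|now apply rankin_cohen_JS0].
  apply (rc_ext B HB); auto using fsum_JSinf, eqD_sym.
Qed.
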